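(* Let $P$ be a locally geometric poset with associated matroid prescheme $M=M(P)$, let $a$ be a distinguished atom, and let $(M,M',M'')$ be the corresponding triple of matroid preschemes (deletion $M'$ and contraction $M''$ with respect to $a$). Let $P'$ and $P''$ be the posets of flats of $M'$ and $M''$, and let $A=A(P)$, $A'=A(P')$, $A''=A(P'')$ be the Orlik–Solomon algebras. Then $A'$ is a subalgebra of $A$, and there exists a short exact sequence of vector spaces $$0\to A'\to A\to A''\to 0.$$
   Context: All posets are finite. For a poset $P$ and $x\in P$, $P_{\le x}=\{y\in P: y\le x\}$. For $T\subseteq P$, $\bigvee T$ is the set of minimal common upper bounds of $T$ and $\bigwedge T$ the set of maximal common lower bounds; $x\vee y$ and $x\wedge y$ denote the sets $\bigvee\{x,y\}$ and $\bigwedge\{x,y\}$. A lattice is a poset in which all $x\vee y$ and $x\wedge y$ are singletons. A poset with minimum $\hat 0$ is ranked if there is an order-preserving $\rho:P\to\mathbb{Z}_{\ge0}$ with $\rho(\hat 0)=0$ and $\rho(y)=\rho(x)+1$ whenever $y$ covers $x$; $\operatorname{at}(P)$ is the set of rank-one elements (atoms). A geometric lattice is a ranked lattice that is atomic (every element is a join of atoms) and semimodular ($\rho(x)+\rho(y)\ge\rho(x\vee y)+\rho(x\wedge y)$). $P$ is locally geometric if it is ranked, has a minimum $\hat 0$, and $P_{\le x}$ is a geometric lattice for every $x\in P$. A simplicial poset is a finite poset $S$ with minimum $\hat 0$ such that every $S_{\le\alpha}$ is isomorphic to the Boolean lattice $2^{\operatorname{at}(\alpha)}$, where $\operatorname{at}(\alpha)$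 is the set of atoms of $S$ below $\alpha$; $|\alpha|=|\operatorname{at}(\alpha)|$. For $a\in\operatorname{at}(\alpha)$, $\alpha\setminus a$ is the unique element of $S_{\le\alpha}$ with atom set $\operatorname{at}(\alpha)\setminus\{a\}$. A matroid prescheme is a pair $(S,I)$ with $S$ a finite simplicial poset and $I\subseteq S$ such that: (I1) $I\neq\varnothing$; (I2) $\alpha\le\beta\in I$ implies $\alpha\in I$; (I3) if $\alpha,\beta\in I$, $|\alpha|<|\beta|$ and $\gamma\in\alpha\vee\beta$, there is an atom $b\le\beta$ with $b\not\le\alpha$ and $(\alpha\vee b)\cap S_{\le\gamma}\subseteq I$; (I4) if $\alpha,\beta\in S$, $\nu$ is a maximal element of $I\cap S_{\le\alpha}$, and $\nu\le\beta$, then $\alpha\vee\beta\ne\varnothing$. A circuit is a minimal element of $S\setminus I$; $\omega\in S$ is $\zeta$-unicircular if $\zeta$ is the unique circuit with $\zeta\le\omega$. A flat is an element $x\in S$ such that for every circuit $\zeta$ covering some $\alpha\le x$ one has $\zeta\le x$; the poset of flats is the subposet of $S$ of flats. A matroid prescheme is simple if every atom is a flat and not a circuit. Posets of flats of matroid preschemes are exactly the locally geometric posets up to isomorphism, and each locally geometric poset is the poset of flats of a unique simple matroid prescheme up to isomorphism. For a locally geometric poset $P$, $M(P)=(S(P),I(P))$ is the (simple) matroid prescheme with $S(P)=\{(x,T): T\subseteq\operatorname{at}(P),\ x\in\bigvee T\}$, a subposet of $P\times2^{\operatorname{at}(P)}$, and $I(P)=\{(x,T)\in S(P):\rho(x)=|T|\}$;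 atoms $(a,\{a\})$ are identified with $a\in\operatorname{at}(P)$. For a simple matroid prescheme $M=(S,I)$ and atom $a$ of $S$, the deletion is $M'=(S_{\not\ge a},I_{\not\ge a})$ and the contraction is $M''=(S_{\ge a},I_{\ge a})$, where subscripts denote the subsets of elements not $\ge a$, resp. $\ge a$. Fix a linear order on atoms. For elements (or sets of atoms) with disjoint atom sets $A,B$, $\operatorname{sgn}(A,B)$ is the sign of the permutation sorting the concatenation of $A$ and $B$ (each listed increasingly) into increasing order. With $(S,I)=M(P)$, $E(P)$ is the free graded-commutative $\mathbb{Q}$-algebra on generators $e_\alpha$, $\alpha\in I\setminus\{\hat 0\}$, with $\deg e_\alpha=|\alpha|$, and $J(P)$ is the ideal generated by: (i) $e_\alpha e_\beta$ when $\alpha\wedge\beta\ne\{\hat 0\}$; (ii) $e_\alpha e_\beta-\operatorname{sgn}(\alpha,\beta)\sum_{\gamma\in(\alpha\vee\beta)\cap I}e_\gamma$ when $\alpha\wedge\beta=\{\hat 0\}$; (iii) $\sum_{b\in\operatorname{at}(\zeta)}\operatorname{sgn}(b,\omega\setminus b)e_{\omega\setminus b}$ when $\omega$ is $\zeta$-unicircular. $A(P)=E(P)/J(P)$. The deletion $M'$ of $M(P)$ is simple, so $M(P')\cong M'$ and (with the induced order on atoms) $E(P')$ is identified with the subalgebra of $E(P)$ generated by the $e_\alpha$ with $\alpha\in I_{\not\ge a}\setminus\{\hat0\}$; ''$A'$ is a subalgebra of $A$'' is understood via the map $A'\to A$, $e_\alpha\mapsto e_\alpha$, induced by this inclusion.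 *)

(* Defs.v *)
From HB Require Import structures.
From mathcomp Require Import all_boot all_order all_fingroup all_algebra.
From mathcomp Require Import generic_quotient ring_quotient.
From mathcomp Require Import boolp.
From mathcomp Require finmap.
From mathcomp.multinomials Require Import monalg.

Set Implicit Arguments.
Unset Strict Implicit.
Unset Printing Implicit Defensive.

Import Order.DefaultProdOrder Order.DefaultSetSubsetOrder.
Import Order.TTheory GRing.Theory Num.Theory.

Local Open Scope ring_scope.

Definition subposet d (P : finPOrderType d) (p : pred P) := {x : P | p x}.

Section SubposetOrder.
Variables (d : Order.disp_t) (P : finPOrderType d) (p : pred P).
HB.instance Definition _ := SubFinite.on (subposet p).
HB.instance Definition _ := [SubChoice_isSubPOrder of subposet p by <: with d].
End SubposetOrder.

Section Posets.
Local Open Scope order_scope.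
Variables (d : Order.disp_t) (P : finPOrderType d).
Implicit Types (x y z : P) (T : {set P}).

(* The set {0^} of minimum elements; it is empty if there is no minimum. *)
Definition bottoms : {set P} := [set x | [forall y, x <= y]].

Definition upper_bounds T : {set P} := [set z | [forall t in T, t <= z]].
Definition lower_bounds T : {set P} := [set z | [forall t in T, z <= t]].

Definition joins T : {set P} :=
  [set z in upper_bounds T | [forall w in upper_bounds T, ~~ (w < z)]].
Definition meets T : {set P} :=
  [set z in lower_bounds T | [forall w in lower_bounds T, ~~ (z < w)]].

Definition is_lattice : Prop :=
  forall x y, #|joins [set x; y]| = 1%N /\ #|meets [set x; y]| = 1%N.

Definition covers x y : bool := (x < y) && ~~ [exists z, (x < z) && (z < y)].

Definition is_rank (rho : P -> nat) : Prop :=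
  [/\ {homo rho : x y / x <= y >-> (x <= y)%N},
      {in bottoms, forall x, rho x = 0%N}
    & forall x y, covers x y -> rho y = (rho x).+1].

Definition ranked : Prop := bottoms != set0 /\ exists rho, is_rank rho.

(* The rank function of a ranked poset, where it is unique; the constant 0
   on posets that are not ranked. *)
Definition rank : P -> nat :=
  if pselect (exists rho, is_rank rho) is left h then projT1 (cid h)
  else fun=> 0%N.

Definition atoms : {set P} := [set x | rank x == 1%N].

Definition atoms_below x : {set P} := [set b in atoms | b <= x].

Definition is_atomic : Prop :=
  forall x, exists2 T : {set P}, T \subset atoms & joins T = [set x].

Definition semimodular : Prop :=
  forall x y j m, j \in joins [set x; y] -> m \in meets [set x; y] ->
  (rank j + rank m <= rank x + rank y)%N.

Definition geometric_lattice : Prop :=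
  [/\ ranked, is_lattice, is_atomic & semimodular].

End Posets.

Arguments bottoms {d} P.
Arguments is_lattice {d} P.
Arguments ranked {d} P.
Arguments atoms {d} P.
Arguments geometric_lattice {d} P.

Definition locally_geometric d (P : finPOrderType d) : Prop :=
  ranked P /\
  forall x : P, geometric_lattice (subposet (fun y : P => (y <= x)%O)).

Definition linear_order_on (T : finType) (D : {set T}) (r : rel T) : Prop :=
  [/\ {in D &, antisymmetric r}, {in D & &, transitive r} & {in D &, total r}].

(* The data (S, I) of a matroid prescheme; the axioms are not part of the
   structure. *)
Record prescheme d := Prescheme {
  faces :> finPOrderType d;
  indep : {set faces}
}.
Arguments indep {d} M : rename.

Section Prescheme.
Local Open Scope order_scope.
Variables (d : Order.disp_t) (M : prescheme d).
Implicit Types (x : M).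

Definition is_circuit x : bool :=
  (x \notin indep M) && [forall y, (y < x) ==> (y \in indep M)].

Definition unicircular zeta omega : bool :=
  [forall xi, (is_circuit xi && (xi <= omega)) == (xi == zeta)].

Definition is_flat x : bool :=
  [forall zeta, is_circuit zeta && [exists al, (al <= x) && covers al zeta]
     ==> (zeta <= x)].

Definition flats : finPOrderType d := subposet is_flat.

(* The face below [x] with atom set [T] (it is unique if [M] is simplicial);
   the default [x] is never reached when [T] is a set of atoms below [x]. *)
Definition face_below x (T : {set M}) : M :=
  odflt x [pick y | (y <= x) && (atoms_below y == T)].

Definition deletion (a : M) : prescheme d :=
  @Prescheme d (subposet (fun x : M => ~~ (a <= x)))
    [set x : subposet (fun x : M => ~~ (a <= x)) | val x \in indep M].

Definition contraction (a : M) : prescheme d :=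
  @Prescheme d (subposet (fun x : M => a <= x))
    [set x : subposet (fun x : M => a <= x) | val x \in indep M].

End Prescheme.

Section PreschemeOfPoset.
Variables (d : Order.disp_t) (P : finPOrderType d).

Definition in_SP : pred (P * {set P})%type :=
  fun s => (s.2 \subset atoms P) && (s.1 \in joins s.2).

Definition prescheme_of : prescheme _ :=
  @Prescheme _ (subposet in_SP)
    [set s : subposet in_SP | rank (val s).1 == #|(val s).2|].

Lemma in_SP_atom a : a \in atoms P -> in_SP (a, [set a]).
Proof.
move=> ha; rewrite /in_SP /= sub1set ha !inE /=; apply/andP; split.
  by apply/forallP => t; apply/implyP; rewrite inE => /eqP ->.
apply/forallP => w; apply/implyP; rewrite inE => /forallP/(_ a).
by rewrite set11 /= => /le_gtF ->.
Qed.

Definition atom_face a (ha : a \in atoms P) : prescheme_of :=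
  exist _ (a, [set a]) (in_SP_atom ha).

End PreschemeOfPoset.

(* The sign of the permutation sorting [s]; when [s] is duplicate-free and [r]
   is linear on it there is exactly one such permutation [p]. *)
Definition sort_sign (T : eqType) (r : rel T) (s : seq T) : rat :=
  if [pick p : 'S_(size s) |
        [seq tnth (in_tuple s) (p i) | i <- enum 'I_(size s)] == sort r s]
  is Some p then (-1) ^+ odd_perm p else 1.

Definition sgn (T : finType) (r : rel T) (A B : {set T}) : rat :=
  sort_sign r (sort r (enum A) ++ sort r (enum B)).

Section IdealOf.
Variables (F : comNzRingType) (R : algType F) (G : R -> Prop).

Inductive ideal_of : R -> Prop :=
| IdealZero : ideal_of 0
| IdealAdd x g y z : G g -> ideal_of z -> ideal_of (x * g * y + z).

Lemma ideal_ofD u v : ideal_of u -> ideal_of v -> ideal_of (u + v).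
Proof.
move=> hu hv; elim: hu => [|x g y z Gg _ IH]; first by rewrite add0r.
by rewrite -addrA; apply: IdealAdd.
Qed.

Lemma ideal_ofMl a u : ideal_of u -> ideal_of (a * u).
Proof.
elim=> [|x g y z Gg _ IH]; first by rewrite mulr0; apply: IdealZero.
by rewrite mulrDr !mulrA; apply: IdealAdd.
Qed.

Lemma ideal_ofMr a u : ideal_of u -> ideal_of (u * a).
Proof.
elim=> [|x g y z Gg _ IH]; first by rewrite mul0r; apply: IdealZero.
by rewrite mulrDl -(mulrA (x * g)); apply: IdealAdd.
Qed.

Definition ideal_pred : {pred R} := fun x => `[< ideal_of x >].

Lemma ideal_predP x : reflect (ideal_of x) (x \in ideal_pred).
Proof. exact: asboolP. Qed.

Lemma ideal_pred_zmod_closed : zmod_closed ideal_pred.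
Proof.
split=> [|u v /ideal_predP hu /ideal_predP hv]; apply/ideal_predP.
  exact: IdealZero.
by apply: ideal_ofD => //; rewrite -mulN1r; apply: ideal_ofMl.
Qed.

HB.instance Definition _ :=
  GRing.isZmodClosed.Build R ideal_pred ideal_pred_zmod_closed.

End IdealOf.

(* Ring structures of the library are nontrivial, so the quotient needs to
   know that the relators do not generate the unit ideal. *)
Record relators (F : comNzRingType) (R : algType F) := Relators {
  relator :> R -> Prop;
  relators_proper : ~ ideal_of relator 1
}.

Section QuotientAlgebra.
Variables (F : comNzRingType) (R : algType F) (G : relators R).

Definition quot_alg := Quotient.quot (ideal_pred G).
HB.instance Definition _ := Choice.on quot_alg.
HB.instance Definition _ := GRing.Zmodule.on quot_alg.

Definition quot_map (x : R) : quot_alg := \pi_(Quotient.quot (ideal_pred G))%qT x.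
Definition quot_repr (x : quot_alg) : R := repr x.

Lemma quot_reprK : cancel quot_repr quot_map.
Proof. exact: reprK. Qed.

Lemma quot_mapP x y : reflect (ideal_of G (x - y)) (quot_map x == quot_map y).
Proof.
rewrite /quot_map -(Quotient.idealrBE (ideal_pred G)).
exact: ideal_predP.
Qed.

Lemma quot_map_eq x y : ideal_of G (x - y) -> quot_map x = quot_map y.
Proof. by move=> h; apply/eqP/quot_mapP. Qed.

Lemma quot_mapK x : ideal_of G (quot_repr (quot_map x) - x).
Proof. by apply/quot_mapP; rewrite quot_reprK. Qed.

Lemma quot_map_zmod : zmod_morphism quot_map.
Proof. by move=> x y; rewrite /quot_map raddfB. Qed.
HB.instance Definition _ :=
  GRing.isZmodMorphism.Build R quot_alg quot_map quot_map_zmod.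

Definition quot_one : quot_alg := quot_map 1.
Definition quot_mul (x y : quot_alg) : quot_alg :=
  quot_map (quot_repr x * quot_repr y).
Definition quot_scale (c : F) (x : quot_alg) : quot_alg :=
  quot_map (c *: quot_repr x).

Lemma quot_mapM : {morph quot_map : x y / x * y >-> quot_mul x y}.
Proof.
move=> x y; apply/esym/quot_map_eq.
set x' := quot_repr _; set y' := quot_repr _.
rewrite -[x' * y'](subrK (x' * y)) -mulrBr -addrA -mulrBl.
by apply: ideal_ofD; [apply: ideal_ofMl | apply: ideal_ofMr]; apply: quot_mapK.
Qed.

Lemma quot_mapZ c : {morph quot_map : x / c *: x >-> quot_scale c x}.
Proof.
move=> x; apply/esym/quot_map_eq; rewrite -scalerBr -[_ - _]mul1r scalerAl.
by apply: ideal_ofMl; apply: quot_mapK.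
Qed.

Let quotE x : x = quot_map (quot_repr x). Proof. by rewrite quot_reprK. Qed.

Fact quot_mulA : associative quot_mul.
Proof.
by move=> x y z; rewrite (quotE x) (quotE y) (quotE z) -!quot_mapM mulrA.
Qed.
Fact quot_mul1 : left_id quot_one quot_mul.
Proof. by move=> x; rewrite (quotE x) -quot_mapM mul1r. Qed.
Fact quot_mulr1 : right_id quot_one quot_mul.
Proof. by move=> x; rewrite (quotE x) -quot_mapM mulr1. Qed.
Fact quot_mulDl : left_distributive quot_mul +%R.
Proof.
move=> x y z; rewrite (quotE x) (quotE y) (quotE z).
by rewrite -raddfD -!quot_mapM -raddfD mulrDl.
Qed.
Fact quot_mulDr : right_distributive quot_mul +%R.
Proof.
move=> x y z; rewrite (quotE x) (quotE y) (quotE z).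
by rewrite -raddfD -!quot_mapM -raddfD mulrDr.
Qed.
Fact quot_one_neq0 : quot_one != 0.
Proof.
apply/negP; rewrite -(raddf0 quot_map) => /quot_mapP; rewrite subr0.
exact: relators_proper.
Qed.

HB.instance Definition _ := GRing.Zmodule_isNzRing.Build quot_alg
  quot_mulA quot_mul1 quot_mulr1 quot_mulDl quot_mulDr quot_one_neq0.

Fact quot_scaleA a b x : quot_scale a (quot_scale b x) = quot_scale (a * b) x.
Proof. by rewrite (quotE x) -!quot_mapZ scalerA. Qed.
Fact quot_scale1 : left_id 1 quot_scale.
Proof. by move=> x; rewrite (quotE x) -quot_mapZ scale1r. Qed.
Fact quot_scaleDr : right_distributive quot_scale +%R.
Proof.
move=> a x y; rewrite (quotE x) (quotE y).
by rewrite -raddfD -!quot_mapZ -raddfD scalerDr.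
Qed.
Fact quot_scaleDl x : {morph quot_scale^~ x : a b / a + b}.
Proof. by move=> a b; rewrite (quotE x) -!quot_mapZ -raddfD scalerDl. Qed.

HB.instance Definition _ := GRing.Zmodule_isLmodule.Build F quot_alg
  quot_scaleA quot_scale1 quot_scaleDr quot_scaleDl.

Fact quot_scaleAl (c : F) (x y : quot_alg) : c *: (x * y) = (c *: x) * y.
Proof.
rewrite (quotE x) (quotE y).
rewrite -[LHS]/(quot_scale c (quot_mul _ _)) -[RHS]/(quot_mul (quot_scale _ _) _).
by rewrite -quot_mapM -!quot_mapZ -quot_mapM scalerAl.
Qed.
HB.instance Definition _ := GRing.Lmodule_isLalgebra.Build F quot_alg quot_scaleAl.

Fact quot_scaleAr (c : F) (x y : quot_alg) : c *: (x * y) = x * (c *: y).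
Proof.
rewrite (quotE x) (quotE y).
rewrite -[LHS]/(quot_scale c (quot_mul _ _)) -[RHS]/(quot_mul _ (quot_scale _ _)).
by rewrite -quot_mapM -!quot_mapZ -quot_mapM scalerAr.
Qed.
HB.instance Definition _ := GRing.Lalgebra_isAlgebra.Build F quot_alg quot_scaleAr.

Fact quot_map_monoid : monoid_morphism quot_map.
Proof. by split=> // x y; rewrite quot_mapM. Qed.
HB.instance Definition _ :=
  GRing.isMonoidMorphism.Build R quot_alg quot_map quot_map_monoid.

Fact quot_map_scalable : scalable quot_map.
Proof. by move=> c x; rewrite quot_mapZ. Qed.
HB.instance Definition _ :=
  GRing.isScalable.Build F R quot_alg *:%R quot_map quot_map_scalable.

End QuotientAlgebra.

Section KillRelators.
Variables (F : comNzRingType) (R : algType F) (S : nzRingType).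
Variables (f : {rmorphism R -> S}).

Lemma ideal_of_ker (G : R -> Prop) x :
  (forall g, G g -> f g = 0) -> ideal_of G x -> f x = 0.
Proof.
move=> Gf; elim=> [|y g z t Gg _ IH]; first exact: rmorph0.
by rewrite rmorphD !rmorphM (Gf g Gg) mulr0 mul0r add0r.
Qed.

Lemma ideal_of_proper (G : R -> Prop) :
  (forall g, G g -> f g = 0) -> ~ ideal_of G 1.
Proof. by move=> Gf /(ideal_of_ker Gf)/eqP; rewrite rmorph1 oner_eq0. Qed.

Variables (G : relators R) (Gf : forall g, G g -> f g = 0).

Definition quot_lift of (forall g, G g -> f g = 0) : quot_alg G -> S :=
  fun x => f (quot_repr x).
Local Notation lft := (quot_lift Gf).

Lemma quot_lift_map x : lft (quot_map G x) = f x.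
Proof.
apply/eqP; rewrite /quot_lift -subr_eq0 -rmorphB.
by rewrite (ideal_of_ker Gf (quot_mapK G x)).
Qed.

Fact quot_lift_zmod : zmod_morphism lft.
Proof.
move=> x y; rewrite -(quot_reprK x) -(quot_reprK y).
by rewrite -rmorphB !quot_lift_map rmorphB.
Qed.
Fact quot_lift_monoid : monoid_morphism lft.
Proof.
split; first by rewrite -(rmorph1 (quot_map G)) quot_lift_map rmorph1.
move=> x y; rewrite -(quot_reprK x) -(quot_reprK y).
by rewrite -rmorphM !quot_lift_map rmorphM.
Qed.
HB.instance Definition _ :=
  GRing.isZmodMorphism.Build (quot_alg G) S lft quot_lift_zmod.
HB.instance Definition _ :=
  GRing.isMonoidMorphism.Build (quot_alg G) S lft quot_lift_monoid.
End KillRelators.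

Section FreeAlgebra.
Variable (X : finType).

Definition free_alg := {malg rat[{fmonom X}]}.
HB.instance Definition _ := GRing.Lalgebra.on free_alg.

Fact free_alg_scalerAr (c : rat) (x y : free_alg) :
  c *: (x * y) = x * (c *: y).
Proof.
have CX (z : free_alg) : c%:MP * z = z * c%:MP.
  apply/malgP => k; rewrite mcoeffCM.
  rewrite (mcoeffMrw _ (finmap.fsubset_refl _) msuppU_le) finmap.big_seq_fset1.
  rewrite {1}[z]monalgE !raddf_sum mulr_sumr /=; apply: eq_bigr => k1 _.
  by rewrite !mcoeffU mulm1 eqxx mulrnAr mulrC.
by rewrite -!mul_malgC mulrA CX -mulrA.
Qed.
HB.instance Definition _ :=
  GRing.Lalgebra_isAlgebra.Build rat free_alg free_alg_scalerAr.

Definition free_gen (x : X) : free_alg := << fmu x >>.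

Definition free_counit : free_alg -> rat :=
  @mcoeff {fmonom X} rat (@one {fmonom X}).
HB.instance Definition _ := GRing.RMorphism.on free_counit.

Lemma free_counit_gen x : free_counit (free_gen x) = 0.
Proof. by rewrite /free_counit /free_gen mcoeffU1 fm1_eq1. Qed.

Variable deg : X -> nat.

(* Over rat these relators force x ^+ 2 = 0 for generators of odd degree. *)
Inductive gcomm_relator : free_alg -> Prop :=
| GComm x y : gcomm_relator
    (free_gen x * free_gen y
     - (-1) ^+ (deg x * deg y) *: (free_gen y * free_gen x)).

Fact free_counit_gcomm g : gcomm_relator g -> free_counit g = 0.
Proof.
case=> x y; rewrite rmorphB /=.
rewrite [X in _ - X]mcoeffZ.
rewrite -!/(free_counit _) !rmorphM /= !free_counit_gen.
by rewrite !mulr0 subr0.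
Qed.

Definition gcomm_relators : relators free_alg :=
  Relators (ideal_of_proper free_counit_gcomm).

Definition gcomm_alg : algType rat := quot_alg gcomm_relators.

Definition gcomm_gen (x : X) : gcomm_alg := quot_map gcomm_relators (free_gen x).

Definition gcomm_counit : gcomm_alg -> rat :=
  quot_lift (G := gcomm_relators) free_counit_gcomm.
HB.instance Definition _ := GRing.RMorphism.on gcomm_counit.

Lemma gcomm_counit_gen x : gcomm_counit (gcomm_gen x) = 0.
Proof.
by rewrite /gcomm_counit /gcomm_gen quot_lift_map; exact: free_counit_gen.
Qed.

End FreeAlgebra.

Section OrlikSolomon.
Variables (d : Order.disp_t) (M : prescheme d) (r : rel M).
Implicit Types (al be ga om ze : M).

Definition gens := {al : M | al \in indep M :\: bottoms M}.

Definition OS_E : algType rat :=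
  @gcomm_alg gens (fun g => #|atoms_below (val g)|).

(* The generator e_al; the junk value 0 outside of I \ {0^} is never used when
   [M] is a matroid prescheme without loops. *)
Definition OS_e al : OS_E :=
  if insub al is Some g then gcomm_gen _ (g : gens) else 0.

Local Notation at_ := atoms_below.

Inductive OS_relator : OS_E -> Prop :=
| OS_meet al be of al \in indep M :\: bottoms M & be \in indep M :\: bottoms M
    & meets [set al; be] != bottoms M :
    OS_relator (OS_e al * OS_e be)
| OS_join al be of al \in indep M :\: bottoms M & be \in indep M :\: bottoms M
    & meets [set al; be] = bottoms M :
    OS_relator (OS_e al * OS_e be
      - sgn r (at_ al) (at_ be)
          *: \sum_(ga in joins [set al; be] :&: indep M) OS_e ga)
| OS_circuit ze om of unicircular ze om :
    OS_relator (\sum_(b in at_ ze)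
      sgn r [set b] (at_ om :\ b) *: OS_e (face_below om (at_ om :\ b))).

Lemma OS_counit_e al : gcomm_counit (OS_e al) = 0.
Proof.
by rewrite /OS_e; case: insubP => [g _ _|_]; rewrite ?gcomm_counit_gen ?rmorph0.
Qed.

Fact OS_counit_scale c (x : OS_E) :
  gcomm_counit x = 0 -> gcomm_counit (c *: x) = 0.
Proof. by move=> x0; rewrite -mulr_algl rmorphM /= x0 mulr0. Qed.

Fact OS_counit_relator g : OS_relator g -> gcomm_counit g = 0.
Proof.
case=> [al be _ _ _|al be _ _ _|ze om _].
- by rewrite rmorphM /= OS_counit_e mul0r.
- rewrite rmorphB rmorphM /= OS_counit_e mul0r OS_counit_scale ?subrr //.
  by rewrite rmorph_sum big1 // => ga _; apply: OS_counit_e.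
- rewrite rmorph_sum big1 // => b _ /=.
  by rewrite OS_counit_scale // OS_counit_e.
Qed.

Definition OS_relators : relators OS_E :=
  Relators (ideal_of_proper OS_counit_relator).

Definition OS_alg : algType rat := quot_alg OS_relators.

Definition OS_gen al : OS_alg := quot_map OS_relators (OS_e al).

End OrlikSolomon.

(* The order on the faces (x, T) compares the first components; on the atoms
   (b, {b}) of S(P) it is the given order on the atoms b of P. *)
Definition face_order d (P : finPOrderType d) (r : rel P) :
  rel (prescheme_of P) := relpre (fun s : prescheme_of P => (val s).1) r.

Definition OS_poset d (P : finPOrderType d) (r : rel P) : algType rat :=
  OS_alg (face_order r).

Section Triple.
Variables (d : Order.disp_t) (P : finPOrderType d).
Variables (a : P) (ha : a \in atoms P).

Definition deletion_poset : finPOrderType _ :=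
  flats (deletion (atom_face ha)).

Definition contraction_poset : finPOrderType _ :=
  flats (contraction (atom_face ha)).

Definition deletion_poset_val (x : deletion_poset) : prescheme_of P :=
  val (val x).

Definition deletion_order (r : rel P) : rel deletion_poset :=
  relpre deletion_poset_val (face_order r).

(* The embedding of M(P') into M(P) obtained from the canonical isomorphism
   M(P') = M': the pair (x, T), where x is a flat of M' and T a set of atoms
   of M', is sent to the face below x with atom set T. *)
Definition deletion_face (s : prescheme_of deletion_poset) : prescheme_of P :=
  face_below (deletion_poset_val (val s).1)
    [set deletion_poset_val t | t in (val s).2].

End Triple.

Arguments deletion_order {d P a} ha r.

(* Main.v *)
Require Import Defs.
From HB Require Import structures.
From mathcomp Require Import all_boot all_order all_algebra.
From mathcomp Require Import perm boolp ring zify.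
From mathcomp.multinomials Require Import monalg.

Set Implicit Arguments.
Unset Strict Implicit.
Unset Printing Implicit Defensive.

Import Order.DefaultProdOrder Order.DefaultSetSubsetOrder.
Import Order.TTheory GRing.Theory Num.Theory.

(** The faces with top [x] span the component at [x] of the Orlik-Solomon algebra
of a locally geometric poset.  The dual of this component has a description
without generators and relations: it consists of the forms at [x], which are
the alternating functions of sequences of atoms that are supported on the bases
of [x] and closed, on sequences of atoms below [x], for the transpose of the
simplicial boundary ([top_form]).

A form defines a functional on the algebra, whose value on a word in the
generators is the value of the form on the concatenated sorted faces.  The
relators are killed: graded commutativity and the products of faces express
alternation, the circuit relations express closedness ([OS_functional]).
Conversely, a functional on the span of the independent faces that respects the
circuit relations has forms as its components.  By linear duality the forms
thus detect all linear relations between the faces ([separation]).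

Forms restrict to the atoms other than [a], so that the map from the algebra of
the deletion is well defined.  It is injective because every form [f] of the
deletion extends: the extension is [f + a /\ g], which is closed exactly when
[f] is the coboundary of [g], where [g] lives on the sets that form a basis
together with [a].  Fixing a first entry [b] provides a primitive of [f] with
some other values, which sit on the coatoms of [x] above [a]; an induction on
[x] removes them ([deletion_primitive]).

An atom of the contraction is a line through [a].  A form of the contraction,
read on lines and multiplied by [a], is a form of the poset
([contraction_pullback_form]); the transpose of this operation is the residue
map to the algebra of the contraction.  The forms that vanish on the sequences
avoiding [a] are exactly these pullbacks ([contraction_form_pullback]), hence
the kernel of the residue map is spanned by the faces that avoid [a], which come
from the deletion ([contraction_map_kernel]).  The residue map is onto since a
face of the contraction lifts by a choice of one atom on each of its lines
([contraction_face_image]).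

The deletion and the contraction are handled as posets of flats, embedded in the
poset by the tops of the flats ([flatP]).  All three posets satisfy the
conditions [locally_matroidal], on which the theory of forms is built. *)
(** * Ranked posets *)

Section RankedPosets.
Local Open Scope order_scope.
Variables (d : Order.disp_t) (Q : finPOrderType d).
Implicit Types (x y z : Q) (T : {set Q}).

Lemma poset_ind (A : Q -> Prop) :
  (forall x, (forall y, y < x -> A y) -> A x) -> forall x, A x.
Proof.
move=> IH x; have [n] := ubnP #|[set y | y < x]|.
elim: n x => // n IHn x xn; apply: IH => y yx; apply: IHn.
rewrite -ltnS; apply: leq_trans xn; rewrite ltnS; apply: proper_card.
apply/properP; split; first by apply/subsetP => z; rewrite !inE => /lt_trans; apply.
by exists y; rewrite !inE ?ltxx.
Qed.

Lemma minimal_below (A : pred Q) x : A x ->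
  exists2 y, y <= x & A y /\ forall z, A z -> ~~ (z < y).
Proof.
elim/poset_ind: x => x IH Ax.
have [/existsP[y /andP[yx Ay]]|/existsPn nA] := boolP [exists y, (y < x) && A y].
  by have [z zy Az] := IH y yx Ay; exists z => //; apply: le_trans zy (ltW yx).
by exists x => //; split=> // z Az; move: (nA z); rewrite Az andbT.
Qed.

Lemma exists_lower_cover x y : x < y -> exists2 z, x <= z & covers z y.
Proof.
move=> xy; have : exists2 z, x <= z & z < y by exists x.
case=> z; have [n] := ubnP #|[set w | z < w]|.
elim: n z => // n IH z zn xz zy.
have [/existsP[w /andP[zw wy]]|nw] := boolP [exists w, (z < w) && (w < y)].
  apply: (IH w) => //; last exact: le_trans (ltW zw).
  rewrite -ltnS; apply: leq_trans zn; rewrite ltnS; apply: proper_card.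
  apply/properP; split; first by apply/subsetP => v; rewrite !inE; apply: lt_trans.
  by exists w; rewrite !inE ?ltxx.
by exists z => //; rewrite /covers zy.
Qed.

Lemma bottomsP x : reflect (forall y, x <= y) (x \in bottoms Q).
Proof. by rewrite inE; apply: forallP. Qed.

Lemma joinsetP T j : reflect
  ((forall t, t \in T -> t <= j) /\
   forall w, (forall t, t \in T -> t <= w) -> ~~ (w < j))
  (j \in joins T).
Proof.
rewrite !inE; apply: (iffP andP) => -[].
  move=> /forallP ub /forallP mn; split=> [t tT|w wT].
    by have /implyP := ub t; apply.
  have /implyP := mn w; apply; rewrite inE; apply/forallP => t.
  by apply/implyP; apply: wT.
move=> ub mn; split; apply/forallP => t; apply/implyP; first exact: ub.
by rewrite inE => /forallP wT; apply: mn => u uT; have /implyP := wT u; apply.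
Qed.

Lemma meetsetP T m : reflect
  ((forall t, t \in T -> m <= t) /\
   forall w, (forall t, t \in T -> w <= t) -> ~~ (m < w))
  (m \in meets T).
Proof.
rewrite !inE; apply: (iffP andP) => -[].
  move=> /forallP ub /forallP mn; split=> [t tT|w wT].
    by have /implyP := ub t; apply.
  have /implyP := mn w; apply; rewrite inE; apply/forallP => t.
  by apply/implyP; apply: wT.
move=> ub mn; split; apply/forallP => t; apply/implyP; first exact: ub.
by rewrite inE => /forallP wT; apply: mn => u uT; have /implyP := wT u; apply.
Qed.

Lemma is_rank_lt (rho : Q -> nat) x y : is_rank rho -> x < y -> (rho x < rho y)%N.
Proof.
by case=> hom _ cov /exists_lower_cover[z xz /cov ->]; rewrite ltnS; apply: hom.
Qed.

Lemma rank_unique (rho rho' : Q -> nat) : bottoms Q != set0 ->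
  is_rank rho -> is_rank rho' -> rho =1 rho'.
Proof.
case/set0Pn => b b0 [_ r0 rc] [_ r0' rc'].
elim/poset_ind=> x IH; have [xb|nxb] := boolP (x \in bottoms Q); first by rewrite r0 ?r0'.
have bx : b < x.
  by rewrite lt_neqAle (bottomsP _ b0) andbT; apply: contraNneq nxb => <-.
have [z bz zx] := exists_lower_cover bx.
by rewrite (rc _ _ zx) (rc' _ _ zx) IH //; case/andP: zx.
Qed.

Lemma rank_is_rank : (exists rho : Q -> nat, is_rank rho) -> is_rank (@rank d Q).
Proof. by rewrite /rank; case: pselect => // h _; apply: (projT2 (cid h)). Qed.

Lemma rankE (rho : Q -> nat) : bottoms Q != set0 -> is_rank rho -> @rank d Q =1 rho.
Proof. by move=> b r; apply: rank_unique => //; apply: rank_is_rank; exists rho. Qed.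

Lemma atoms_belowE x t : (t \in atoms_below x) = (rank t == 1%N) && (t <= x).
Proof. by rewrite !inE. Qed.

End RankedPosets.

(** * Joins of atoms below a fixed element *)

(** Every principal ideal carries the closure operator of a matroid on its
atoms.  Deletions and contractions inherit these conditions more directly than
the lattice axioms. *)
Record locally_matroidal d (Q : finPOrderType d) : Prop := LocallyMatroidal {
  lm_bottom : bottoms Q != set0;
  lm_rank : is_rank (@rank d Q);
  lm_join : forall (x : Q) (T : {set Q}), T \subset atoms_below x ->
    exists j, [/\ (j <= x)%O, forall t, t \in T -> (t <= j)%O
      & forall u, (u <= x)%O -> (forall t, t \in T -> (t <= u)%O) -> (j <= u)%O];
  lm_atomic : forall x u : Q, (u <= x)%O ->
    (forall t, t \in atoms_below x -> (t <= u)%O) -> u = x;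
  lm_exchange : forall x y t : Q, (y <= x)%O -> t \in atoms_below x ->
    ~~ (t <= y)%O ->
    exists z, [/\ (z <= x)%O, (y <= z)%O, (t <= z)%O & rank z = (rank y).+1]
}.

Section JoinBelow.
Local Open Scope order_scope.
Variables (d : Order.disp_t) (Q : finPOrderType d).
Implicit Types (x y z t : Q) (S T U : {set Q}).

(** A set of atoms may have several joins; only one of them lies below a given
upper bound [x].  The default is never reached when [T] consists of atoms below
[x]. *)
Definition join_below x T : Q := odflt x [pick j in joins T | j <= x].

Definition basis x T : bool := in_SP (x, T) && (rank x == #|T|).

Hypothesis lmQ : locally_matroidal Q.

Lemma rank_lt x y : x < y -> (rank x < rank y)%N.
Proof. exact: is_rank_lt (lm_rank lmQ). Qed.

Lemma rank_le x y : x <= y -> (rank x <= rank y)%N.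
Proof. by case: (lm_rank lmQ) => h _ _; apply: h. Qed.

Lemma eq_of_rank x y : x <= y -> (rank y <= rank x)%N -> x = y.
Proof.
rewrite le_eqVlt => /orP[/eqP //|/rank_lt]; rewrite ltnNge => /negPf -> //.
Qed.

Lemma bottom_exists : exists b : Q, (forall x, b <= x) /\ rank b = 0%N.
Proof.
have /set0Pn[b b0] := lm_bottom lmQ; exists b; split; first exact/bottomsP.
by case: (lm_rank lmQ) => _ h _; apply: h.
Qed.

Lemma rank0P x : reflect (forall y, x <= y) (rank x == 0%N).
Proof.
apply: (iffP eqP) => [x0|xb]; have [b [bx b0]] := bottom_exists.
  by rewrite -(eq_of_rank (bx x)) // x0.
by apply/eqP; rewrite -leqn0 -b0; apply: rank_le.
Qed.

Lemma sub_atoms_below x T : reflect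
  (T \subset atoms Q /\ forall t, t \in T -> t <= x) (T \subset atoms_below x).
Proof.
apply: (iffP idP) => [/subsetP h|[/subsetP h1 h2]].
  by split=> [|t /h]; [apply/subsetP => t /h|]; rewrite inE => /andP[].
by apply/subsetP => t tT; rewrite inE h1 // h2.
Qed.

Lemma atoms_below_le x y : x <= y -> atoms_below x \subset atoms_below y.
Proof.
by move=> xy; apply/subsetP => t; rewrite !inE => /andP[-> /le_trans]; apply.
Qed.

Lemma join_belowP x T : T \subset atoms_below x ->
  [/\ join_below x T <= x, join_below x T \in joins T,
      forall t, t \in T -> t <= join_below x T
    & forall u, u <= x -> (forall t, t \in T -> t <= u) -> join_below x T <= u].
Proof.
move=> Tx; have [j [jx jub jmin]] := lm_join lmQ Tx.
have jT : j \in joins T.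
  apply/joinsetP; split=> // w wub; apply/negP => wj.
  by have := jmin w (le_trans (ltW wj) jx) wub; rewrite (lt_geF wj).
rewrite /join_below; case: pickP => [k /andP[kT kx]|/(_ j)]; last by rewrite jT jx.
have [kub kmin] := joinsetP _ _ kT.
have /orP[/eqP jk|jk] : (j == k) || (j < k) by rewrite -le_eqVlt; apply: jmin.
  by rewrite -jk.
by have := kmin j jub; rewrite jk.
Qed.

Lemma join_below_le x T : T \subset atoms_below x -> join_below x T <= x.
Proof. by case/join_belowP. Qed.

Lemma join_below_ub x T t : T \subset atoms_below x -> t \in T -> t <= join_below x T.
Proof. by case/join_belowP=> _ _ h _; apply: h. Qed.

Lemma join_below_min x T u : T \subset atoms_below x -> u <= x ->
  (forall t, t \in T -> t <= u) -> join_below x T <= u.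
Proof. by case/join_belowP=> _ _ _; apply. Qed.

Lemma join_below_eq x T j : T \subset atoms_below x -> j \in joins T -> j <= x ->
  j = join_below x T.
Proof.
move=> Tx /joinsetP[ub mn] jx; apply/eqP; rewrite eq_sym.
have := join_below_min Tx jx ub; rewrite le_eqVlt => /orP[] // h.
by have /negP := mn _ (fun t => join_below_ub Tx (t := t)).
Qed.

Lemma sub_atoms_join x T : T \subset atoms_below x -> T \subset atoms_below (join_below x T).
Proof.
move=> Tx; apply/sub_atoms_below; split; first by case/sub_atoms_below: Tx.
by move=> t; apply: join_below_ub.
Qed.

Lemma in_SPP x T :
  reflect (T \subset atoms_below x /\ join_below x T = x) (in_SP (x, T)).
Proof.
rewrite /in_SP /=; apply: (iffP andP) => -[].
  move=> Ta xT; have Tx : T \subset atoms_below x.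
    by apply/sub_atoms_below; split=> //; case/joinsetP: xT.
  by split=> //; rewrite -(join_below_eq Tx xT).
move=> Tx xE; split; first by case/sub_atoms_below: Tx.
by rewrite -xE; case/join_belowP: Tx.
Qed.

Lemma in_SP_min x T u : in_SP (x, T) -> u <= x -> (forall t, t \in T -> t <= u) -> u = x.
Proof.
by case/in_SPP => Tx xE ux Tu; apply: le_anti; rewrite ux -{1}xE join_below_min.
Qed.

Lemma in_SP_join x T : T \subset atoms_below x -> in_SP (join_below x T, T).
Proof.
move=> Tx; rewrite /in_SP /=; case/sub_atoms_below: (Tx) => -> _ /=.
by case/join_belowP: Tx.
Qed.

Lemma join_below_sub x S T : T \subset atoms_below x -> S \subset T ->
  join_below x S <= join_below x T.
Proof.
move=> Tx ST; apply: join_below_min; rewrite ?join_below_le ?(subset_trans ST) //.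
by move=> t tS; apply: join_below_ub => //; apply: (subsetP ST).
Qed.

Lemma join_below_mono x y T : y <= x -> T \subset atoms_below y ->
  join_below x T = join_below y T.
Proof.
move=> yx Ty; apply/esym/join_below_eq.
- exact: subset_trans (atoms_below_le yx).
- by case/join_belowP: Ty.
- exact: le_trans (join_below_le Ty) yx.
Qed.

(** By exchange, each further atom raises the rank of the join by at most one. *)
Lemma rank_join_setU x S U : S :|: U \subset atoms_below x ->
  (rank (join_below x (S :|: U)) <= rank (join_below x S) + #|U|)%N.
Proof.
have [n] := ubnP #|U|; elim: n U => // n IH U Un SUx.
have [->|/set0Pn[u uU]] := eqVneq U set0; first by rewrite setU0 leq_addr.
have SU'x : S :|: U :\ u \subset atoms_below x.
  by apply: subset_trans SUx; apply: setUS; apply: subD1set.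
have Uu : #|U| = #|U :\ u|.+1 by rewrite (cardsD1 u) uU.
have := IH (U :\ u); rewrite -ltnS -Uu => /(_ Un SU'x) {IH}.
set y := join_below x (S :|: U :\ u) => yr.
have ux : u \in atoms_below x by apply: (subsetP SUx); rewrite inE uU orbT.
have SUE t : t \in S :|: U -> t = u \/ t \in S :|: U :\ u.
  by rewrite !inE; case: eqP => [|_ ->]; [left|right].
have [uy|nuy] := boolP (u <= y).
  rewrite Uu addnS; apply: leqW; apply: leq_trans yr.
  apply: rank_le; apply: join_below_min (join_below_le SU'x) _ => // t /SUE[-> //|].
  exact: join_below_ub.
have [z [zx yz uz rz]] := lm_exchange lmQ (join_below_le SU'x) ux nuy.
rewrite Uu addnS; apply: leq_trans (_ : rank z <= _)%N; last by rewrite rz ltnS.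
apply: rank_le; apply: join_below_min => // t /SUE[-> //|tS].
exact: le_trans (join_below_ub SU'x tS) yz.
Qed.

Lemma rank_join_le x T : T \subset atoms_below x -> (rank (join_below x T) <= #|T|)%N.
Proof.
move=> Tx; rewrite -[T]set0U; apply: leq_trans (rank_join_setU _) _; rewrite ?set0U //.
have [b [bx b0]] := bottom_exists.
suff /rank_le : join_below x set0 <= b by rewrite b0 leqn0 => /eqP ->.
by apply: join_below_min => //; [apply: sub0set | move=> t; rewrite inE].
Qed.

Lemma in_SP_rank_le x T : in_SP (x, T) -> (rank x <= #|T|)%N.
Proof. by case/in_SPP => Tx {1}<-; apply: rank_join_le. Qed.

Lemma basis_atoms x T : basis x T -> T \subset atoms_below x.
Proof. by case/andP => /in_SPP[]. Qed.

Lemma basis_join x T : basis x T -> join_below x T = x.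
Proof. by case/andP => /in_SPP[]. Qed.

Lemma basis_card x T : basis x T -> rank x = #|T|.
Proof. by case/andP => _ /eqP. Qed.

Lemma basisE x T : T \subset atoms_below x -> rank x = #|T| ->
  (rank x <= rank (join_below x T))%N -> basis x T.
Proof.
move=> Tx rT xT; rewrite /basis rT eqxx andbT; apply/in_SPP; split=> //.
exact: eq_of_rank (join_below_le Tx) xT.
Qed.

(** If the rank of the join of [S] were less than the cardinality of [S], the
remaining atoms of [T] could not make up for it. *)
Lemma basis_sub x S T : basis x T -> S \subset T -> basis (join_below x S) S.
Proof.
move=> bT ST; have Tx := basis_atoms bT; have Sx := subset_trans ST Tx.
rewrite /basis in_SP_join //= eqn_leq rank_join_le //=.
have := @rank_join_setU x S (T :\: S); rewrite setDE setUIr setUCr setIT.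
rewrite (setUidPr ST) basis_join // (basis_card bT) => /(_ Tx).
by rewrite -(cardsID S T) (setIidPr ST) setDE leq_add2r.
Qed.

(** A maximal set of full rank between [A] and [T] spans every atom of [T]. *)
Lemma basis_extend x (A : {set Q}) T : in_SP (x, T) -> A \subset T ->
    rank (join_below x A) = #|A| ->
  exists B : {set Q}, [/\ A \subset B, B \subset T & basis x B].
Proof.
case/in_SPP => Tx xE AT rA.
pose I (B : {set Q}) := [&& A \subset B, B \subset T & rank (join_below x B) == #|B|].
have I0 : I A by rewrite /I subxx AT rA eqxx.
case: (@arg_maxnP _ A I (fun B => #|B|) I0) => B /and3P[AB BT /eqP rB] Bmax.
have Bx := subset_trans BT Tx; exists B; split=> //.
suff jB : join_below x B = x by apply: basisE; rewrite ?jB // -rB jB.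
apply: le_anti; rewrite join_below_le //= -{1}xE.
apply: join_below_min (join_below_le Bx) _ => // t tT.
apply/negPn/negP => ntB.
have ntB' : t \notin B by apply: contra ntB; apply: join_below_ub.
have tBx : t |: B \subset atoms_below x.
  by rewrite subUset Bx sub1set (subsetP Tx).
have ctB : #|t |: B| = #|B|.+1 by rewrite cardsU1 ntB'.
suff /Bmax : I (t |: B) by rewrite /= ctB ltnn.
rewrite /I (subset_trans AB) ?subsetUr // subUset sub1set tT BT.
rewrite eqn_leq rank_join_le //= ctB -rB.
apply: rank_lt; rewrite lt_neqAle join_below_sub ?subsetUr // andbT.
by apply: contraNneq ntB => ->; apply: join_below_ub => //; exact: setU11.
Qed.

Lemma rank_join0 x : rank (join_below x set0) = 0%N.
Proof.
by apply/eqP; rewrite -leqn0 -(cards0 Q) rank_join_le ?sub0set.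
Qed.

Lemma atom_le_eq t u : t \in atoms Q -> u \in atoms Q -> t <= u -> t = u.
Proof.
by rewrite !inE => /eqP t1 /eqP u1 tu; apply: eq_of_rank; rewrite ?t1 ?u1.
Qed.

Lemma in_SP_atoms_below x : in_SP (x, atoms_below x).
Proof.
apply/in_SPP; split=> //; apply: (lm_atomic lmQ); first exact: join_below_le.
by move=> t; apply: join_below_ub.
Qed.

Lemma rank_line x t u : t \in atoms_below x -> u \in atoms_below x -> t != u ->
  rank (join_below x [set t; u]) = 2%N.
Proof.
move=> tx ux tu.
have sub : [set t; u] \subset atoms_below x by rewrite subUset !sub1set tx.
apply/eqP; rewrite eqn_leq; apply/andP; split.
  by apply: leq_trans (rank_join_le sub) _; rewrite cards2 tu.
have [t1 u1] : t \in atoms Q /\ u \in atoms Q by move: tx ux; rewrite !inE => /andP[-> _] /andP[-> _].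
have tj : t <= join_below x [set t; u] by apply: join_below_ub; rewrite ?set21.
have uj : u <= join_below x [set t; u] by apply: join_below_ub; rewrite ?set22.
have <- : rank t = 1%N by apply/eqP; rewrite inE in t1.
apply: rank_lt; rewrite lt_neqAle tj andbT; apply: contraNneq tu => tE.
have ut : u <= t by rewrite [leRHS]tE.
by rewrite (atom_le_eq u1 t1 ut).
Qed.

Lemma coatom_above x y : y < x -> exists z, [/\ y <= z, z < x & (rank z).+1 = rank x].
Proof.
case/exists_lower_cover=> z yz zx; exists z; split=> //; first by case/andP: zx.
by case: (lm_rank lmQ) => _ _ h; rewrite (h _ _ zx).
Qed.

End JoinBelow.

(** * Locally geometric posets are locally matroidal *)

Section LocallyGeometric.
Local Open Scope order_scope.
Variables (d : Order.disp_t) (P : finPOrderType d).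
Implicit Types (x y z t : P) (T : {set P}).

Lemma lattice_join_least d' (L : finPOrderType d') : is_lattice L ->
  forall u v : L, exists2 j, j \in joins [set u; v] &
    [/\ u <= j, v <= j & forall w, u <= w -> v <= w -> j <= w].
Proof.
move=> lat u v; have [/eqP/cards1P[j jE] _] := lat u v.
have jj : j \in joins [set u; v] by rewrite jE set11.
have [jub jmin] := joinsetP _ _ jj; exists j => //.
split=> [||w uw vw]; try by apply: jub; rewrite !inE eqxx ?orbT.
pose A (z : L) := (u <= z) && (v <= z).
have Aw : A w by rewrite /A uw.
have [k kw [/andP[uk vk] kmin]] := minimal_below Aw.
suff : k \in joins [set u; v] by rewrite jE inE => /eqP <-.
apply/joinsetP; split=> [t|z zub]; first by rewrite !inE => /orP[] /eqP ->.
by apply: kmin; rewrite /A !zub // !inE eqxx ?orbT.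
Qed.

Hypothesis Pgeo : locally_geometric P.
Local Notation below x := (subposet (fun y : P => y <= x)).

Let Pbot : bottoms P != set0. Proof. by case: Pgeo => -[]. Qed.
Let Prank : is_rank (@rank d P).
Proof. by case: Pgeo => -[_ h] _; apply: rank_is_rank. Qed.

(** The restriction of the rank function is a rank function on the principal
ideal, where there is only one. *)
Lemma rank_below x (y : below x) : rank y = rank (val y).
Proof.
have Pgx : geometric_lattice (below x) by case: Pgeo.
apply: (rankE (rho := fun z : below x => rank (val z))); first by case: Pgx => -[].
case: (Prank) => hom r0 rc; split=> [u v uv|u|u v].
- by apply: hom; rewrite -leEsub.
- move/bottomsP => ub; have /set0Pn[b bb] := Pbot; apply: r0; apply/bottomsP => z.
  have bx : b <= x by apply: (bottomsP _ bb).
  by apply: le_trans (bottomsP _ bb z); rewrite -[b]/(val (exist _ b bx : below x)) -leEsub.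
move=> /andP[uv nuv]; apply: rc; rewrite /covers -ltEsub uv /=.
apply: contra nuv => /existsP[z /andP[uz zv]].
have zx : z <= x by apply: le_trans (ltW zv) (valP v).
by apply/existsP; exists (exist _ z zx : below x); rewrite !ltEsub uz.
Qed.

(** Joins of sets of atoms are built one atom at a time.  Exchange is
semimodularity for [y] and an atom, whose meet has nonnegative rank. *)
Lemma locally_geometric_matroidal : locally_matroidal P.
Proof.
have geo x : geometric_lattice (below x) by case: Pgeo.
have down x y : y <= x -> exists y' : below x, val y' = y by move=> yx; exists (exist _ y yx).
have top x : exists x' : below x, val x' = x by apply: down.
split=> //.
- move=> x T; have [n] := ubnP #|T|; elim: n T => // n IH T Tn Tx.
  have [->|/set0Pn[t tT]] := eqVneq T set0.
    have /set0Pn[b bb] := Pbot; have bP := bottomsP _ bb; exists b.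
    by split=> [//|t|u _ _ //]; rewrite inE.
  have Tt : #|T| = #|T :\ t|.+1 by rewrite (cardsD1 t) tT.
  case: (IH (T :\ t)) => [||j [jx jub jmin]]; first by rewrite -ltnS -Tt.
    exact: subset_trans (subsetDl _ _) Tx.
  have tx : t <= x by move: (subsetP Tx t tT); rewrite inE => /andP[].
  have [[t' tE] [j' jE]] := (down x t tx, down x j jx).
  have [_ lat _ _] := geo x.
  have [k _ [tk jk kmin]] := lattice_join_least lat t' j'.
  exists (val k); split=> [|s sT|u ux uub]; first exact: (valP k).
    have [->|st] := eqVneq s t; first by rewrite -tE -leEsub.
    apply: le_trans (_ : j <= _); first by apply: jub; rewrite !inE st.
    by rewrite -jE -leEsub.
  have [u' uE] := down x u ux; rewrite -uE -leEsub; apply: kmin; rewrite leEsub uE.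
    by rewrite tE uub.
  by rewrite jE; apply: jmin => // s; rewrite inE => /andP[_ /uub].
- move=> x u ux uub; have [_ _ atm _] := geo x.
  have [[x' xE] [u' uE]] := (top x, down x u ux).
  have [T /subsetP Ta Tj] := atm x'.
  have uT s : s \in T -> s <= u'.
    move=> sT; rewrite leEsub uE; apply: uub; rewrite inE (valP s) andbT.
    by have := Ta s sT; rewrite !inE rank_below.
  have [v vu [vub vmin]] :=
    @minimal_below _ _ (fun v => [forall s in T, s <= v]) u' (introT forall_inP uT).
  suff : v \in joins T.
    rewrite Tj inE => /eqP vx; apply: le_anti; rewrite ux -xE -uE -vx -leEsub.
    exact: vu.
  apply/joinsetP; split=> [|w wub]; first exact/forall_inP.
  by apply: vmin; apply/forall_inP.
move=> x y t yx; rewrite inE inE => /andP[/eqP t1 tx] nty.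
have [[t' tE] [y' yE]] := (down x t tx, down x y yx).
have [_ lat _ smod] := geo x.
have [k kj [yk tk _]] := lattice_join_least lat y' t'.
have [_ /eqP/cards1P[m mE]] := lat y' t'.
have /(smod _ _ _ _ kj) : m \in meets [set y'; t'] by rewrite mE set11.
rewrite !rank_below tE yE t1 => kr.
exists (val k); rewrite (valP k) -{1}yE -{1}tE -!leEsub yk tk; split=> //.
have yk' : y < val k.
  rewrite lt_neqAle -{2}yE -leEsub yk andbT; apply: contraNneq nty => ->.
  by rewrite -tE -leEsub.
apply/eqP; rewrite eqn_leq (is_rank_lt Prank yk') andbT -addn1.
exact: leq_trans (leq_addr _ _) kr.
Qed.

End LocallyGeometric.

(** * The faces of the prescheme of a poset *)

Section Faces.
Local Open Scope order_scope.
Variables (d : Order.disp_t) (Q : finPOrderType d).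
Hypothesis lmQ : locally_matroidal Q.
Local Notation M := (prescheme_of Q).
Implicit Types (x y z t : Q) (S T : {set Q}) (al be ga om ze b : M).

Definition face_top al : Q := (val al).1.
Definition face_atoms al : {set Q} := (val al).2.
Local Notation top := face_top.
Local Notation at_ := face_atoms.

Lemma face_le al be : (al <= be) = (top al <= top be) && (at_ al \subset at_ be).
Proof. by rewrite leEsub leEprod. Qed.

Lemma face_eq al be : top al = top be -> at_ al = at_ be -> al = be.
Proof.
move=> t a; apply: val_inj; move: t a; rewrite /top /at_.
by case: (val al); case: (val be) => ???? /= -> ->.
Qed.

Lemma in_SP_face al : in_SP (top al, at_ al).
Proof. by have := valP al; rewrite /top /at_; case: (val al). Qed.

Lemma face_atoms_below al : at_ al \subset atoms_below (top al).
Proof. by case/(in_SPP lmQ): (in_SP_face al). Qed.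

Lemma face_join al : join_below (top al) (at_ al) = top al.
Proof. by case/(in_SPP lmQ): (in_SP_face al). Qed.

Lemma faceP x T : in_SP (x, T) -> exists al, top al = x /\ at_ al = T.
Proof. by move=> h; exists (exist _ (x, T) h : M). Qed.

Lemma subface_exists al T : T \subset at_ al ->
  exists be, [/\ be <= al, at_ be = T & top be = join_below (top al) T].
Proof.
move=> Ta; have Tx := subset_trans Ta (face_atoms_below al).
have [be [tb ab]] := faceP (in_SP_join lmQ Tx).
by exists be; split=> //; rewrite face_le tb ab Ta join_below_le.
Qed.

Lemma subface_top al be : be <= al -> top be = join_below (top al) (at_ be).
Proof.
rewrite face_le => /andP[tt aa]; rewrite (join_below_mono lmQ tt) ?face_join //.
exact: face_atoms_below.
Qed.

Lemma subface_inj al be ga : be <= al -> ga <= al -> at_ be = at_ ga -> be = ga.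
Proof.
by move=> ba ca bc; apply: face_eq => //; rewrite (subface_top ba) (subface_top ca) bc.
Qed.

Lemma subface_le al be ga : be <= al -> ga <= al -> at_ be \subset at_ ga -> be <= ga.
Proof.
move=> ba ca bc; rewrite face_le bc andbT (subface_top ba) (subface_top ca).
apply: join_below_sub => //; apply: subset_trans (face_atoms_below _) _.
by apply: atoms_below_le; move: ca; rewrite face_le => /andP[].
Qed.

Lemma face_bottomsP al : reflect (at_ al = set0) (al \in bottoms M).
Proof.
apply: (iffP (bottomsP _)) => [h|a0 be].
  have [be [_ b0 _]] := subface_exists (sub0set (at_ al)).
  by have := h be; rewrite face_le b0 subset0 => /andP[_ /eqP].
rewrite face_le a0 sub0set andbT.
have := in_SP_rank_le lmQ (in_SP_face al); rewrite a0 cards0 leqn0.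
by move/(rank0P lmQ)/(_ (top be)).
Qed.

Lemma face_bottoms_neq0 : bottoms M != set0.
Proof.
have [b [bb b0]] := bottom_exists lmQ.
have [|al [_ aa]] := @faceP b set0; first by apply/(in_SPP lmQ); split;
  [exact: sub0set | apply: le_anti; rewrite bb join_below_le ?sub0set].
by apply/set0Pn; exists al; apply/face_bottomsP.
Qed.

Lemma face_is_rank : is_rank (fun al => #|at_ al|).
Proof.
split=> [al be|al /face_bottomsP ->|al be].
- by rewrite face_le => /andP[_ /subset_leq_card].
- exact: cards0.
case/andP=> ab nab; have [alb neq] := (ltW ab, lt_eqF ab).
have sub : at_ al \subset at_ be by move: alb; rewrite face_le => /andP[].
have /subsetPn[t tb nta] : ~~ (at_ be \subset at_ al).
  apply/negP => h; move/negP: (negbT neq); apply; apply/eqP.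
  by apply: (subface_inj alb (lexx _)); apply/eqP; rewrite eqEsubset sub.
have tab : t |: at_ al \subset at_ be by rewrite subUset sub1set tb.
have [ga [gb ag _]] := subface_exists tab.
have ag' : al < ga.
  rewrite lt_neqAle (subface_le alb gb) ?ag ?subsetUr // andbT.
  by apply: contraNneq nta => ->; rewrite ag setU11.
suff <- : ga = be by rewrite ag cardsU1 nta.
apply/eqP; apply: contraNT nab => gnb; apply/existsP; exists ga.
by rewrite ag' lt_neqAle gnb.
Qed.

Lemma rank_face al : rank al = #|at_ al|.
Proof. exact: rankE face_bottoms_neq0 face_is_rank al. Qed.

Lemma atom_faceP al b :
  reflect (exists2 t, t \in at_ al & top b = t /\ at_ b = [set t])
          (b \in atoms_below al).
Proof.
rewrite atoms_belowE rank_face; apply: (iffP andP) => [[/cards1P[t bt] ba]|[t ta [tb bt]]].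
  exists t; first by move: ba; rewrite face_le bt sub1set => /andP[].
  split=> //; have /(sub_atoms_below)[_ /(_ t)] := face_atoms_below b.
  rewrite bt set11 => /(_ isT) tb.
  apply/esym/(in_SP_min lmQ (in_SP_face b) tb) => u.
  by rewrite bt inE => /eqP ->.
rewrite bt cards1 eqxx face_le tb bt sub1set ta andbT; split=> //.
by have /sub_atoms_below[_ /(_ t ta)] := face_atoms_below al.
Qed.

Lemma atom_face_exists al t : t \in at_ al ->
  exists2 b, b \in atoms_below al & top b = t /\ at_ b = [set t].
Proof.
move=> ta; have tA : t \in atoms Q.
  by have /sub_atoms_below[/subsetP h _] := face_atoms_below al; apply: h.
have [b bt] := faceP (in_SP_atom tA).
by exists b => //; apply/atom_faceP; exists t.
Qed.

Lemma atom_face_top al b : b \in atoms_below al -> top b \in at_ al /\ at_ b = [set top b].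
Proof. by case/atom_faceP=> t ta [-> ->]. Qed.

Lemma face_top_inj al be : {in atoms_below al & atoms_below be, injective face_top}.
Proof.
by move=> b c /atom_face_top[_ ab] /atom_face_top[_ ac] bc; apply: face_eq; rewrite // ab ac bc.
Qed.

Lemma mem_atom_face al be b : b \in atoms_below al -> (b \in atoms_below be) = (top b \in at_ be).
Proof.
move=> ba; have [_ ab] := atom_face_top ba.
apply/idP/idP => [/atom_face_top[]//|tb]; apply/atom_faceP; exists (top b) => //.
Qed.

Lemma atoms_below_top al : [set top b | b in atoms_below al] = at_ al.
Proof.
apply/setP => t; apply/imsetP/idP => [[b /atom_face_top[tb _] ->]//|].
by case/atom_face_exists=> b ba [<- _]; exists b.
Qed.

Lemma card_atoms_below al : #|atoms_below al| = #|at_ al|.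
Proof. by rewrite -atoms_below_top card_in_imset //; apply: face_top_inj. Qed.

Lemma face_belowE al (T' : {set M}) : T' \subset atoms_below al ->
  [/\ face_below al T' <= al, at_ (face_below al T') = [set top b | b in T']
    & top (face_below al T') = join_below (top al) [set top b | b in T']].
Proof.
move=> Ta; have Ta' : [set top b | b in T'] \subset at_ al.
  by rewrite -atoms_below_top imsetS.
have atE be : be <= al -> (atoms_below be == T') = (at_ be == [set top b | b in T']).
  move=> ba; rewrite -atoms_below_top; apply/eqP/eqP => [->//|].
  have bsub : atoms_below be \subset atoms_below al by apply: atoms_below_le.
  move=> /setP E; apply/setP => b; apply/idP/idP => bb.
    have /imsetP[c cT tc] : top b \in [set top b | b in T'] by rewrite -E imset_f.
    by rewrite (face_top_inj (subsetP bsub _ bb) (subsetP Ta _ cT) tc).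
  have /imsetP[c cT tc] : top b \in [set top b | b in atoms_below be] by rewrite E imset_f.
  by rewrite (face_top_inj (subsetP Ta _ bb) (subsetP bsub _ cT) tc).
have [be [ba bT tb]] := subface_exists Ta'.
rewrite /face_below; case: pickP => [ga /andP[ga_al]|/(_ be)]; last first.
  by rewrite ba /= atE // bT eqxx.
by rewrite atE // => /eqP gT; split=> //; rewrite (subface_top ga_al) gT.
Qed.

Lemma face_indepE al : (al \in indep M) = basis (top al) (at_ al).
Proof. by rewrite inE /basis in_SP_face. Qed.

Lemma face_indep_sub al be : be <= al -> al \in indep M -> be \in indep M.
Proof.
move=> ba; rewrite !face_indepE => bal; rewrite (subface_top ba).
by apply: basis_sub bal _ => //; move: ba; rewrite face_le => /andP[].
Qed.

Lemma face_meetsE al be :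
  (meets [set al; be] == bottoms M) = [disjoint at_ al & at_ be].
Proof.
have [b0 bb] := set0Pn _ face_bottoms_neq0; have b0min := bottomsP _ bb.
apply/eqP/pred0P => [mE t|dis].
  apply/negP => /andP[/= ta tb].
  have [[b ba [tb1 ab1]] [c cb [tc1 ac1]]] := (atom_face_exists ta, atom_face_exists tb).
  have bc : b = c by apply: face_eq; rewrite ?tb1 ?ab1.
  have /meetsetP[_ /(_ b) mn] : b0 \in meets [set al; be] by rewrite mE.
  suff /mn : forall u, u \in [set al; be] -> b <= u.
    rewrite lt_neqAle b0min andbT negbK => /eqP b0b.
    by move: bb => /face_bottomsP; rewrite b0b ab1 => /setP/(_ t); rewrite !inE eqxx.
  move=> u; rewrite !inE => /orP[] /eqP ->.
    by move: ba; rewrite inE => /andP[].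
  by move: cb; rewrite bc inE => /andP[].
apply/setP => g; apply/meetsetP/idP => [[glb _]|gb].
  apply/face_bottomsP/setP => t; rewrite in_set0; apply/negP => tg.
  have := glb al; have := glb be; rewrite !inE !eqxx orbT => /(_ isT) + /(_ isT).
  rewrite !face_le => /andP[_ /subsetP/(_ t tg) tb] /andP[_ /subsetP/(_ t tg) ta].
  by have := dis t; rewrite /= ta tb.
have gmin := bottomsP _ gb; split=> [u _|w wlb]; first exact: gmin.
rewrite lt_neqAle gmin andbT negbK; apply/eqP; apply/esym.
suff w0 : at_ w = set0 by apply: (subface_inj (lexx w)); rewrite ?gmin // w0; apply/esym/face_bottomsP.
apply/setP => t; rewrite in_set0; apply/negP => tw.
have := wlb al; have := wlb be; rewrite !inE !eqxx orbT => /(_ isT) + /(_ isT).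
rewrite !face_le => /andP[_ /subsetP/(_ t tw) tb] /andP[_ /subsetP/(_ t tw) ta].
by have := dis t; rewrite /= ta tb.
Qed.

(** A common upper bound of two faces has a subface whose atoms are those of the
two faces; minimality forces equality. *)
Lemma face_joinsE al be ga : (ga \in joins [set al; be]) =
  [&& top al <= top ga, top be <= top ga & at_ ga == at_ al :|: at_ be].
Proof.
apply/joinsetP/and3P => [[ub mn]|[tal tbe /eqP ag]].
  have := ub al; have := ub be; rewrite !inE !eqxx orbT => /(_ isT) beg /(_ isT) alg.
  have [[tal aal] [tbe abe]] : (top al <= top ga /\ at_ al \subset at_ ga) /\
      (top be <= top ga /\ at_ be \subset at_ ga).
    by move: alg beg; rewrite !face_le => /andP[] ? ? /andP[].
  split=> //; have sub : at_ al :|: at_ be \subset at_ ga by rewrite subUset aal.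
  have [h [hg ah _]] := subface_exists sub.
  suff /mn : forall u, u \in [set al; be] -> u <= h.
    by rewrite lt_neqAle hg andbT negbK => /eqP <-; rewrite ah.
  move=> u; rewrite !inE => /orP[] /eqP ->; [apply: subface_le alg hg _ | apply: subface_le beg hg _];
    rewrite ah ?subsetUl ?subsetUr //.
split=> [u|w wub].
  by rewrite !inE => /orP[] /eqP ->; rewrite face_le ?tal ?tbe ag ?subsetUl ?subsetUr.
rewrite lt_neqAle; apply/negP => /andP[/negP nwg wg]; apply: nwg; apply/eqP.
apply: (subface_inj wg (lexx ga)); apply/eqP; rewrite eqEsubset andbC.
have -> /= : at_ w \subset at_ ga by move: wg; rewrite face_le => /andP[].
have := wub al; have := wub be; rewrite !inE !eqxx orbT => /(_ isT) + /(_ isT).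
by rewrite !face_le ag subUset => /andP[_ ->] /andP[_ ->].
Qed.

Lemma circuit_below om : om \notin indep M -> exists2 ze, ze <= om & is_circuit ze.
Proof.
case/(@minimal_below _ _ (fun om => om \notin indep M)) => ze zo [nz mn].
exists ze => //; rewrite /is_circuit nz; apply/forallP => y; apply/implyP => yz.
by apply: contraTT yz => /mn.
Qed.

Lemma circuit_indep ze be : is_circuit ze -> be < ze -> be \in indep M.
Proof. by case/andP=> _ /forallP/(_ be)/implyP. Qed.

Lemma unicircularP ze om : unicircular ze om ->
  [/\ is_circuit ze, ze <= om & forall xi, is_circuit xi -> xi <= om -> xi = ze].
Proof.
move/forallP => h; have := h ze; rewrite eqxx => /eqP/andP[cz zo]; split=> // xi cx xo.
by have := h xi; rewrite cx xo => /eqP/esym/eqP.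
Qed.

Lemma unicircular_dependent ze om : unicircular ze om -> om \notin indep M.
Proof.
case/unicircularP=> /andP[nz _] zo _; apply: contra nz.
exact: face_indep_sub.
Qed.

(** Removing an atom breaks the only circuit exactly when the atom lies on it. *)
Lemma unicircular_indep ze om b : unicircular ze om -> b \in atoms_below om ->
  (face_below om (atoms_below om :\ b) \in indep M) = (b \in atoms_below ze).
Proof.
move=> uni bo; have [cz zo uniq] := unicircularP uni.
have [fo af _] := face_belowE (subsetDl (atoms_below om) [set b]).
have afE t : (t \in at_ (face_below om (atoms_below om :\ b))) = (t != top b) && (t \in at_ om).
  rewrite af; apply/imsetP/andP => [[c]|[tb to]].
    rewrite in_setD1 => /andP[cb co] ->; have [-> _] := atom_face_top co; split=> //.
    by apply: contraNneq cb => /(face_top_inj co bo) ->.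
  have [c co [tc _]] := atom_face_exists to; exists c => //.
  by rewrite in_setD1 co andbT; apply: contraNneq tb => <-; rewrite tc.
rewrite (mem_atom_face _ bo); apply/idP/idP => [ind|bz].
  apply: contraTT ind => nbz; have /andP[nz _] := cz; apply: contra nz.
  apply: face_indep_sub; apply: (subface_le zo fo); apply/subsetP => t tz; rewrite afE.
  rewrite (contraTneq _ tz) /=; last by move=> ->.
  by move: zo; rewrite face_le => /andP[_ /subsetP]; apply.
apply/negPn/negP => /circuit_below[xi xf cx].
have xz := uniq xi cx (le_trans xf fo).
by move: xf; rewrite face_le xz => /andP[_ /subsetP/(_ _ bz)]; rewrite afE eqxx.
Qed.

(** Two circuits below a face of nullity one coincide: otherwise removing an
atom of the second one outside the first leaves a spanning set, independent by
its cardinality and yet containing the first. *)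
Lemma unicircular_exists om : #|at_ om| = (rank (top om)).+1 ->
  exists ze, unicircular ze om.
Proof.
move=> co; have : om \notin indep M.
  by rewrite face_indepE; apply/negP => /basis_card E; rewrite E in co; lia.
case/circuit_below=> ze zo cz; exists ze; apply/forallP => xi; apply/eqP.
apply/idP/eqP => [/andP[cx xo]|->]; last by rewrite cz zo.
apply/eqP/negPn/negP => nxz.
have /subsetPn[t tx ntz] : ~~ (at_ xi \subset at_ ze).
  apply: contra nxz => xz; have := subface_le xo zo xz; rewrite le_eqVlt => /orP[//|].
  by move/(circuit_indep cz); have /andP[/negPf ->] := cx.
have xom : at_ xi \subset at_ om by move: xo; rewrite face_le => /andP[].
have to : t \in at_ om by apply: (subsetP xom).
have [om' [oo ao topo]] := subface_exists (subsetDl (at_ om) [set t]).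
have [xi' [xx ax topx]] := subface_exists (subsetDl (at_ xi) [set t]).
have xi'I : xi' \in indep M.
  apply: (circuit_indep cx); rewrite lt_neqAle xx andbT; apply: contraTneq tx => <-.
  by rewrite ax !inE eqxx.
have topxx : top xi' = top xi.
  have tle : top xi' <= top xi by move: xx; rewrite face_le => /andP[].
  apply: (eq_of_rank lmQ tle); move: xi'I; rewrite face_indepE => /basis_card ->.
  have : xi \notin indep M by case/andP: cx.
  rewrite face_indepE /basis in_SP_face /= => nr.
  have := in_SP_rank_le lmQ (in_SP_face xi); rewrite leq_eqVlt (negPf nr) /=.
  by rewrite ax [in X in (_ < X)%N](cardsD1 t) tx add1n ltnS.
have topoo : top om' = top om.
  apply/(in_SP_min lmQ (in_SP_face om)); first by move: oo; rewrite face_le => /andP[].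
  have x'o' : xi' <= om'.
    by apply: (subface_le (le_trans xx xo) oo); rewrite ax ao setSD.
  have txo : top xi <= top om' by move: x'o'; rewrite face_le topxx => /andP[].
  move=> u uo; have [ut0|ut] := eqVneq u t.
    rewrite ut0; apply: (le_trans _ txo).
      by have /sub_atoms_below[_ h] := face_atoms_below xi; apply: h.
  have /sub_atoms_below[_] := face_atoms_below om'; apply.
  by rewrite ao !inE ut.
have : om' \in indep M.
  rewrite face_indepE /basis in_SP_face /= topoo ao; apply/eqP.
  by have := cardsD1 t (at_ om); rewrite to co => -[].
have zo' : ze <= om'.
  apply: (subface_le zo oo); rewrite ao subsetD1 ntz andbT.
  by move: zo; rewrite face_le => /andP[].
by move/(face_indep_sub zo'); case/andP: cz => /negPf ->.
Qed.

End Faces.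

Arguments face_top {d Q} al.
Arguments face_atoms {d Q} al.

(** * Flats of the deletion and of the contraction *)

Section Flats.
Local Open Scope order_scope.
Variables (d : Order.disp_t) (P : finPOrderType d).
Hypothesis lmP : locally_matroidal P.
Variables (a : P).
Local Notation M := (prescheme_of P).
Local Notation top := face_top.
Local Notation at_ := face_atoms.

(** The deletion is the case where [bb] is false, the contraction the case where
it is true; one argument describes the flats of both. *)
Variables (bb : bool) (p : pred M).
Hypothesis hp : forall y : M, p y = ((a \in at_ y) == bb).

Definition restricted_prescheme : prescheme _ :=
  @Prescheme _ (subposet p) [set x : subposet p | val x \in indep M].
Local Notation N := restricted_prescheme.
Implicit Types (al be ze om : M) (u v w : N).

Let lift_face om : p om -> exists u : N, val u = om.
Proof. by move=> pom; exists (exist _ om pom : N). Qed.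

Let leN u v : (u <= v) = (val u <= val v). Proof. by rewrite leEsub. Qed.
Let ltN u v : (u < v) = (val u < val v). Proof. by rewrite ltEsub. Qed.

Let indepN u : (u \in indep N) = (val u \in indep M).
Proof. by rewrite inE. Qed.

Let between om v w : val v <= om -> om <= val w -> p om.
Proof.
rewrite !face_le => /andP[_ /subsetP vo] /andP[_ /subsetP ow]; rewrite hp.
have := valP v; rewrite hp => /eqP; have := valP w; rewrite hp => /eqP.
case: bb => aw av; apply/eqP; first by rewrite vo ?av.
by apply/negP => /ow; rewrite aw.
Qed.

Let facet_cover be ze t : be <= ze -> t \in at_ ze -> at_ be = at_ ze :\ t ->
  forall v w, val v = be -> val w = ze -> covers v w.
Proof.
move=> bz tz bE v w vE wE; rewrite /covers ltN vE wE lt_neqAle bz andbT.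
apply/andP; split; first by apply: contraTneq tz => <-; rewrite bE !inE eqxx.
apply/existsP => -[y]; rewrite !ltN vE wE => /andP[by_ yz].
have [by' yz'] := (ltW by_, ltW yz).
have yE : at_ (val y) = at_ be \/ at_ (val y) = at_ ze.
  move: by' yz'; rewrite !face_le bE => /andP[_ sub1] /andP[_ sub2].
  have [ty|nty] := boolP (t \in at_ (val y)).
    by right; apply/eqP; rewrite eqEsubset sub2 -(setD1K tz) subUset sub1set ty.
  by left; apply/eqP; rewrite eqEsubset sub1 subsetD1 sub2 nty.
case: yE => yE.
  by move: by_; rewrite (subface_inj lmP yz' bz yE) ltxx.
by move: yz; rewrite (subface_inj lmP yz' (lexx _) yE) ltxx.
Qed.

(** Let [c] be an atom below the top of [u] but not in [u], and let [B] be a basis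
contained in [u].  The face [c |: B] is dependent; a circuit in it contains [c],
and it covers a face below [u], so that [u] is not flat.  Conversely, a circuit
that covers an independent face has the same top as that face. *)
Lemma flatP u : is_flat u <-> atoms_below (top (val u)) :\ a \subset at_ (val u).
Proof.
split=> [|flat_u].
  move/forallP => flat_u; apply/subsetP => c; rewrite !in_setD1 => /andP[ca cx].
  apply/negPn/negP => ncu; set x := top (val u).
  (* In the contraction the basis has to contain [a]. *)
  pose A : {set P} := if bb then [set a] else set0.
  have Au : A \subset at_ (val u).
    rewrite /A; have := valP u; rewrite hp => /eqP; case: bb => au; last exact: sub0set.
    by rewrite sub1set au.
  have rA : rank (join_below x A) = #|A|.
    rewrite /A; move: Au; rewrite /A; case: bb => [ax|_]; last by rewrite rank_join0 // cards0.
    have ax' := subset_trans ax (face_atoms_below lmP (val u)).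
    apply/eqP; rewrite eqn_leq rank_join_le //= cards1.
    have := join_below_ub lmP ax' (set11 a); move/(rank_le lmP); apply: leq_trans.
    by move: ax'; rewrite sub1set atoms_belowE => /andP[/eqP ->].
  have [B [AB Bu bB]] := basis_extend lmP (in_SP_face (val u)) Au rA.
  have ncB : c \notin B by apply: contra ncu; apply: (subsetP Bu).
  have cBx : c |: B \subset atoms_below x by rewrite subUset sub1set cx (basis_atoms lmP bB).
  have cBspan : in_SP (x, c |: B).
    apply/(in_SPP lmP); split=> //; apply: le_anti; rewrite join_below_le //=.
    by rewrite -[leLHS](basis_join lmP bB) join_below_sub ?subsetUr.
  have [om [ox oB]] := faceP cBspan.
  have [be [bx bE]] := faceP (proj1 (andP bB)).
  have aB : (a \in B) = bb.
    have := valP u; rewrite hp => /eqP; move: AB; rewrite /A; case: bb => [|_ au].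
      by rewrite sub1set => ->.
    by apply/negbTE; move: au => /negbT; apply: contra; apply: (subsetP Bu).
  have pom : p om by rewrite hp oB !inE [a == c]eq_sym (negPf ca) aB eqxx.
  have [w wE] := lift_face pom.
  have bI : be \in indep M by rewrite face_indepE bx bE.
  have oN : w \notin indep N.
    rewrite indepN wE face_indepE ox oB; apply/negP => /basis_card; rewrite (basis_card bB).
    by rewrite cardsU1 ncB => /eqP; rewrite -[X in X == _]add0n eqn_add2r.
  have [ze zw [nz mz]] := @minimal_below _ _ (fun w => w \notin indep N) w oN.
  have cz : is_circuit ze.
    rewrite /is_circuit nz; apply/forallP => y; apply/implyP => yz.
    by apply: contraTT yz => /mz.
  have zo : val ze <= om by rewrite -wE -leN.
  have bo : be <= om by rewrite face_le ox oB bx bE lexx subsetUr.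
  have czz : c \in at_ (val ze).
    apply: contraT => ncz; case/negP: nz; rewrite indepN; apply: face_indep_sub bI => //.
    apply: (subface_le lmP zo bo); rewrite bE.
    move: zo; rewrite face_le oB => /andP[_]; rewrite -subDset; apply: subset_trans.
    by rewrite subsetD1 subxx ncz.
  have [al [az aE _]] := subface_exists lmP (subsetDl (at_ (val ze)) [set c]).
  have pal : p al.
    by rewrite hp aE !inE [a == c]eq_sym ca; have := valP ze; rewrite hp.
  have [v vE] := lift_face pal.
  have vz : covers v ze := facet_cover az czz aE vE (erefl _).
  have vu : v <= u.
    rewrite leN vE face_le aE; apply/andP; split.
      by apply: le_trans (_ : top (val ze) <= _); [move: az | move: zo]; rewrite face_le ?ox => /andP[].
    apply: subset_trans Bu; rewrite subDset; move: zo; rewrite face_le oB => /andP[_ sub].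
    exact: sub.
  have := flat_u ze; rewrite cz (_ : [exists al0, _]) /=; last by apply/existsP; exists v; rewrite vu.
  by rewrite leN face_le => /andP[_ /subsetP/(_ c czz)]; rewrite (negPf ncu).
apply/forallP => ze; apply/implyP => /andP[cz /existsP[al /andP[alu]]].
rewrite /covers => /andP[alz nbet]; have alz' : val al < val ze by rewrite -ltN.
have card : #|at_ (val ze)| = #|at_ (val al)|.+1.
  have [_ _] := face_is_rank lmP; apply; rewrite /covers alz' /=.
  apply: contra nbet => /existsP[y /andP[aly yz]]; apply/existsP.
  have [y' y'E] := lift_face (between (ltW aly) (ltW yz)).
  by exists y'; rewrite !ltN y'E aly.
have [nz allI] := andP cz.
have alI : val al \in indep M.
  by rewrite -indepN; have /forallP/(_ al)/implyP := allI; apply.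
have tz : top (val al) = top (val ze).
  have := ltW alz'; rewrite face_le => /andP[tt _].
  apply: (eq_of_rank lmP tt); move: alI; rewrite face_indepE => /basis_card ->.
  rewrite -ltnS -card ltn_neqAle (in_SP_rank_le lmP (in_SP_face _)) andbT.
  by move: nz; rewrite indepN face_indepE /basis in_SP_face.
rewrite leN face_le -tz; move: (alu); rewrite leN face_le => /andP[tau subau].
rewrite tau; apply/subsetP => t tze; have [ta|nta] := eqVneq t a; last first.
  apply: (subsetP flat_u); rewrite in_setD1 nta.
  apply: (subsetP (atoms_below_le tau)); rewrite tz.
  exact: (subsetP (face_atoms_below lmP _)).
have := valP u; have := valP ze; rewrite !hp ta -[in X in X -> _]ta tze => /eqP <- /eqP.
by [].
Qed.

Definition flat_top (x : flats N) : P := top (val (val x)).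

Lemma flat_atoms (x : flats N) : at_ (val (val x)) =
  if bb then atoms_below (flat_top x) else atoms_below (flat_top x) :\ a.
Proof.
have /flatP sub := valP x; have := valP (val x); rewrite hp => /eqP ab.
have sup := face_atoms_below lmP (val (val x)).
apply/eqP; rewrite eqEsubset; case: bb ab => ab; last first.
  by rewrite subsetD1 ab sup.
rewrite sup; apply/subsetP => t tx; have [->|ta] := eqVneq t a; first by rewrite ab.
by apply: (subsetP sub); rewrite in_setD1 ta.
Qed.

Lemma flat_le (x y : flats N) : (x <= y) = (flat_top x <= flat_top y).
Proof.
rewrite leEsub leN face_le; case: (boolP (_ <= _)) => //= xy.
rewrite !flat_atoms; have sub := atoms_below_le xy.
by case: bb; rewrite // subsetD1 (subset_trans (subsetDl _ _) sub) !inE eqxx.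
Qed.

Lemma flat_top_deletion z : bb = false ->
  (exists x : flats N, flat_top x = z) <-> in_SP (z, atoms_below z :\ a).
Proof.
move=> b0; split=> [[x <-]|/faceP[al [ax aE]]].
  by have := in_SP_face (val (val x)); rewrite flat_atoms b0.
have pal : p al by rewrite hp aE b0 !inE eqxx.
have [u uE] := lift_face pal.
have fu : is_flat u by apply/flatP; rewrite uE aE ax.
by exists (exist _ u fu : flats N); rewrite /flat_top /= uE.
Qed.

Lemma flat_top_contraction z : bb = true -> a \in atoms P ->
  (exists x : flats N, flat_top x = z) <-> a <= z.
Proof.
move=> b1 ha; split=> [[x <-]|az].
  have := valP (val x); rewrite hp b1 flat_atoms b1 => /eqP.
  by rewrite inE => /andP[].
have [al [ax aE]] := faceP (in_SP_atoms_below lmP z).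
have pal : p al by rewrite hp aE b1 inE ha az.
have [u uE] := lift_face pal.
have fu : is_flat u by apply/flatP; rewrite uE aE ax subsetDl.
by exists (exist _ u fu : flats N); rewrite /flat_top /= uE.
Qed.

End Flats.

(** * The deletion as a poset embedded in the original one *)

Section DeletionEmbedding.
Local Open Scope order_scope.
Variables (d d' : Order.disp_t) (P : finPOrderType d) (F : finPOrderType d').
Hypothesis lmP : locally_matroidal P.
Variables (a : P) (ha : a \in atoms P) (iota : F -> P).
Hypothesis iota_le : forall x y, (x <= y) = (iota x <= iota y).
Hypothesis iota_im : forall z, (exists x, iota x = z) <-> in_SP (z, atoms_below z :\ a).
Implicit Types (x y t : F) (z w : P) (T : {set F}) (S : {set P}).

Lemma embedding_inj : injective iota.
Proof. by move=> x y xy; apply: le_anti; rewrite !iota_le xy lexx. Qed.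

Lemma embedding_lt x y : (x < y) = (iota x < iota y).
Proof. by rewrite !lt_neqAle iota_le (inj_eq embedding_inj). Qed.

Lemma embedding_retraction (b : F) : exists kappa : P -> F, cancel iota kappa.
Proof.
exists (fun z => odflt b [pick x | iota x == z]) => x.
by case: pickP => [y /eqP /embedding_inj //|/(_ x)]; rewrite eqxx.
Qed.

Let a1 : rank a = 1%N. Proof. by move: (ha); rewrite inE => /eqP. Qed.

Lemma deletion_span x : in_SP (iota x, atoms_below (iota x) :\ a).
Proof. by apply/iota_im; exists x. Qed.

Lemma deletion_eq x w : w <= iota x ->
  (forall z, z \in atoms_below (iota x) :\ a -> z <= w) -> w = iota x.
Proof. exact: in_SP_min (deletion_span x). Qed.

(** A join of atoms other than [a] is spanned by these atoms. *)
Lemma deletion_join z S : S \subset atoms_below z :\ a ->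
  exists x, iota x = join_below z S.
Proof.
rewrite subsetD1 => /andP[Sz naS]; apply/iota_im; set j := join_below z S.
have Sj : S \subset atoms_below j := sub_atoms_join lmP Sz.
have sub : atoms_below j :\ a \subset atoms_below j := subsetDl _ _.
apply/(in_SPP lmP); split=> //; apply: (in_SP_min lmP (in_SP_join lmP Sz)).
  exact: join_below_le.
move=> t tS; apply: join_below_ub => //; rewrite in_setD1 (subsetP Sj) // andbT.
by apply: contraNneq naS => <-.
Qed.

Lemma deletion_bottom : exists b : F, (forall x, b <= x) /\ rank (iota b) = 0%N.
Proof.
have [b [bmin b0]] := bottom_exists lmP.
have [|x xE] := @deletion_join b set0; first exact: sub0set.
have xb : iota x = b.
  by apply: le_anti; rewrite bmin xE join_below_le ?sub0set.
by exists x; rewrite xb; split=> // y; rewrite iota_le xb.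
Qed.

Lemma deletion_bottoms : bottoms F != set0.
Proof.
by have [b [bmin _]] := deletion_bottom; apply/set0Pn; exists b; apply/bottomsP.
Qed.

(** The join of [z] with the atoms other than [a] below [y] belongs to the deletion, and
exchange bounds its rank. *)
Lemma deletion_step x y z : y <= x -> z \in atoms_below (iota x) :\ a -> ~~ (z <= iota y) ->
  exists w : F, [/\ y <= w, w <= x, z <= iota w & rank (iota w) = (rank (iota y)).+1].
Proof.
move=> yx zx nzy; have yx' : iota y <= iota x by rewrite -iota_le.
set S := z |: (atoms_below (iota y) :\ a).
have Sx : S \subset atoms_below (iota x) :\ a.
  by rewrite subUset sub1set zx setSD // atoms_below_le.
have [w wE] := deletion_join Sx.
have Sx' : S \subset atoms_below (iota x) := subset_trans Sx (subsetDl _ _).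
have zw : z <= iota w by rewrite wE join_below_ub // setU11.
have yw : iota y <= iota w.
  have [_ <-] := in_SPP lmP _ _ (deletion_span y); rewrite wE.
  rewrite -(join_below_mono lmP yx' (subsetDl _ _)).
  by apply: join_below_sub => //; apply: subsetUr.
have zx' : z \in atoms_below (iota x) by move: zx; rewrite in_setD1 => /andP[].
have [v [vx yv zv vr]] := lm_exchange lmP yx' zx' nzy.
exists w; rewrite !iota_le yw wE join_below_le //; split=> //; first by rewrite -wE.
apply/eqP; rewrite eqn_leq; apply/andP; split.
  rewrite -vr rank_le //; apply: join_below_min => // t; rewrite in_setU1 => /orP[/eqP -> //|].
  by rewrite in_setD1 => /andP[_]; rewrite inE => /andP[_ /le_trans]; apply.
apply: rank_lt => //; rewrite lt_neqAle -wE yw andbT.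
by apply: contraNneq nzy => ->.
Qed.

Lemma deletion_is_rank : is_rank (fun x => rank (iota x)).
Proof.
split=> [x y|x /bottomsP xmin|y x].
- by rewrite iota_le; apply: rank_le.
- have [b [bmin b0]] := deletion_bottom.
  by rewrite (_ : x = b) //; apply: le_anti; rewrite xmin bmin.
rewrite /covers => /andP[yx nbet].
have [/existsP[z /andP[zx nzy]]|/existsPn H] :=
    boolP [exists z, (z \in atoms_below (iota x) :\ a) && ~~ (z <= iota y)]; last first.
  have yx' : iota y <= iota x by rewrite -iota_le ltW.
  have E : iota y = iota x.
    by apply: deletion_eq => // z zx; have := H z; rewrite zx negbK.
  by rewrite (embedding_inj E) ltxx in yx.
have [w [yw wx zw rw]] := deletion_step (ltW yx) zx nzy.
suff <- : w = x by [].
apply/eqP; apply: contraNT nbet => nwx; apply/existsP; exists w.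
rewrite [w < x]lt_neqAle nwx wx lt_neqAle yw !andbT.
by apply: contraNneq nzy => ->.
Qed.

Lemma deletion_rank x : rank x = rank (iota x).
Proof. exact: rankE deletion_bottoms deletion_is_rank x. Qed.

Lemma deletion_atom_neq x : rank x = 1%N -> iota x != a.
Proof.
rewrite deletion_rank => x1; apply: contra_eq_neq x1 => xa.
have := in_SP_rank_le lmP (deletion_span x); rewrite xa.
suff -> : atoms_below a :\ a = set0 by rewrite cards0 leqn0 => /eqP ->.
apply/setP => t; rewrite !inE; apply/negP => /and3P[ta /eqP t1 tle]; case/eqP: ta.
by apply: (eq_of_rank lmP tle); rewrite t1 a1.
Qed.

Lemma deletion_atoms_below x t : (t \in atoms_below x) = (iota t \in atoms_below (iota x)).
Proof. by rewrite !atoms_belowE deletion_rank iota_le. Qed.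

Lemma deletion_atom_image z : z \in atoms P -> z != a -> exists t, iota t = z.
Proof.
move=> z1 za; apply/iota_im; have zz : z \in atoms_below z :\ a by rewrite in_setD1 za inE z1 lexx.
apply/(in_SPP lmP); split; first exact: subsetDl.
apply: le_anti; rewrite join_below_le ?subsetDl //=.
by apply: join_below_ub; rewrite ?subsetDl.
Qed.

Lemma deletion_image_atoms x : iota @: atoms_below x = atoms_below (iota x) :\ a.
Proof.
apply/setP => z; rewrite in_setD1; apply/imsetP/andP => [[t tx ->]|[za zx]].
  rewrite -deletion_atoms_below tx deletion_atom_neq //.
  by apply/eqP; move: tx; rewrite atoms_belowE => /andP[].
have zA : z \in atoms P by move: zx; rewrite inE => /andP[].
by have [t tz] := deletion_atom_image zA za; exists t; rewrite // deletion_atoms_below tz.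
Qed.

Lemma deletion_image_sub x T : (T \subset atoms_below x) = (iota @: T \subset atoms_below (iota x)).
Proof.
apply/subsetP/subsetP => [h _ /imsetP[t tT ->]|h t tT].
  by rewrite -deletion_atoms_below h.
by rewrite deletion_atoms_below; apply: h; apply: imset_f.
Qed.

Lemma deletion_image_sub_neq x T : T \subset atoms_below x ->
  iota @: T \subset atoms_below (iota x) :\ a.
Proof. by move=> Tx; rewrite -deletion_image_atoms imsetS. Qed.

Lemma deletion_matroidal : locally_matroidal F.
Proof.
split; first exact: deletion_bottoms.
- by apply: rank_is_rank; exists (fun x => rank (iota x)); apply: deletion_is_rank.
- move=> x T Tx; have Sx := deletion_image_sub_neq Tx.
  have Sx' := subset_trans Sx (subsetDl _ _).
  have [j jE] := deletion_join Sx; exists j; rewrite iota_le jE join_below_le //.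
  split=> // [t tT|u]; first by rewrite iota_le jE join_below_ub // imset_f.
  rewrite !iota_le => ux uub; rewrite jE; apply: join_below_min => // z /imsetP[t tT ->].
  by rewrite -iota_le uub.
- move=> x u ux uub; apply: embedding_inj; apply: deletion_eq; first by rewrite -iota_le.
  by move=> z; rewrite -deletion_image_atoms => /imsetP[t tx ->]; rewrite -iota_le uub.
move=> x y t yx tx nty.
have zx : iota t \in atoms_below (iota x) :\ a by rewrite -deletion_image_atoms imset_f.
have nty' : ~~ (iota t <= iota y) by rewrite -iota_le.
have [w [yw wx tw rw]] := deletion_step yx zx nty'.
by exists w; rewrite !deletion_rank; split=> //; rewrite iota_le.
Qed.

Lemma deletion_in_SP x T : in_SP (x, T) = in_SP (iota x, iota @: T).
Proof.
apply/(in_SPP deletion_matroidal)/(in_SPP lmP) => -[Tx xE].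
  have Sx := deletion_image_sub_neq Tx; have Sx' := subset_trans Sx (subsetDl _ _).
  split=> //; have [j jE] := deletion_join Sx.
  suff jx : j = x by rewrite -jE jx.
  apply: (in_SP_min deletion_matroidal (T := T)); first exact/(in_SPP deletion_matroidal).
    by rewrite iota_le jE join_below_le.
  by move=> t tT; rewrite iota_le jE join_below_ub // imset_f.
have Tx' : T \subset atoms_below x by rewrite deletion_image_sub.
split=> //; apply: embedding_inj; apply: (in_SP_min lmP (T := iota @: T)).
- exact/(in_SPP lmP).
- by rewrite -iota_le (join_below_le deletion_matroidal).
- by move=> z /imsetP[t tT ->]; rewrite -iota_le (join_below_ub deletion_matroidal).
Qed.

Lemma deletion_basis x T : basis x T = basis (iota x) (iota @: T).
Proof. by rewrite /basis deletion_in_SP deletion_rank card_imset //; apply: embedding_inj. Qed.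

Lemma deletion_basis_image z S : a \notin S -> basis z S ->
  exists x T, [/\ iota x = z, iota @: T = S & basis x T].
Proof.
move=> naS bS; have Sz := basis_atoms lmP bS.
have Sz' : S \subset atoms_below z :\ a by rewrite subsetD1 Sz.
have [x xE] := deletion_join Sz'; rewrite (basis_join lmP bS) in xE.
have TE : iota @: (iota @^-1: S) = S.
  apply/setP => s; apply/imsetP/idP => [[t]|sS]; first by rewrite inE => tS ->.
  have sA : s \in atoms P by move: (subsetP Sz _ sS); rewrite inE => /andP[].
  have sa : s != a by apply: contraNneq naS => <-.
  by have [t tE] := deletion_atom_image sA sa; exists t; rewrite ?inE tE.
by exists x, (iota @^-1: S); split=> //; rewrite deletion_basis TE xE.
Qed.

End DeletionEmbedding.

(** * The contraction as a poset embedded in the original one *)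

Section ContractionEmbedding.
Local Open Scope order_scope.
Variables (d d' : Order.disp_t) (P : finPOrderType d) (F : finPOrderType d').
Hypothesis lmP : locally_matroidal P.
Variables (a : P) (ha : a \in atoms P) (iota : F -> P).
Hypothesis iota_le : forall x y, (x <= y) = (iota x <= iota y).
Hypothesis iota_im : forall z, (exists x, iota x = z) <-> a <= z.
Implicit Types (x y t : F) (z w : P) (T : {set F}) (S : {set P}).

Let iota_inj : injective iota := embedding_inj iota_le.
Let iota_lt := embedding_lt iota_le.

Let a1 : rank a = 1%N. Proof. by move: (ha); rewrite inE => /eqP. Qed.

Lemma contraction_ge x : a <= iota x.
Proof. by apply/iota_im; exists x. Qed.

Lemma contraction_atom x : a \in atoms_below (iota x).
Proof. by rewrite inE ha contraction_ge. Qed.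

Lemma contraction_bottom : exists b : F, (forall x, b <= x) /\ iota b = a.
Proof.
have /iota_im[b ba] := lexx a; exists b; split=> // x.
by rewrite iota_le ba contraction_ge.
Qed.

Lemma contraction_bottoms : bottoms F != set0.
Proof.
by have [b [bmin _]] := contraction_bottom; apply/set0Pn; exists b; apply/bottomsP.
Qed.

Lemma contraction_rank_gt0 x : (0 < rank (iota x))%N.
Proof. by rewrite -a1 rank_le ?contraction_ge. Qed.

Lemma contraction_is_rank : is_rank (fun x => (rank (iota x)).-1).
Proof.
have [_ _ rc] := lm_rank lmP.
split=> [x y|x /bottomsP xmin|y x].
- by rewrite iota_le => /(rank_le lmP); rewrite -!subn1; apply: leq_sub2r.
- have [b [bmin bE]] := contraction_bottom.
  by rewrite (_ : x = b) ?bE ?a1 //; apply: le_anti; rewrite xmin bmin.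
rewrite /covers => /andP[yx nbet]; rewrite (rc (iota y) (iota x)) /=.
  by rewrite prednK ?contraction_rank_gt0.
rewrite /covers -iota_lt yx; apply: contra nbet => /existsP[z /andP[yz zx]].
have /iota_im[w wE] : a <= z := le_trans (contraction_ge y) (ltW yz).
by apply/existsP; exists w; rewrite !iota_lt wE yz.
Qed.

Lemma contraction_rank x : (rank x).+1 = rank (iota x).
Proof.
by rewrite (rankE contraction_bottoms contraction_is_rank) prednK ?contraction_rank_gt0.
Qed.

Lemma contraction_atoms_below x t :
  (t \in atoms_below x) = (rank (iota t) == 2%N) && (iota t <= iota x).
Proof. by rewrite atoms_belowE -contraction_rank iota_le. Qed.

Lemma contraction_line x z : z \in atoms_below (iota x) -> z != a ->
  exists2 t, t \in atoms_below x & iota t = join_below (iota x) [set a; z].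
Proof.
move=> zx za; have sub : [set a; z] \subset atoms_below (iota x).
  by rewrite subUset !sub1set contraction_atom.
have /iota_im[t tE] : a <= join_below (iota x) [set a; z].
  by rewrite join_below_ub ?set21.
exists t => //; rewrite contraction_atoms_below tE join_below_le // andbT.
by rewrite (rank_line lmP) ?contraction_atom // eq_sym.
Qed.

Lemma contraction_line_eq x t z : t \in atoms_below x -> z \in atoms P -> z != a ->
  z <= iota t -> iota t = join_below (iota x) [set a; z].
Proof.
rewrite contraction_atoms_below => /andP[/eqP t2 tx] zA za zt.
have zx : z \in atoms_below (iota x) by rewrite inE zA (le_trans zt).
have sub : [set a; z] \subset atoms_below (iota x).
  by rewrite subUset !sub1set contraction_atom.
apply/esym/(eq_of_rank lmP); last by rewrite t2 (rank_line lmP) ?contraction_atom // eq_sym.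
apply: join_below_min => // u; rewrite !inE => /orP[] /eqP -> //.
exact: contraction_ge.
Qed.

(** An element of rank two is the join of its atoms, hence has an atom besides
[a]. *)
Lemma contraction_lift t : rank t = 1%N ->
  exists z, [/\ z \in atoms P, z != a & z <= iota t].
Proof.
move=> t1; have t2 : rank (iota t) = 2%N by rewrite -contraction_rank t1.
have [/existsP[z /and3P[zA za zt]]|/existsPn H] :=
  boolP [exists z, [&& z \in atoms P, z != a & z <= iota t]]; first by exists z.
have : a = iota t.
  apply: (lm_atomic lmP (contraction_ge t)) => z; rewrite inE => /andP[zA zt].
  by have := H z; rewrite zA zt andbT /= negbK => /eqP ->.
by move=> ta; rewrite -ta a1 in t2.
Qed.

Lemma contraction_lifting : exists lift : F -> P, forall x t, t \in atoms_below x ->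
  lift t \in atoms_below (iota x) :\ a /\ iota t = join_below (iota x) [set a; lift t].
Proof.
have /choice[lift liftP] : forall t, exists z, rank t = 1%N ->
    [/\ z \in atoms P, z != a & z <= iota t].
  move=> t; have [t1|nt1] := eqVneq (rank t) 1%N; last first.
    by exists a => t1; rewrite t1 eqxx in nt1.
  by have [z zP] := contraction_lift t1; exists z.
exists lift => x t tx; have [t1 tx'] : rank t = 1%N /\ t <= x.
  by move: tx; rewrite atoms_belowE => /andP[/eqP -> ->].
have [lA la lt] := liftP t t1; rewrite in_setD1 la inE lA (le_trans lt) -?iota_le //.
by split=> //; apply: (contraction_line_eq tx lA la lt).
Qed.

Lemma contraction_matroidal : locally_matroidal F.
Proof.
split; first exact: contraction_bottoms.
- by apply: rank_is_rank; exists (fun x => (rank (iota x)).-1); apply: contraction_is_rank.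
- move=> x T Tx; pose S := a |: \bigcup_(t in T) atoms_below (iota t).
  have Tle t : t \in T -> iota t <= iota x.
    by move/(subsetP Tx); rewrite inE => /andP[_]; rewrite iota_le.
  have Sx : S \subset atoms_below (iota x).
    rewrite subUset sub1set contraction_atom; apply/bigcupsP => t tT.
    by apply: atoms_below_le; apply: Tle.
  have /iota_im[j jE] : a <= join_below (iota x) S by rewrite join_below_ub ?setU11.
  exists j; rewrite iota_le jE join_below_le //; split=> // [t tT|u].
    rewrite iota_le jE; have [_ <-] := in_SPP lmP _ _ (in_SP_atoms_below lmP (iota t)).
    rewrite -(join_below_mono lmP (Tle t tT) (subxx _)); apply: join_below_sub => //.
    by apply: subset_trans (subsetUr _ _); apply: (bigcup_sup t).
  rewrite !iota_le => ux uub; rewrite jE; apply: join_below_min => // z.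
  rewrite in_setU1 => /orP[/eqP ->|/bigcupP[t tT]]; first exact: contraction_ge.
  by rewrite inE => /andP[_ zt]; apply: (le_trans zt); rewrite -iota_le uub.
- move=> x u; rewrite iota_le => ux uub; apply: iota_inj.
  apply: (lm_atomic lmP ux) => z zx; have [->|za] := eqVneq z a.
    exact: contraction_ge.
  have [t tx tE] := contraction_line zx za.
  apply: le_trans (_ : iota t <= _); last by rewrite -iota_le uub.
  by rewrite tE join_below_ub ?set22 // subUset !sub1set contraction_atom.
move=> x y t yx tx nty.
have [t1 tx'] : rank t = 1%N /\ t <= x.
  by move: tx; rewrite atoms_belowE => /andP[/eqP -> ->].
have [z [zA zt nzy]] : exists z, [/\ z \in atoms P, z <= iota t & ~~ (z <= iota y)].
  have [z [zA za zt]] := contraction_lift t1; exists z; split=> //.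
  apply: contra nty => zy; rewrite iota_le (contraction_line_eq tx zA za zt).
  have xy : iota y <= iota x by rewrite -iota_le.
  apply: join_below_min => // [|u]; last first.
    by rewrite !inE => /orP[] /eqP -> //; apply: contraction_ge.
  by rewrite subUset !sub1set contraction_atom inE zA (le_trans zy).
have za : z != a by apply: contraNneq nzy => ->; apply: contraction_ge.
have zx : z \in atoms_below (iota x) by rewrite inE zA (le_trans zt) // -iota_le.
have yx' : iota y <= iota x by rewrite -iota_le.
have [w [wx yw zw rw]] := lm_exchange lmP yx' zx nzy.
have aw : a <= w := le_trans (contraction_ge y) yw.
have /iota_im[v vE] := aw; exists v; rewrite !iota_le vE; split=> //.
  rewrite (contraction_line_eq tx zA za zt); apply: join_below_min => //.
    by rewrite subUset !sub1set contraction_atom.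
  by move=> u; rewrite !inE => /orP[] /eqP ->.
by apply/eqP; rewrite -eqSS !contraction_rank vE rw.
Qed.

End ContractionEmbedding.

Local Open Scope ring_scope.

(** * Alternating functions on sequences *)

Section Alternating.
Variables (R : numDomainType) (T : eqType).
Implicit Types (h : seq T -> R) (s : seq T) (t : T).

Definition alternating h :=
  forall s u v s', h (s ++ u :: v :: s') = - h (s ++ v :: u :: s').

Lemma alternating_prefix h s : alternating h -> alternating (fun s2 => h (s ++ s2)).
Proof. by move=> ah s1 u v s2; rewrite !catA; apply: ah. Qed.

Lemma alternating_cons h t : alternating h -> alternating (fun u => h (t :: u)).
Proof. exact: (@alternating_prefix h [:: t]). Qed.

Lemma alternating_suffix h s : alternating h -> alternating (fun u => h (u ++ s)).
Proof. by move=> ah s1 u v s2; rewrite -!catA; apply: ah. Qed.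

Lemma alternating_to_front h s t u : alternating h ->
  h (s ++ t :: u) = (-1) ^+ size s * h (t :: s ++ u).
Proof.
elim: s h => [|x s IH] h ah /=; first by rewrite mul1r.
rewrite (IH (fun u => h (x :: u))); last exact: alternating_cons.
by rewrite (ah [::]) /= exprS mulN1r mulNr mulrN.
Qed.

Lemma alternating_swap h s1 s2 s3 s4 : alternating h ->
  h (s1 ++ s2 ++ s3 ++ s4) =
    (-1) ^+ (size s2 * size s3)%N * h (s1 ++ s3 ++ s2 ++ s4).
Proof.
move=> /(@alternating_prefix h s1).
rewrite -![h (s1 ++ _)]/((fun s => h (s1 ++ s)) _).
move: (fun s => h (s1 ++ s)) => g; elim: s3 g => [|t s3 IH] g ag.
  by rewrite muln0 mul1r.
rewrite cat_cons (alternating_to_front s2 t _ ag) (IH (fun s => g (t :: s))).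
  by rewrite mulrA -exprD mulnS.
exact: alternating_cons.
Qed.

(** Moving one of two equal entries next to the other shows that the value is
its own opposite. *)
Lemma alternating_eq0 h s : alternating h -> ~~ uniq s -> h s = 0.
Proof.
elim: s h => [|t s IH] //= h ah; rewrite negb_and negbK => /orP[|us]; last first.
  by apply: (IH (fun u => h (t :: u))) => //; apply: alternating_cons.
case/splitPr=> s1 s2.
rewrite (alternating_to_front s1 t s2 (alternating_cons t ah)).
have /eqP := ah [::] t t (s1 ++ s2).
by rewrite -addr_eq0 -mulr2n mulrn_eq0 => /eqP ->; rewrite mulr0.
Qed.

(** By induction on [n]: the permutation is a lift of a smaller one, and moving
the image of the first index to the front accounts for the difference of the
signs. *)
Lemma alternating_ord n (t : 'I_n -> T) (p : 'S_n) h : alternating h ->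
  h [seq t (p i) | i <- enum 'I_n] = (-1) ^+ p * h [seq t i | i <- enum 'I_n].
Proof.
elim: n t p h => [|n IH] t p h ah.
  by rewrite enum_ord0 permS0 odd_perm1 mul1r.
have [q pE] : exists q : 'S_n, p = lift_perm ord0 (p ord0) q.
  have pne k : p ord0 != p (lift ord0 k).
    by rewrite (inj_eq perm_inj); apply: neq_lift.
  pose f k := odflt k (unlift (p ord0) (p (lift ord0 k))).
  have fE k : lift (p ord0) (f k) = p (lift ord0 k).
    by rewrite /f; case: (unlift_some (pne k)) => l El -> /=; rewrite -El.
  have finj : injective f.
    move=> k l kl; have := fE k; rewrite kl fE => /perm_inj.
    by move/lift_inj.
  exists (perm finj); apply/permP => i.
  case: (unliftP ord0 i) => [k|] ->; last by rewrite lift_perm_id.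
  by rewrite lift_perm_lift permE fE.
move: pE; set j := p ord0 => pE.
rewrite pE enum_ordSl /= lift_perm_id -map_comp.
under eq_map => k do rewrite /= lift_perm_lift.
rewrite (IH (fun k => t (lift j k)) q _ (alternating_cons (t j) ah)).
rewrite odd_lift_perm /= -(map_comp t (lift ord0)).
have -> : t ord0 :: [seq t (lift ord0 i) | i <- enum 'I_n] =
          [seq t i | i <- enum 'I_n.+1] by rewrite enum_ordSl /= -map_comp.
set s := [seq t i | i <- enum 'I_n.+1].
have ss : size s = n.+1 by rewrite size_map size_enum_ord.
have js : (j < size s)%N by rewrite ss.
have sn (k : 'I_n.+1) : nth (t j) s k = t k.
  by rewrite (nth_map ord0) ?size_enum_ord // nth_ord_enum.
have -> : [seq t (lift j k) | k <- enum 'I_n] = take j s ++ drop j.+1 s.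
  apply: (@eq_from_nth _ (t j)).
    rewrite size_cat size_take size_drop js [LHS]size_map size_enum_ord ss.
    by rewrite subSS subnKC // -ltnS.
  move=> k; rewrite size_map size_enum_ord => kn.
  rewrite (nth_map (Ordinal kn)) ?size_enum_ord //.
  rewrite -sn nth_cat size_take js /= nth_enum_ord // /bump.
  case: ltnP => kj; first by rewrite nth_take // add0n.
  by rewrite nth_drop addSn subnKC.
rewrite -[in RHS](cat_take_drop j s) (drop_nth (t j) js) sn.
rewrite (alternating_to_front _ _ _ ah) size_take js.
by rewrite signr_addb mulrACA signr_odd -expr2 sqrr_sign mul1r.
Qed.

End Alternating.

(** Sorting permutes the entries, and a permutation changes the value of an
alternating function by its sign. *)
Lemma alternating_sort (T : eqType) (h : seq T -> rat) (r : rel T) s :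
  alternating h -> h s = sort_sign r s * h (sort r s).
Proof.
move=> ah; rewrite /sort_sign; case: pickP => [p /eqP <-|np].
  by rewrite (alternating_ord _ _ ah) mulrA -expr2 sqrr_sign mul1r map_tnth_enum.
have : perm_eq (sort r s) (in_tuple s) by rewrite perm_sort.
by case/tuple_permP=> p Ep; have := np p; rewrite {}Ep eqxx.
Qed.

(** * Exterior multiplication by a covector *)

(** Left exterior multiplication by the covector [w], on functions of
sequences.  The recursion is the Leibniz rule for evaluation at the first
entry. *)
Fixpoint wedge (R : nzRingType) (T : Type) (w : T -> R) (h : seq T -> R) (s : seq T) : R :=
  if s is t :: s' then w t * h s' - wedge w (fun u => h (t :: u)) s' else 0.

Section Wedge.
Variables (R : numDomainType) (T : eqType).
Implicit Types (w v : T -> R) (h : seq T -> R) (s : seq T) (t : T) (D : pred T).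

Lemma eq_wedge_in D w h h' s : all D s ->
    (forall u, all D u -> (size u).+1 = size s -> h u = h' u) ->
  wedge w h s = wedge w h' s.
Proof.
elim: s h h' => [|t s IH] h h' //= /andP[Dt Ds] hh'.
congr (_ * _ - _); first exact: hh'.
by apply: IH => // u Du su; apply: hh'; rewrite /= ?Dt ?su.
Qed.

Lemma eq_wedge w h h' s : h =1 h' -> wedge w h s = wedge w h' s.
Proof. by move=> hh'; apply: (@eq_wedge_in predT) => //; apply/allP. Qed.

Lemma wedge0 w s : wedge w (fun=> 0) s = 0.
Proof. by elim: s => //= t s ->; rewrite mulr0 subrr. Qed.

Lemma wedge_eq0 D w h s : all D s ->
    (forall u, all D u -> (size u).+1 = size s -> h u = 0) -> wedge w h s = 0.
Proof. by move=> Ds h0; rewrite -(wedge0 w s); apply: eq_wedge_in h0. Qed.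

Lemma wedgeD w h h' s : wedge w (fun u => h u + h' u) s = wedge w h s + wedge w h' s.
Proof.
elim: s h h' => [|t s IH] h h' /=; first by rewrite addr0.
by rewrite (IH (fun u => h (t :: u))) mulrDr opprD addrACA.
Qed.

Lemma wedgeZ w c h s : wedge w (fun u => c * h u) s = c * wedge w h s.
Proof.
elim: s h => [|t s IH] h /=; first by rewrite mulr0.
by rewrite (IH (fun u => h (t :: u))) mulrBr mulrCA.
Qed.

Lemma wedgeB w h h' s : wedge w (fun u => h u - h' u) s = wedge w h s - wedge w h' s.
Proof.
rewrite -mulN1r -wedgeZ -wedgeD; apply: eq_wedge => u.
by rewrite mulN1r.
Qed.

Lemma wedge_suml (I : finType) (P : pred I) (W : I -> T -> R) h s :
  wedge (fun t => \sum_(i | P i) W i t) h s = \sum_(i | P i) wedge (W i) h s.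
Proof.
elim: s h => [|t s IH] h /=; first by rewrite big1.
by rewrite (IH (fun u => h (t :: u))) mulr_suml -sumrB.
Qed.

Lemma eq_wedgel w v h s : {in s, w =1 v} -> wedge w h s = wedge v h s.
Proof.
elim: s h => [|t s IH] h //= wv; rewrite wv ?mem_head // IH // => x xs.
by rewrite wv // inE xs orbT.
Qed.

Lemma wedge0l h s : wedge (fun=> 0) h s = 0.
Proof. by elim: s h => //= t s IH h; rewrite IH mul0r subr0. Qed.

Lemma wedge_anticomm w v h s : wedge w (wedge v h) s = - wedge v (wedge w h) s.
Proof.
elim: s h => [|t s IH] h /=; first by rewrite oppr0.
by rewrite !wedgeB !wedgeZ (IH (fun u => h (t :: u))); ring.
Qed.

(** Anticommutation with itself makes the square its own opposite. *)
Lemma wedge_square w h s : wedge w (wedge w h) s = 0.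
Proof.
by apply/eqP; rewrite -[_ == 0](mulrn_eq0 _ 2) mulr2n {1}wedge_anticomm addNr.
Qed.

Lemma alternating_wedge w h : alternating h -> alternating (wedge w h).
Proof.
move=> ah s1 u v s2; elim: s1 h ah => [|t s1 IH] h ah /=; last first.
  by rewrite ah (IH (fun u => h (t :: u)) (alternating_cons t ah)) mulrN opprB opprK addrC.
rewrite (@eq_wedge w _ (fun u' => - h (v :: u :: u'))); last first.
  by move=> u'; rewrite (ah [::]).
rewrite (@eq_wedge w _ (fun u' => -1 * h (v :: u :: u'))); last first.
  by move=> u'; rewrite mulN1r.
by rewrite wedgeZ mulN1r; ring.
Qed.

Lemma wedge_cat w h s u :
  wedge w h (s ++ u) = wedge w (fun s' => h (s' ++ u)) s
                       + (-1) ^+ size s * wedge w (fun u' => h (s ++ u')) u.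
Proof.
elim: s h => [|t s IH] h; first by rewrite add0r mul1r.
by rewrite cat_cons /= (IH (fun u => h (t :: u))) exprS; ring.
Qed.

End Wedge.

Lemma wedge_map (R : numDomainType) (T U : eqType) (f : T -> U) (w : U -> R) h s :
  wedge w h (map f s) = wedge (fun t => w (f t)) (fun u => h (map f u)) s.
Proof. by elim: s h => //= t s IH h; rewrite IH. Qed.

(** The transpose of the simplicial boundary: the alternating sum of the values
of a function at a sequence with one entry removed. *)
Definition coboundary (R : nzRingType) (T : Type) : (seq T -> R) -> seq T -> R :=
  wedge (fun=> 1).
(** Exterior multiplication by the element of the dual basis that belongs to
[a]. *)
Definition dual_wedge (R : nzRingType) (T : eqType) (a : T) : (seq T -> R) -> seq T -> R :=
  wedge (fun t => (t == a)%:R).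

Section Coboundary.
Variables (R : numDomainType) (T : eqType).
Implicit Types (h : seq T -> R) (s : seq T) (t a b : T).

(** Fixing the first entry is a contracting homotopy for the coboundary. *)
Lemma coboundary_homotopy h b s :
  coboundary (fun u => h (b :: u)) s = h s - coboundary h (b :: s).
Proof. by rewrite /coboundary /= mul1r opprB addrC subrK. Qed.

Lemma dual_wedge_notin a h s : a \notin s -> dual_wedge a h s = 0.
Proof.
move=> nas; rewrite /dual_wedge (@eq_wedgel _ _ _ (fun=> 0)) ?wedge0l // => t ts.
by case: eqP => // ta; rewrite -ta ts in nas.
Qed.

Lemma dual_wedge_cons a h s : (forall u, h (a :: u) = 0) ->
  dual_wedge a h (a :: s) = h s.
Proof.
move=> h0; rewrite /dual_wedge /= eqxx mul1r (@eq_wedge _ _ _ _ (fun=> 0)) //.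
by rewrite wedge0 subr0.
Qed.

Lemma dual_wedge_uniq a h s : a \notin s -> dual_wedge a h (a :: s) = h s.
Proof.
move=> nas; rewrite /dual_wedge /= eqxx mul1r.
have := dual_wedge_notin (fun u => h (a :: u)) nas.
by rewrite /dual_wedge => ->; rewrite subr0.
Qed.

Lemma coboundary_dual_wedge a h s :
  coboundary (dual_wedge a h) s = - dual_wedge a (coboundary h) s.
Proof. exact: wedge_anticomm. Qed.

(** A repeated entry gives the value zero, and a single entry [a] can be moved to
the front. *)
Lemma alternating_eq0_pivot a (D : pred T) h s : alternating h ->
    (forall u, all D u -> a \notin u -> h u = 0) ->
    (forall u, all D u -> a \notin u -> h (a :: u) = 0) ->
  all D s -> h s = 0.
Proof.
move=> ah h0 ha Ds; have [us|us] := boolP (uniq s); last exact: alternating_eq0.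
have [sa|na] := boolP (a \in s); last exact: h0.
move: Ds us; case/splitPr: sa => s1 s2; rewrite alternating_to_front //.
rewrite all_cat cat_uniq /= => /and3P[D1 _ D2].
rewrite negb_or => /and4P[_ /andP[na1 _] na2 _].
by rewrite ha ?mulr0 ?all_cat ?D1 ?mem_cat ?(negPf na1).
Qed.
End Coboundary.

Lemma coboundary_sum (R : numDomainType) (T : finType) (h : seq T -> R) s :
  coboundary h s = \sum_b dual_wedge b h s.
Proof.
rewrite /coboundary /dual_wedge -wedge_suml; apply: eq_wedgel => t _.
by rewrite (bigD1 t) //= eqxx big1 ?addr0 // => b; rewrite eq_sym => /negPf ->.
Qed.

(** * The sign of a sequence relative to a linear order *)

Section SortSign.
Variables (R : numDomainType) (T : finType) (D : {set T}) (r : rel T).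
Hypothesis rlin : linear_order_on D r.
Implicit Types (s : seq T).

Fixpoint inversion_sign s : R :=
  if s is t :: s' then (-1) ^+ count (fun v => ~~ r t v) s' * inversion_sign s' else 1.

(** The parity of the number of inversions as a sign, extended by zero to an
alternating function. *)
Definition order_form s : R :=
  if uniq s && all (mem D) s then inversion_sign s else 0.

Lemma order_form_alternating : alternating order_form.
Proof.
move=> s1 u v s2; rewrite /order_form.
have pe : perm_eq (s1 ++ u :: v :: s2) (s1 ++ v :: u :: s2).
  by rewrite perm_cat2l -[u :: _]/([:: u] ++ [:: v] ++ s2) perm_catCA.
rewrite -(perm_uniq pe) -(perm_all _ pe); case: ifP => [|_]; last by rewrite oppr0.
case/andP; rewrite cat_uniq all_cat /= => /and3P[_ _ /andP[]].
rewrite inE negb_or => /andP[uv _] _ /and4P[_ uD vD _] {pe}.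
elim: s1 => [|t s1 IH] /=; last first.
  by rewrite IH mulrN !count_cat /= (addnCA (~~ r t u)).
have [antir _ totr] := rlin.
have : r u v (+) r v u.
  case: (boolP (r u v)) (totr u v uD vD) => ruv /= => [_|->] //.
  by apply/negP => rvu; case/eqP: uv; apply: antir => //; rewrite ruv rvu.
by rewrite !exprD; case: (r u v); case: (r v u) => //= _; ring.
Qed.

Lemma order_form_sort s : uniq s -> all (mem D) s -> order_form (sort r s) = 1.
Proof.
move=> us Ds; rewrite /order_form sort_uniq us all_sort Ds /=.
have [antir tranr totr] := rlin.
have : sorted r (sort r s) by apply: (sort_sorted_in (P := mem D)).
move: Ds; rewrite -(all_sort _ r); elim: (sort r s) => //= t {us}s IH /andP[tD sD] ts.
rewrite IH ?(path_sorted ts) // mulr1.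
have /allP rt : all (r t) s.
  by apply: (order_path_min_in (P := mem D) tranr) ts; apply/andP.
by rewrite (_ : count _ _ = 0) //; apply/eqP; rewrite -leqn0 leqNgt -has_count;
   apply/hasPn => v /rt ->.
Qed.
End SortSign.

(** The sign of a sorting permutation, computed by comparison with one
alternating function that is known on increasing sequences. *)
Lemma alternating_order_form (T : finType) (D : {set T}) (r : rel T) (h : seq T -> rat) s :
  linear_order_on D r -> alternating h -> uniq s -> all (mem D) s ->
  h s = order_form rat D r s * h (sort r s).
Proof.
move=> rlin ah us Ds; rewrite (alternating_sort r s ah); congr (_ * _).
rewrite (alternating_sort r s (order_form_alternating rat rlin)).
by rewrite order_form_sort // mulr1.
Qed.

(** * Linear functionals on quotients of free algebras *)

Section Functionals.

Lemma scalar0 (V : lmodType rat) (phi : V -> rat) : scalar phi -> phi 0 = 0.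
Proof. by move=> lphi; have := lphi (-1) 0 0; rewrite scaler0 addr0 mulN1r addNr. Qed.

Lemma scalar_sum (V : lmodType rat) (phi : V -> rat) (I : Type) (s : seq I) (P : pred I)
    (c : I -> rat) (F : I -> V) : scalar phi ->
  phi (\sum_(i <- s | P i) c i *: F i) = \sum_(i <- s | P i) c i * phi (F i).
Proof.
move=> lphi; have phi0 := scalar0 lphi.
apply: (big_rec2 (fun u v => phi u = v)) => // i u v _ <-; exact: lphi.
Qed.

(** Since [L] kills the two-sided ideal of the relators, it does not depend on
the representative. *)
Lemma quot_functional (R : algType rat) (G : relators R) (L : R -> rat) : scalar L ->
    (forall u g v, G g -> L (u * g * v) = 0) ->
  exists L' : quot_alg G -> rat, scalar L' /\ forall u, L' (quot_map G u) = L u.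
Proof.
move=> linL L0; have LD u v : L (u + v) = L u + L v by have := linL 1 u v; rewrite scale1r mul1r.
have L00 := scalar0 linL.
have Lideal u : ideal_of G u -> L u = 0.
  by elim=> // v g w z Gg _ IH; rewrite LD L0 // IH addr0.
have Lquot u : L (quot_repr (quot_map G u)) = L u.
  by rewrite -[quot_repr _](subrK u) LD Lideal ?add0r //; apply: quot_mapK.
exists (fun y => L (quot_repr y)); split=> // c y z.
rewrite -(quot_reprK y) -(quot_reprK z) -linearZ -linearD !Lquot.
exact: linL.
Qed.

Variable X : finType.
Implicit Types (u v : free_alg X) (w : {fmonom X}).

(** The words are the monomial basis of the free algebra. *)
Definition word w : free_alg X := << w >>.

Lemma word_sum u : u = \sum_(w <- finmap.enum_fset (msupp u)) u@_w *: word w.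
Proof.
rewrite {1}[u]monalgE; apply: eq_bigr => w _.
apply/malgP => k; rewrite mcoeffU.
rewrite (mcoeffZ (u@_w) (<< w >> : {malg rat[{fmonom X}]}) k) mcoeffU.
by rewrite mulr_natr.
Qed.

Lemma word_mul w w' : word (mmul w w') = word w * word w'.
Proof. by rewrite /word malgM_def fgmulUU mulr1. Qed.

Lemma word_functional (F : {fmonom X} -> rat) :
  exists L : free_alg X -> rat, scalar L /\ forall w, L (word w) = F w.
Proof.
exists (mmap idfun F); split=> [c u v|w]; last by rewrite /word mmapU mul1r.
rewrite mmapD; congr (_ + _).
rewrite (mmapEw (msuppZ_le c (u : {malg rat[{fmonom X}]}))) mmapE mulr_sumr.
by apply: eq_bigr => w _; rewrite mulrA; congr (_ * _); apply: (@mcoeffZ {fmonom X}).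
Qed.

Lemma scalar_word_eq0 (phi : free_alg X -> rat) : scalar phi ->
  (forall w, phi (word w) = 0) -> forall u, phi u = 0.
Proof.
by move=> lphi phi0 u; rewrite [u]word_sum (scalar_sum _ _ _ _ lphi) big1 // => w _;
  rewrite phi0 mulr0.
Qed.

Lemma word_two_sided (L : free_alg X -> rat) g : scalar L ->
    (forall w w', L (word w * g * word w') = 0) ->
  forall u v, L (u * g * v) = 0.
Proof.
move=> linL Lw u v.
apply: (scalar_word_eq0 (phi := fun v => L (u * g * v))) => [c v1 v2|w'].
  by rewrite mulrDr -scalerAr linL.
apply: (scalar_word_eq0 (phi := fun u => L (u * g * word w'))) => [c u1 u2|w] //.
by rewrite !mulrDl -!scalerAl linL.
Qed.
End Functionals.

Lemma sort_sign_sqr (T : eqType) (r : rel T) s : sort_sign r s * sort_sign r s = 1.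
Proof.
by rewrite /sort_sign; case: pickP => [p _|_]; rewrite ?mulr1 // -expr2 sqrr_sign.
Qed.

(** * Forms *)

Section Forms.
Variables (d : Order.disp_t) (Q : finPOrderType d).
Implicit Types (x : Q) (E T : {set Q}) (f : seq Q -> rat) (s : seq Q).

(** The forms at [x] are the linear functionals on the top degree of the
Orlik-Solomon algebra of the geometric lattice below [x], or, with [E] a set of
atoms, of the lattice of flats of the restriction to [E]. *)
Record top_form E x f : Prop := TopForm {
  form_alternating : alternating f;
  form_support : forall s, f s != 0 -> [set t in s] \subset E /\ basis x [set t in s];
  form_cocycle : forall s, [set t in s] \subset E :&: atoms_below x -> coboundary f s = 0
}.

Lemma set_cat s1 s2 : [set t in s1 ++ s2] = [set t in s1] :|: [set t in s2].
Proof. by apply/setP => t; rewrite !inE mem_cat. Qed.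

Lemma set_cons t s : [set u in t :: s] = t |: [set u in s].
Proof. by apply/setP => u; rewrite !inE. Qed.

Lemma form_uniq E x f s : top_form E x f -> f s != 0 -> uniq s.
Proof. by move=> ff; apply: contraNT => /alternating_eq0 ->; rewrite ?eqxx //; case: ff. Qed.

Lemma all_set (D : {set Q}) s : all (mem D) s = ([set t in s] \subset D).
Proof.
by apply/allP/subsetP => h t; [rewrite inE|]; move=> ts; apply: h; rewrite ?inE.
Qed.

End Forms.

Section SortedFaces.
Variables (d : Order.disp_t) (Q : finPOrderType d) (r : rel Q).
Hypothesis lmQ : locally_matroidal Q.
Hypothesis rlin : linear_order_on (atoms Q) r.
Local Notation M := (prescheme_of Q).
Local Notation top := face_top.
Local Notation at_ := face_atoms.
Implicit Types (x : Q) (T D : {set Q}) (f : seq Q -> rat) (s : seq Q).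
Implicit Types (al be ga om ze b : M) (A B : {set M}).

Definition increasing T : seq Q := sort r (enum T).

Lemma mem_increasing T t : (t \in increasing T) = (t \in T).
Proof. by rewrite mem_sort mem_enum. Qed.

Lemma set_increasing T : [set t in increasing T] = T.
Proof. by apply/setP => t; rewrite inE mem_increasing. Qed.

Lemma increasing_uniq T : uniq (increasing T).
Proof. by rewrite sort_uniq enum_uniq. Qed.

Lemma size_increasing T : size (increasing T) = #|T|.
Proof. by rewrite size_sort cardE. Qed.

Lemma sort_increasing s : uniq s -> [set t in s] \subset atoms Q ->
  sort r s = increasing [set t in s].
Proof.
move=> us sA; have [antir tranr totr] := rlin.
have sAP : {subset s <= atoms Q} by move=> t ts; apply: (subsetP sA); rewrite inE.
have : perm_eq s (enum [set t in s]).
  by apply: uniq_perm; rewrite ?enum_uniq // => t; rewrite mem_enum inE.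
apply/perm_sort_inP.
- by move=> u v us' vs'; apply: totr; apply: sAP.
- by move=> u v w us' vs' ws'; apply: tranr; apply: sAP.
- by move=> u v us' vs'; apply: antir; apply: sAP.
Qed.

Lemma sort_increasing_set T s : uniq s -> [set t in s] = T -> T \subset atoms Q ->
  sort r s = increasing T.
Proof. by move=> us <- ?; apply: sort_increasing. Qed.

Lemma order_form_increasing T : T \subset atoms Q ->
  order_form rat (atoms Q) r (increasing T) = 1.
Proof.
by move=> TA; apply: order_form_sort; rewrite ?enum_uniq // all_set set_enum.
Qed.

Lemma alternating_increasing f s : alternating f -> uniq s -> [set t in s] \subset atoms Q ->
  f s = order_form rat (atoms Q) r s * f (increasing [set t in s]).
Proof.
move=> af us sA; rewrite (alternating_order_form rlin af us) ?all_set //.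
by rewrite sort_increasing.
Qed.

Lemma face_atomsA al : at_ al \subset atoms Q.
Proof. by case/sub_atoms_below: (face_atoms_below lmQ al). Qed.

Lemma sort_face_atoms al A : A \subset atoms_below al ->
  [seq top b | b <- sort (face_order r) (enum A)] = increasing [set top b | b in A].
Proof.
move=> Aal; have inj : {in A &, injective face_top}.
  by move=> b c /(subsetP Aal) bA /(subsetP Aal) cA; apply: (face_top_inj lmQ bA cA).
rewrite -sort_map; apply: sort_increasing_set.
- rewrite map_inj_in_uniq ?enum_uniq // => b c.
  by rewrite !mem_enum; apply: inj.
- apply/setP => t; rewrite inE; apply/mapP/imsetP => -[b bA ->]; exists b => //.
    by rewrite mem_enum in bA.
  by rewrite mem_enum.
- apply: subset_trans (face_atomsA al); rewrite -(atoms_below_top lmQ).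
  exact: imsetS.
Qed.

(** The sign [sgn] refers to the atoms of the prescheme.  Through the tops of
these atoms it compares the values of an alternating function at two lists of
atoms of the poset. *)
Lemma sgn_faces al A B f : alternating f -> A \subset atoms_below al ->
    B \subset atoms_below al -> [disjoint A & B] ->
  f (increasing [set top b | b in A] ++ increasing [set top b | b in B]) =
  sgn (face_order r) A B * f (increasing [set top b | b in A :|: B]).
Proof.
move=> af Aal Bal AB; have ABal : A :|: B \subset atoms_below al by rewrite subUset Aal.
rewrite -(sort_face_atoms Aal) -(sort_face_atoms Bal) -map_cat.
have af' : alternating (fun s : seq M => f (map top s)).
  by move=> s1 u v s2; rewrite !map_cat; apply: af.
rewrite (alternating_sort (face_order r) _ af') -/(sgn _ _ _); congr (_ * f _).
rewrite -sort_map.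
have inj : {in A :|: B &, injective face_top}.
  by move=> b c /(subsetP ABal) bA /(subsetP ABal) cA; apply: (face_top_inj lmQ bA cA).
apply: sort_increasing_set.
- rewrite map_inj_in_uniq; last first.
    by move=> b c; rewrite !mem_cat !mem_sort !mem_enum -!in_setU; apply: inj.
  rewrite cat_uniq !sort_uniq !enum_uniq /= andbT -all_predC; apply/allP => b /=.
  by rewrite !mem_sort !mem_enum => bB; rewrite (disjointFl AB bB).
- apply/setP => t; rewrite inE; apply/mapP/imsetP => -[b bA ->]; exists b => //;
  by move: bA; rewrite mem_cat !mem_sort !mem_enum -in_setU.
- apply: subset_trans (face_atomsA al); rewrite -(atoms_below_top lmQ).
  exact: imsetS.
Qed.

Lemma sgn_disjoint_faces al be ga f : alternating f -> (al <= ga)%O -> (be <= ga)%O ->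
    [disjoint at_ al & at_ be] ->
  f (increasing (at_ al) ++ increasing (at_ be)) =
  sgn (face_order r) (atoms_below al) (atoms_below be) * f (increasing (at_ al :|: at_ be)).
Proof.
move=> af ag bg dis.
have dAB : [disjoint atoms_below al & atoms_below be].
  apply/pred0P => b; apply/negP => /andP[/= ba bb].
  have [[ta _] [tb _]] := (atom_face_top lmQ ba, atom_face_top lmQ bb).
  by have := pred0P dis (top b); rewrite /= ta tb.
rewrite -[at_ al](atoms_below_top lmQ al) -[at_ be](atoms_below_top lmQ be) -imsetU.
exact: (sgn_faces af (atoms_below_le ag) (atoms_below_le bg) dAB).
Qed.

Lemma sgn_sqr A B : sgn (face_order r) A B * sgn (face_order r) A B = 1.
Proof. exact: sort_sign_sqr. Qed.

Lemma face_top_setD1 om b : b \in atoms_below om ->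
  [set top c | c in atoms_below om :\ b] = at_ om :\ top b.
Proof.
move=> bo; apply/setP => t; rewrite in_setD1; apply/imsetP/andP => [[c]|[tb to]].
  rewrite in_setD1 => /andP[cb co] ->; have [-> _] := atom_face_top lmQ co; split=> //.
  by apply: contraNneq cb => /(face_top_inj lmQ co bo) ->.
have [c co [tc _]] := atom_face_exists lmQ to; exists c => //.
by rewrite in_setD1 co andbT; apply: contraNneq tb => <-; rewrite tc.
Qed.

(** The signs of the circuit relations are those of the coboundary: moving the
atom [b] of a sorted face to the front has the sign of the removal of [b]. *)
Lemma coboundary_face om f : alternating f ->
  coboundary f (increasing (at_ om)) =
  \sum_(b in atoms_below om) sgn (face_order r) [set b] (atoms_below om :\ b)
                              * f (increasing (at_ om :\ top b)).
Proof.
move=> af; rewrite coboundary_sum (bigID (mem (at_ om))) /= addrC big1 ?add0r; last first.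
  by move=> t to; apply: dual_wedge_notin; rewrite mem_increasing.
rewrite -{1}(atoms_below_top lmQ) big_imset /=; last exact: (face_top_inj lmQ).
apply: eq_bigr => b bo; set sg := sgn _ _ _.
have aD := alternating_wedge (fun t => (t == top b)%:R) af.
have subb : [set b] \subset atoms_below om by rewrite sub1set.
have dis : [disjoint [set b] & atoms_below om :\ b] by rewrite disjoints1 !inE eqxx.
have := sgn_faces aD subb (subsetDl _ _) dis; rewrite -/sg setD1K //.
rewrite (atoms_below_top lmQ) face_top_setD1 // imset_set1 {1}/increasing enum_set1.
rewrite (_ : sort r [:: _] = [:: top b]) //= -/(dual_wedge _) => E.
have /dual_wedge_uniq DE : top b \notin increasing (at_ om :\ top b).
  by rewrite mem_increasing !inE eqxx.
rewrite -[RHS]/(sg * _) -DE {}/dual_wedge /= E mulrA /sg sgn_sqr mul1r.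
by [].
Qed.

End SortedFaces.

(** * Forms are functionals on the Orlik-Solomon algebra *)

Lemma sum_in_subset (V : zmodType) (I : finType) (A B : {set I}) (F : I -> V) : B \subset A ->
  (forall i, i \in A -> i \notin B -> F i = 0) -> \sum_(i in B) F i = \sum_(i in A) F i.
Proof.
move=> BA F0; rewrite [RHS](bigID (mem B)) /= [X in _ + X]big1 ?addr0.
  by apply: eq_bigl => i; case: (boolP (i \in B)) => [/(subsetP BA) ->|]; rewrite ?andbF.
by move=> i /andP[]; apply: F0.
Qed.

Section FormFunctional.
Variables (d : Order.disp_t) (Q : finPOrderType d) (r : rel Q).
Hypothesis lmQ : locally_matroidal Q.
Hypothesis rlin : linear_order_on (atoms Q) r.
Local Notation M := (prescheme_of Q).
Local Notation top := face_top.
Local Notation at_ := face_atoms.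
Local Notation fo := (face_order r).
Local Notation gen := (gens M).
Implicit Types (al be ga om ze b : M) (s : seq Q).

(** The bottom face has no generator; letting it stand for 1, the independent
faces span the algebra. *)
Definition OS_face al : OS_poset r :=
  if al \in bottoms M then 1 else OS_gen fo al.

Lemma dependent_card al : al \notin indep M -> (1 < #|at_ al|)%N.
Proof.
rewrite ltnNge face_indepE; apply: contra => a1.
have aal := face_atoms_below lmQ al; rewrite /basis in_SP_face eqn_leq /=.
rewrite in_SP_rank_le //=; last exact: in_SP_face.
have [->|/set0Pn[t ta]] := eqVneq (at_ al) set0; first by rewrite cards0.
move: (subsetP aal t ta); rewrite atoms_belowE => /andP[/eqP t1 /(rank_le lmQ)].
by rewrite t1; apply: leq_trans.
Qed.

(** The facet opposite to an atom of the circuit is independent, hence its rank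
is one less than the number of atoms of [om]; that is at least the rank of the
top of [om]. *)
Lemma facet_top om ze b : unicircular ze om -> b \in atoms_below ze ->
  top (face_below om (atoms_below om :\ b)) = top om.
Proof.
move=> uni bz; have [_ zo _] := unicircularP uni.
have bo : b \in atoms_below om by apply: (subsetP (atoms_below_le zo)).
have [fo_ afo _] := face_belowE lmQ (subsetDl (atoms_below om) [set b]).
apply: (eq_of_rank lmQ); first by move: fo_; rewrite face_le => /andP[].
have := unicircular_indep lmQ uni bo; rewrite bz face_indepE => /basis_card ->.
rewrite afo face_top_setD1 //.
have := unicircular_dependent lmQ uni; rewrite face_indepE /basis in_SP_face /= => nr.
have := in_SP_rank_le lmQ (in_SP_face om); rewrite leq_eqVlt (negPf nr) /=.
by rewrite (cardsD1 (top b) (at_ om)); have [-> _] := atom_face_top lmQ bo.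
Qed.

Lemma bottom_indep al : al \in bottoms M -> al \in indep M.
Proof.
move=> ab; apply: contraTT ab => /dependent_card a1; apply/negP => /(face_bottomsP lmQ) a0.
by rewrite a0 cards0 in a1.
Qed.

Lemma facet_nonbottom om b : om \notin indep M -> b \in atoms_below om ->
  face_below om (atoms_below om :\ b) \notin bottoms M.
Proof.
move=> /dependent_card co bo; apply/negP => /(face_bottomsP lmQ).
have [_ -> _] := face_belowE lmQ (subsetDl (atoms_below om) [set b]).
rewrite face_top_setD1 // => E; move: co.
by rewrite (cardsD1 (top b)) E cards0; case: (_ \in _).
Qed.

Definition gen_lift al : free_alg gen :=
  if insub al is Some g then free_gen (g : gen) else 0.

Definition free_to_E (u : free_alg gen) : OS_E M := quot_map (gcomm_relators _) u.

Lemma free_to_EM : {morph free_to_E : u v / u * v}.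
Proof. by move=> u v; rewrite /free_to_E rmorphM. Qed.

Lemma free_to_E1 : free_to_E 1 = 1.
Proof. by rewrite /free_to_E rmorph1. Qed.

Lemma free_to_EB : {morph free_to_E : u v / u - v}.
Proof. by move=> u v; rewrite /free_to_E rmorphB. Qed.

Lemma free_to_EZ c : {morph free_to_E : u / c *: u}.
Proof. by move=> u; rewrite /free_to_E linearZ. Qed.

Lemma free_to_E_sum (I : Type) (t : seq I) (P : pred I) (F : I -> free_alg gen) :
  free_to_E (\sum_(i <- t | P i) F i) = \sum_(i <- t | P i) free_to_E (F i).
Proof. exact: raddf_sum. Qed.

Lemma free_to_E_surj (u : OS_E M) : exists u', u = free_to_E u'.
Proof. by exists (quot_repr u); rewrite /free_to_E quot_reprK. Qed.

Lemma OS_e_lift al : OS_e al = free_to_E (gen_lift al).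
Proof. by rewrite /OS_e /gen_lift /free_to_E; case: insubP => // _; rewrite raddf0. Qed.

Section Functional.
Variables (x : Q) (f : seq Q -> rat) (ff : top_form [set: Q] x f).

Lemma form_face be s : (top be <= x)%O -> at_ be \subset [set t in s] ->
  f s != 0 -> be \in indep M.
Proof.
move=> bx bs /(form_support ff)[_ bas].
have := basis_sub lmQ bas bs; rewrite face_indepE.
by rewrite (join_below_mono lmQ bx) ?face_join // face_atoms_below.
Qed.

Definition word_seq (w : seq gen) : seq Q :=
  flatten [seq increasing r (at_ (val g)) | g <- w].
Definition word_below (w : seq gen) : bool := all (fun g : gen => (top (val g) <= x)%O) w.

Lemma word_seq_below w : word_below w -> [set t in word_seq w] \subset atoms_below x.
Proof.
elim: w => [|g w IH] /=; first by move=> _; apply/subsetP => t; rewrite inE.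
case/andP=> gx /IH wx; rewrite /word_seq /= set_cat subUset wx andbT set_increasing.
exact: subset_trans (face_atoms_below lmQ _) (atoms_below_le gx).
Qed.

(** The form as seen from the middle of a word: a relator vanishes in the quotient
between any two words. *)
Definition context_form (w w' : seq gen) s : rat :=
  if word_below w && word_below w' then f (word_seq w ++ s ++ word_seq w') else 0.

Lemma context_form_alternating w w' : alternating (context_form w w').
Proof.
move=> s1 u v s2; rewrite /context_form; case: ifP => _; last by rewrite oppr0.
have af := form_alternating ff.
exact: (alternating_suffix (word_seq w') (alternating_prefix (word_seq w) af)) s1 u v s2.
Qed.

Variable L : free_alg gen -> rat.
Hypothesis linL : scalar L.
Hypothesis Lword : forall w : {fmonom gen},
  L (word w) = if word_below w then f (word_seq w) else 0.

Let L0 : L 0 = 0.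
Proof. exact: scalar0 linL. Qed.

Let LB u v : L (u - v) = L u - L v.
Proof. by have := linL (-1) v u; rewrite scaleN1r mulN1r ![- _ + _]addrC. Qed.

Let LZ c u : L (c *: u) = c * L u.
Proof. by have := linL c u 0; rewrite !addr0 L0 addr0. Qed.

Let Lsum (I : finType) (P : pred I) (F : I -> free_alg gen) :
  L (\sum_(i | P i) F i) = \sum_(i | P i) L (F i).
Proof.
apply: (big_rec2 (fun u v => L u = v)) => // i u v _ <-.
by have := linL 1 (F i) u; rewrite scale1r mul1r.
Qed.

Definition gen_below al := (al \in indep M :\: bottoms M) && (top al <= x)%O.

Definition in_context (w w' : {fmonom gen}) (u : free_alg gen) : rat :=
  L (word w * u * word w').

Lemma in_contextB w w' u v : in_context w w' (u - v) = in_context w w' u - in_context w w' v.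
Proof. by rewrite /in_context mulrBr mulrBl LB. Qed.

Lemma in_contextZ w w' c u : in_context w w' (c *: u) = c * in_context w w' u.
Proof. by rewrite /in_context -scalerAr -scalerAl LZ. Qed.

Lemma in_context_sum w w' (I : finType) (P : pred I) (F : I -> free_alg gen) :
  in_context w w' (\sum_(i | P i) F i) = \sum_(i | P i) in_context w w' (F i).
Proof. by rewrite /in_context mulr_sumr mulr_suml Lsum. Qed.

Lemma functional_gen w w' al : in_context w w' (gen_lift al) =
  if gen_below al then context_form w w' (increasing r (at_ al)) else 0.
Proof.
rewrite /in_context /gen_lift /gen_below; case: insubP => [g gI gE|/negPf ->];
  last by rewrite mulr0 mul0r.
rewrite -[free_gen g]/(word (fmu g)) -!word_mul Lword !fmM fmU -gE (valP g) /= /context_form.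
rewrite /word_below !all_cat /= andbT /word_seq !map_cat !flatten_cat /= cats0 -catA.
by case: (all _ w); case: (all _ w') => //=; rewrite ?andbT ?andbF; case: (_ <= _)%O.
Qed.

Lemma functional_gen_mul w w' al be : in_context w w' (gen_lift al * gen_lift be) =
  if gen_below al && gen_below be
  then context_form w w' (increasing r (at_ al) ++ increasing r (at_ be)) else 0.
Proof.
rewrite /in_context /gen_lift /gen_below; case: insubP => [g gI gE|/negPf ->];
  last by rewrite mul0r mulr0 mul0r.
case: insubP => [h hI hE|/negPf ->]; last by rewrite !mulr0 mul0r andbF.
rewrite -[free_gen g]/(word (fmu g)) -[free_gen h]/(word (fmu h)) -!word_mul Lword !fmM !fmU.
rewrite -gE -hE (valP g) (valP h) /= /context_form.
rewrite /word_below !all_cat /= andbT /word_seq !map_cat !flatten_cat /= cats0 -!catA.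
by case: (all _ w); case: (all _ w') => //=; rewrite ?andbT ?andbF; do 2!case: (_ <= _)%O.
Qed.

Lemma functional_gcomm w w' (g h : gen) :
  in_context w w' (free_gen g * free_gen h
     - (-1) ^+ (#|atoms_below (val g)| * #|atoms_below (val h)|)
        *: (free_gen h * free_gen g)) = 0.
Proof.
have gE (k : gen) : free_gen k = gen_lift (val k) by rewrite /gen_lift valK.
have af := context_form_alternating w w'.
rewrite !gE in_contextB in_contextZ; apply/eqP; rewrite subr_eq0; apply/eqP.
apply: (etrans (functional_gen_mul w w' (val g) (val h))); apply: esym.
apply: (etrans (congr1 _ (functional_gen_mul w w' (val h) (val g)))); apply: esym.
rewrite [gen_below (val h) && _]andbC; case: ifP => _; last by rewrite mulr0.
have := alternating_swap [::] (increasing r (at_ (val g))) (increasing r (at_ (val h))) [::] af.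
have sE (k : gen) : size (increasing r (at_ (val k))) = #|atoms_below (val k)|.
  by rewrite size_increasing (card_atoms_below lmQ).
rewrite !cats0 !sE => E; exact: E.
Qed.

(** Two faces with tops below [x] have exactly one join with top below [x]; if it
is dependent, the form vanishes on every sequence that contains its atoms. *)
Lemma functional_join w w' al be : al \in indep M :\: bottoms M -> be \in indep M :\: bottoms M ->
    [disjoint at_ al & at_ be] ->
  in_context w w' (gen_lift al * gen_lift be
     - sgn fo (atoms_below al) (atoms_below be)
        *: \sum_(ga in joins [set al; be] :&: indep M) gen_lift ga) = 0.
Proof.
move=> aI bI dis; have [anb bnb] : al \notin bottoms M /\ be \notin bottoms M.
  by case/setDP: aI => _ ->; case/setDP: bI => _ ->.
have joinsU ga : ga \in joins [set al; be] ->
    [/\ (top al <= top ga)%O, (top be <= top ga)%O & at_ ga = at_ al :|: at_ be].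
  by rewrite face_joinsE // => /and3P[? ? /eqP].
have joinsB ga : ga \in joins [set al; be] -> ga \notin bottoms M.
  case/joinsU => _ _ aU; apply: contra anb => /(face_bottomsP lmQ) g0.
  by apply/(face_bottomsP lmQ)/eqP; rewrite -subset0 -g0 aU subsetUl.
rewrite in_contextB in_contextZ in_context_sum functional_gen_mul.
case: (pickP [pred ga | (ga \in joins [set al; be] :&: indep M) && (top ga <= x)%O]).
  move=> ga /andP[]; rewrite inE => /andP[gJ gI] gx.
  have [ag bg gU] := joinsU _ gJ.
  rewrite (bigD1 ga); last by rewrite inE gJ.
  rewrite [X in _ * (_ + X)]big1 ?addr0; last first.
    move=> ga' /andP[]; rewrite inE => /andP[gJ' gI'] neq; rewrite functional_gen /gen_below.
    case: ifP => // /andP[_ gx']; case/eqP: neq; have [_ _ gU'] := joinsU _ gJ'.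
    apply: face_eq; rewrite ?gU ?gU' //.
    rewrite -(face_join lmQ ga) -(face_join lmQ ga') gU gU'.
    rewrite -(join_below_mono lmQ gx) -?(join_below_mono lmQ gx') //.
      by rewrite -gU' face_atoms_below.
    by rewrite -gU face_atoms_below.
  rewrite functional_gen /gen_below aI bI (le_trans ag gx) (le_trans bg gx) /=.
  have -> : ga \in indep M :\: bottoms M by rewrite inE gI joinsB.
  rewrite gx /=.
  have [ag' bg'] : (al <= ga)%O /\ (be <= ga)%O.
    by split; rewrite face_le gU ?ag ?bg ?subsetUl ?subsetUr.
  have E := sgn_disjoint_faces lmQ rlin (context_form_alternating w w') ag' bg' dis.
  by rewrite E gU subrr.
move=> none; rewrite big1 ?mulr0 ?subr0; last first.
  move=> ga gJ; rewrite functional_gen /gen_below; case: ifP => // /andP[_ gx].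
  by have := none ga; rewrite /= gJ gx.
case: ifP => // /andP[/andP[_ ax] /andP[_ bx]]; apply/eqP/negPn/negP.
rewrite /context_form; case: ifP => [ww|_]; last by rewrite eqxx.
set s := _ ++ _ => fs; have Us : at_ al :|: at_ be \subset [set t in s].
  by rewrite /s !set_cat !set_increasing subsetU // subsetU ?orbT // subxx.
have [_ /basis_atoms sx] := form_support ff fs.
have Ux := subset_trans Us (sx lmQ).
have [ga [tg ag]] := faceP (in_SP_join lmQ Ux).
have gx : (top ga <= x)%O by rewrite tg join_below_le.
have gI : ga \in indep M by apply: (form_face gx _ fs); rewrite ag.
have := none ga; rewrite /= gx inE gI face_joinsE // ag eqxx !andbT tg.
by rewrite -{1}(face_join lmQ al) -{1}(face_join lmQ be) -(join_below_mono lmQ ax)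
  -?(join_below_mono lmQ bx) ?face_atoms_below // !join_below_sub ?subsetUl ?subsetUr.
Qed.

Lemma functional_meet w w' al be : ~~ [disjoint at_ al & at_ be] ->
  in_context w w' (gen_lift al * gen_lift be) = 0.
Proof.
case/pred0Pn => t /andP[/= ta tb]; rewrite functional_gen_mul; case: ifP => // _.
apply: alternating_eq0; first exact: context_form_alternating.
rewrite cat_uniq !negb_and negbK; apply/orP; right; apply/orP; left.
by apply/hasP; exists t; rewrite mem_increasing.
Qed.

(** Closedness of the form on the atoms of [om] followed by the entries of the two
words.  Removing an entry of the words leaves the dependent set of all atoms of
[om], where the form vanishes, so only the removals from [om] contribute. *)
Lemma functional_circuit w w' ze om : unicircular ze om ->
  in_context w w' (\sum_(b in atoms_below ze) sgn fo [set b] (atoms_below om :\ b)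
       *: gen_lift (face_below om (atoms_below om :\ b))) = 0.
Proof.
move=> uni; have [_ zo _] := unicircularP uni; have dep := unicircular_dependent lmQ uni.
have zoA := atoms_below_le zo.
set G := context_form w w'.
rewrite in_context_sum; transitivity (
    \sum_(b in atoms_below ze) sgn fo [set b] (atoms_below om :\ b) *
      (if (top om <= x)%O then G (increasing r (at_ om :\ top b)) else 0)).
  apply: eq_bigr => b bz.
  have bo := subsetP zoA b bz.
  rewrite in_contextZ functional_gen /gen_below; congr (_ * _).
  rewrite inE facet_nonbottom // (unicircular_indep lmQ uni bo) bz (facet_top uni bz) /=.
  have [_ -> _] := face_belowE lmQ (subsetDl (atoms_below om) [set b]).
  by rewrite face_top_setD1.
have [ox|_] := boolP (top om <= x)%O; last by rewrite big1 // => b _; rewrite mulr0.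
have [ww|nww] := boolP (word_below w && word_below w'); last first.
  by rewrite big1 // => b _; rewrite /G /context_form (negPf nww) mulr0.
have depf s : at_ om \subset [set t in s] -> f s = 0.
  by move=> os; apply/eqP/negPn/negP => /(form_face ox os); apply/negP.
apply: (etrans (sum_in_subset zoA _)).
  move=> b bo nbz; suff -> : G (increasing r (at_ om :\ top b)) = 0 by rewrite mulr0.
  rewrite /G /context_form ww; apply/eqP/negPn/negP => fs.
  have [fo_ afo _] := face_belowE lmQ (subsetDl (atoms_below om) [set b]).
  move/negP: nbz; apply; rewrite -(unicircular_indep lmQ uni bo).
  apply: (form_face _ _ fs).
    by apply: le_trans ox; move: fo_; rewrite face_le => /andP[].
  rewrite afo face_top_setD1 // !set_cat set_increasing.
  by rewrite subsetU // subsetU ?orbT // subxx.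
rewrite -(coboundary_face lmQ rlin om (context_form_alternating w w')).
have := form_cocycle ff (s := increasing r (at_ om) ++ word_seq w ++ word_seq w').
rewrite setTI !set_cat set_increasing !subUset !word_seq_below; try by case/andP: ww.
rewrite (subset_trans (face_atoms_below lmQ om) (atoms_below_le ox)) => /(_ isT).
rewrite /coboundary wedge_cat [X in _ + _ * X](@eq_wedge _ _ _ _ (fun=> 0)); last first.
  by move=> u; apply: depf; rewrite set_cat set_increasing subsetUl.
rewrite wedge0 mulr0 addr0 => E0.
(* Moving the first word behind the facet costs a sign that is common to all
facets. *)
rewrite (@eq_wedge_in _ _ predT _ _ (fun u => (-1) ^+ (size (word_seq w) * (#|at_ om|).-1)%N
   * f (u ++ word_seq w ++ word_seq w'))); last first.
- move=> u _; rewrite size_increasing => su; rewrite /G /context_form ww.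
  have af := form_alternating ff.
  by rewrite (alternating_swap [::] _ _ _ af) -su.
- exact/allP.
by rewrite wedgeZ E0 mulr0.
Qed.

End Functional.

(** Between any two words each relator is sent to zero by the functional that a
form defines on the free algebra. *)
Lemma OS_functional x f : top_form [set: Q] x f ->
  exists phi : OS_poset r -> rat, scalar phi /\ forall al, al \in indep M ->
      phi (OS_face al) = if top al == x then f (increasing r (at_ al)) else 0.
Proof.
move=> ff.
have [L [linL Lw]] := word_functional (fun w : {fmonom gen} =>
  if word_below x w then f (word_seq w) else 0).
have [L1 [linL1 L1E]] : exists L1 : OS_E M -> rat, scalar L1 /\ forall u, L1 (free_to_E u) = L u.
  apply: (quot_functional linL) => u g v [g1 g2]; apply: (word_two_sided linL) => w w'.
  exact: (functional_gcomm ff linL Lw).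
have [phi [linphi phiE]] : exists phi : OS_poset r -> rat, scalar phi /\
    forall u, phi (quot_map (OS_relators fo) u) = L1 u.
  apply: (quot_functional linL1) => u g v Gg.
  suff [g' [-> Lg']] : exists g', g = free_to_E g' /\ forall w w', in_context L w w' g' = 0.
    have [[u' ->] [v' ->]] := (free_to_E_surj u, free_to_E_surj v).
    rewrite -(free_to_EM u' g') -(free_to_EM (u' * g') v') L1E.
    exact: (word_two_sided linL).
  case: Gg => [al be aI bI|al be aI bI|ze om uni].
  - rewrite (face_meetsE lmQ) => nd.
    exists (gen_lift al * gen_lift be); split=> [|w w']; first by rewrite free_to_EM !OS_e_lift.
    exact: (functional_meet ff linL Lw).
  - move/eqP; rewrite (face_meetsE lmQ) => dis.
    eexists; split; last by move=> w w'; apply: (functional_join ff linL Lw w w' aI bI dis).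
    rewrite free_to_EB free_to_EM free_to_EZ free_to_E_sum !OS_e_lift.
    by under eq_bigr do rewrite OS_e_lift.
  eexists; split; last by move=> w w'; apply: (functional_circuit ff linL Lw w w' uni).
  by rewrite free_to_E_sum; apply: eq_bigr => b _; rewrite free_to_EZ OS_e_lift.
exists phi; split=> // al aI.
have -> : OS_face al = quot_map (OS_relators fo) (free_to_E
   (if al \in bottoms M then 1 else gen_lift al)).
  by rewrite /OS_face; case: ifP => _; rewrite ?free_to_E1 ?rmorph1 // -OS_e_lift.
rewrite phiE L1E.
have -> : L (if al \in bottoms M then 1 else gen_lift al) =
   if (top al <= x)%O then f (increasing r (at_ al)) else 0.
  case: ifP => [ab|nab].
    rewrite -[1]/(word (mone : {fmonom gen})) Lw fm1 /= /word_seq /=.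
    rewrite (_ : (top al <= x)%O); last first.
      have := in_SP_rank_le lmQ (in_SP_face al).
      by move/(face_bottomsP lmQ): ab => ->; rewrite cards0 leqn0 => /(rank0P lmQ).
    by move/(face_bottomsP lmQ): ab => ->; rewrite /increasing enum_set0.
  have := functional_gen linL Lw mone mone al.
  rewrite /in_context -[word mone]/(1 : free_alg gen) mul1r mulr1 => ->.
  rewrite /gen_below inE nab aI /context_form /word_below /word_seq fm1 /=.
  by rewrite cats0.
have [-> |] := eqVneq (top al) x; first by rewrite lexx.
case: ifP => // ax; apply: contra_neq_eq => /(form_support ff)[_].
rewrite set_increasing => /basis_join <- //.
by rewrite (join_below_mono lmQ ax) ?face_join // face_atoms_below.
Qed.

End FormFunctional.

(** * Forms separate the elements of the Orlik-Solomon algebra *)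

(** The functionals vanishing on the rows of [w] are spanned by the columns of its
cokernel matrix. *)
Lemma dual_span (I J : finType) (w : J -> I -> rat) (c : I -> rat) :
    (forall l : I -> rat, (forall j, \sum_i w j i * l i = 0) -> \sum_i c i * l i = 0) ->
  exists e : J -> rat, forall i, c i = \sum_j e j * w j i.
Proof.
move=> H; pose W := \matrix_(j < #|J|, i < #|I|) w (enum_val j) (enum_val i).
pose C := \row_(i < #|I|) c (enum_val i).
have sumE (T : finType) (F : T -> rat) : \sum_i F i = \sum_(i < #|T|) F (enum_val i).
  by rewrite (reindex (@enum_val T T)) //; apply/onW_bij/enum_val_bij.
have /submxP[D CE] : (C <= W)%MS.
  rewrite submxE; apply/eqP/matrixP => i k; rewrite ord1 !mxE.
  rewrite -[RHS](H (fun i => cokermx W (enum_rank i) k)) => [|j].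
  by rewrite [RHS]sumE; apply: eq_bigr => l _; rewrite mxE enum_valK.
  have /matrixP/(_ (enum_rank j) k) := mulmx_coker W; rewrite !mxE => E.
  by rewrite -[RHS]E [LHS]sumE; apply: eq_bigr => l _; rewrite enum_valK [W _ _]mxE enum_rankK.
exists (fun j => D 0 (enum_rank j)) => i.
have /matrixP/(_ 0 (enum_rank i)) := CE; rewrite !mxE enum_rankK => ->.
by rewrite [RHS]sumE; apply: eq_bigr => j _; rewrite mxE enum_rankK enum_valK.
Qed.

Section Separation.
Variables (d : Order.disp_t) (Q : finPOrderType d) (r : rel Q).
Hypothesis lmQ : locally_matroidal Q.
Hypothesis rlin : linear_order_on (atoms Q) r.
Local Notation M := (prescheme_of Q).
Local Notation top := face_top.
Local Notation at_ := face_atoms.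
Local Notation fo := (face_order r).
Local Notation gen := (gens M).
Local Notation inc := (increasing r).
Local Notation OSf := (OS_face r).
Implicit Types (x : Q) (al be ga om ze b : M) (s : seq Q) (c : M -> rat).
Implicit Types (y z : OS_poset r).

Definition E_to_A (u : OS_E M) : OS_poset r := quot_map (OS_relators fo) u.

Lemma E_to_AM : {morph E_to_A : u v / u * v}.
Proof. by move=> u v; rewrite /E_to_A rmorphM. Qed.

Lemma E_to_A1 : E_to_A 1 = 1.
Proof. by rewrite /E_to_A rmorph1. Qed.

Lemma E_to_AZ k : {morph E_to_A : u / k *: u}.
Proof. by move=> u; rewrite /E_to_A linearZ. Qed.

Lemma E_to_AB : {morph E_to_A : u v / u - v}.
Proof. by move=> u v; rewrite /E_to_A rmorphB. Qed.

Lemma E_to_A_sum (I : Type) (s : seq I) (P : pred I) (F : I -> OS_E M) :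
  E_to_A (\sum_(i <- s | P i) F i) = \sum_(i <- s | P i) E_to_A (F i).
Proof. exact: raddf_sum. Qed.

Lemma E_to_A_relator g : OS_relator fo g -> E_to_A g = 0.
Proof.
move=> Gg; rewrite /E_to_A -(raddf0 (quot_map (OS_relators fo))).
apply: quot_map_eq; rewrite subr0 -[g]addr0 -[g]mulr1 -[g * 1]mul1r mulrA.
exact: IdealAdd Gg (IdealZero _).
Qed.

Lemma OS_face_gen al : al \notin bottoms M -> OSf al = E_to_A (OS_e al).
Proof. by rewrite /OS_face => /negPf ->. Qed.

Lemma OS_face_bottom al : al \in bottoms M -> OSf al = 1.
Proof. by rewrite /OS_face => ->. Qed.

Lemma joins_bottom al be ga : al \in bottoms M ->
  (ga \in joins [set al; be]) = (ga == be).
Proof.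
move=> /(face_bottomsP lmQ) a0; rewrite (face_joinsE lmQ) a0 set0U.
have aleq (x : Q) : (top al <= x)%O.
  by have := in_SP_rank_le lmQ (in_SP_face al); rewrite a0 cards0 leqn0 => /(rank0P lmQ).
rewrite aleq /=; apply/andP/eqP => [[bg /eqP gb]|->]; last by rewrite lexx eqxx.
by apply: (subface_inj lmQ (lexx ga)); rewrite // face_le bg gb subxx.
Qed.

(** For faces that share an atom the concatenated list has a repeated entry, on
which the order form is zero.  With 1 for the bottom face, one formula thus
covers all cases. *)
Lemma OS_face_mul al be : al \in indep M -> be \in indep M ->
  OSf al * OSf be = order_form rat (atoms Q) r (inc (at_ al) ++ inc (at_ be))
    *: \sum_(ga in joins [set al; be] :&: indep M) OSf ga.
Proof.
move=> aI bI.
have [ab|nab] := boolP (al \in bottoms M).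
  rewrite (OS_face_bottom ab) mul1r; move/(face_bottomsP lmQ): (ab) => ->.
  rewrite [inc set0](_ : _ = [::]) ?cat0s; last by rewrite /increasing enum_set0.
  rewrite order_form_increasing ?scale1r ?face_atomsA //.
  rewrite (big_pred1 be) // => ga; rewrite /= inE joins_bottom //.
  by case: eqP => [->|//]; rewrite bI.
have [bb|nbb] := boolP (be \in bottoms M).
  rewrite (OS_face_bottom bb) mulr1; move/(face_bottomsP lmQ): (bb) => ->.
  rewrite [inc set0](_ : _ = [::]) ?cats0; last by rewrite /increasing enum_set0.
  rewrite order_form_increasing ?scale1r ?face_atomsA //.
  rewrite (big_pred1 al) // => ga; rewrite /= inE setUC joins_bottom //.
  by case: eqP => [->|//]; rewrite aI.
rewrite !OS_face_gen // -(E_to_AM (OS_e al) (OS_e be)).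
have aI' : al \in indep M :\: bottoms M by rewrite inE nab.
have bI' : be \in indep M :\: bottoms M by rewrite inE nbb.
have [dis|ndis] := boolP [disjoint at_ al & at_ be]; last first.
  have := OS_meet fo aI' bI'; rewrite (face_meetsE lmQ) => /(_ ndis)/E_to_A_relator ->.
  rewrite /order_form cat_uniq (_ : has _ _ = true) ?andbF ?scale0r //.
  case/pred0Pn: ndis => t /andP[/= ta tb].
  by apply/hasP; exists t; rewrite mem_increasing.
have mE : meets [set al; be] = bottoms M by apply/eqP; rewrite (face_meetsE lmQ).
have /E_to_A_relator := OS_join fo aI' bI' mE.
rewrite E_to_AB => /eqP; rewrite subr_eq0 => /eqP ->; rewrite E_to_AZ E_to_A_sum.
have -> : \sum_(ga in joins [set al; be] :&: indep M) E_to_A (OS_e ga) =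
   \sum_(ga in joins [set al; be] :&: indep M) OSf ga.
  apply: eq_bigr => ga; rewrite inE (face_joinsE lmQ) => /andP[/and3P[_ _ /eqP gU] _].
  rewrite OS_face_gen //; apply: contra nab => /(face_bottomsP lmQ) g0.
  by apply/(face_bottomsP lmQ)/eqP; rewrite -subset0 -g0 gU subsetUl.
case: (pickP [pred ga | ga \in joins [set al; be] :&: indep M]) => [ga|none]; last first.
  by rewrite !big_pred0 ?scaler0.
rewrite /= inE (face_joinsE lmQ) => /andP[/and3P[ag bg /eqP gU] _].
have [ag' bg'] : (al <= ga)%O /\ (be <= ga)%O.
  by rewrite !face_le gU ag bg subsetUl subsetUr.
rewrite (sgn_disjoint_faces lmQ rlin (order_form_alternating rat rlin) ag' bg' dis).
by rewrite -gU order_form_increasing ?mulr1 ?face_atomsA.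
Qed.

Definition spanned y : Prop := exists c, y = \sum_(al in indep M) c al *: OSf al.

Lemma spannedD y z : spanned y -> spanned z -> spanned (y + z).
Proof.
move=> [c ->] [c' ->]; exists (fun al => c al + c' al).
by rewrite -big_split; apply: eq_bigr => al _; rewrite scalerDl.
Qed.

Lemma spannedZ k y : spanned y -> spanned (k *: y).
Proof.
move=> [c ->]; exists (fun al => k * c al).
by rewrite scaler_sumr; apply: eq_bigr => al _; rewrite scalerA.
Qed.

Lemma spanned0 : spanned 0.
Proof. by exists (fun=> 0); rewrite big1 // => al _; rewrite scale0r. Qed.

Lemma spanned_sum (I : Type) (s : seq I) (P : pred I) (F : I -> OS_poset r) :
  (forall i, P i -> spanned (F i)) -> spanned (\sum_(i <- s | P i) F i).
Proof. by move=> H; apply: big_ind => //; [apply: spanned0 | apply: spannedD]. Qed.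

Lemma spanned_face al : al \in indep M -> spanned (OSf al).
Proof.
move=> aI; exists (fun be => (be == al)%:R).
rewrite (bigD1 al) //= eqxx scale1r big1 ?addr0 // => be /andP[_ /negPf ->].
by rewrite scale0r.
Qed.

Lemma spanned_mul al y : al \in indep M -> spanned y -> spanned (OSf al * y).
Proof.
move=> aI [c ->]; rewrite mulr_sumr; apply: spanned_sum => be bI.
rewrite -scalerAr; apply: spannedZ; rewrite (OS_face_mul aI bI); apply: spannedZ.
by apply: spanned_sum => ga; rewrite inE => /andP[_]; apply: spanned_face.
Qed.

Lemma spanned1 : spanned 1.
Proof.
have /set0Pn[al ab] := face_bottoms_neq0 lmQ.
by rewrite -(OS_face_bottom ab); apply: spanned_face; apply: bottom_indep.
Qed.

(** By the product formula the span of the independent faces is stable under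
multiplication by the generators. *)
Lemma OS_spanned y : spanned y.
Proof.
have [u ->] : exists u : OS_E M, y = E_to_A u.
  by exists (quot_repr y); rewrite /E_to_A quot_reprK.
have [v ->] := free_to_E_surj u; rewrite [v]word_sum free_to_E_sum E_to_A_sum.
apply: spanned_sum => w _; rewrite free_to_EZ E_to_AZ; apply: spannedZ.
rewrite -(fmK w); elim: (w : seq gen) => [|g t IH].
  by rewrite -fmoneE -[word (fmone _)]/(1 : free_alg gen) free_to_E1 E_to_A1; apply: spanned1.
have -> : word (FMonom (g :: t)) = free_gen g * word (FMonom t).
  by rewrite -[free_gen g]/(word (fmu g)) -word_mul; congr word; apply/eqP; rewrite fmP fmM fmU.
rewrite free_to_EM E_to_AM.
have -> : free_to_E (free_gen g) = OS_e (val g).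
  by rewrite OS_e_lift /gen_lift valK.
have := valP g; rewrite inE => /andP[nb gI].
by rewrite -(OS_face_gen nb); apply: spanned_mul.
Qed.

End Separation.

Section LinearCombinations.
Variables (V : lmodType rat) (I J : finType) (G : I -> V).

Lemma sum_delta i : \sum_k (k == i)%:R *: G k = G i.
Proof.
rewrite (bigD1 i) //= eqxx scale1r big1 ?addr0 // => k /negPf ->.
by rewrite scale0r.
Qed.

Lemma sum_deltas (A : {set J}) (k : J -> rat) (F : J -> I) :
  \sum_i (\sum_(j in A) k j * (i == F j)%:R) *: G i = \sum_(j in A) k j *: G (F j).
Proof.
under eq_bigr do rewrite scaler_suml.
rewrite exchange_big /=; apply: eq_bigr => j _.
by under eq_bigr do rewrite -scalerA; rewrite -scaler_sumr sum_delta.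
Qed.

Lemma sum_combination (c : I -> rat) (e : J -> rat) (w : J -> I -> rat) :
    (forall i, c i = \sum_j e j * w j i) ->
  \sum_i c i *: G i = \sum_j e j *: \sum_i w j i *: G i.
Proof.
move=> cE; under eq_bigr do rewrite cE scaler_suml.
rewrite exchange_big /=; apply: eq_bigr => j _; rewrite scaler_sumr.
by apply: eq_bigr => i _; rewrite scalerA.
Qed.
End LinearCombinations.

Lemma sum_combination_sumType (V : lmodType rat) (I J K : finType) (G : I -> V)
    (c : I -> rat) (e : J + K -> rat) (w : J + K -> I -> rat) :
    (forall i, c i = \sum_j e j * w j i) ->
  \sum_i c i *: G i = \sum_j e (inl j) *: (\sum_i w (inl j) i *: G i)
                       + \sum_k e (inr k) *: (\sum_i w (inr k) i *: G i).
Proof. by move=> /sum_combination ->; rewrite big_sumType. Qed.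

Section SeparationByForms.
Variables (d : Order.disp_t) (Q : finPOrderType d) (r : rel Q).
Hypothesis lmQ : locally_matroidal Q.
Hypothesis rlin : linear_order_on (atoms Q) r.
Local Notation M := (prescheme_of Q).
Local Notation top := face_top.
Local Notation at_ := face_atoms.
Local Notation fo := (face_order r).
Local Notation inc := (increasing r).
Local Notation OSf := (OS_face r).
Local Notation ordf := (order_form rat (atoms Q) r).
Implicit Types (x : Q) (al be ga om ze b : M) (s : seq Q) (c l : M -> rat).

Local Notation facet om b := (face_below om (atoms_below om :\ b)).

(** The component at [x] of a functional on the span of the faces, as an
alternating function.  The sum has at most one term. *)
Definition functional_form l x s : rat :=
  ordf s * \sum_(al in indep M | (top al == x) && (at_ al == [set t in s])) l al.

Lemma functional_form_face l x al : al \in indep M -> top al = x ->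
  functional_form l x (inc (at_ al)) = l al.
Proof.
move=> aI ax; rewrite /functional_form order_form_increasing ?face_atomsA // mul1r.
rewrite set_increasing (big_pred1 al) // => be /=; apply/idP/eqP => [|->].
  by case/and3P => _ /eqP bx /eqP ba; apply: face_eq; rewrite ?ax.
by rewrite aI ax !eqxx.
Qed.

Lemma functional_form_support l x s : functional_form l x s != 0 ->
  basis x [set t in s].
Proof.
apply: contra_neqT => nb; rewrite /functional_form big_pred0 ?mulr0 // => al.
apply/negP => /and3P[aI /eqP ax /eqP a_s]; case/negP: nb.
by rewrite -ax -a_s -face_indepE.
Qed.

Lemma functional_form_alternating l x : alternating (functional_form l x).
Proof.
move=> s1 u v s2; rewrite /functional_form (order_form_alternating rat rlin) mulNr.
congr (- (_ * _)); apply: eq_bigl => al; congr [&& _, _ & _ == _].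
by apply/setP => t; rewrite !inE !mem_cat !inE; do 2![case: (t == _)].
Qed.

Lemma functional_form_facet l om b : (forall al, al \notin indep M -> l al = 0) ->
    om \notin indep M -> #|at_ om| = (rank (top om)).+1 -> b \in atoms_below om ->
  functional_form l (top om) (inc (at_ om :\ top b)) = l (facet om b).
Proof.
move=> l0 dep card bo.
have [fo_ afo _] := face_belowE lmQ (subsetDl (atoms_below om) [set b]).
have sA : at_ om :\ top b \subset atoms Q := subset_trans (subsetDl _ _) (face_atomsA lmQ om).
rewrite face_top_setD1 // in afo.
have [fI|nfI] := boolP (facet om b \in indep M).
  rewrite -afo; apply: functional_form_face => //.
  apply: (eq_of_rank lmQ); first by move: fo_; rewrite face_le => /andP[].
  move: fI; rewrite face_indepE => /basis_card ->.
  have := cardsD1 (top b) (at_ om); have [-> _] := atom_face_top lmQ bo.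
  by rewrite card add1n afo => -[->].
rewrite (l0 _ nfI) /functional_form big_pred0 ?mulr0 // => al.
apply/negP => /and3P[aI /eqP ax /eqP ao]; case/negP: nfI; move: ao.
rewrite set_increasing => ao; suff <- : al = facet om b by [].
have alo : (al <= om)%O by rewrite face_le ax lexx ao subsetDl.
by apply: (subface_inj lmQ alo fo_); rewrite ao afo.
Qed.

(** Unless all terms of the coboundary vanish, the entries of [s] with one entry
removed form a basis of [x].  The entries are then the atoms of a unicircular
face with top [x], and the coboundary is the circuit relation of that face. *)
Lemma functional_form_cocycle l x : (forall al, al \notin indep M -> l al = 0) ->
    (forall ze om, unicircular ze om ->
      \sum_(b in atoms_below om) sgn fo [set b] (atoms_below om :\ b) * l (facet om b) = 0) ->
  forall s, [set t in s] \subset atoms_below x -> coboundary (functional_form l x) s = 0.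
Proof.
move=> l0 lR s sx; have af := functional_form_alternating l x.
have ac := alternating_wedge (fun=> 1) af.
have [us|/(alternating_eq0 ac) //] := boolP (uniq s).
have sA : [set t in s] \subset atoms Q by case/sub_atoms_below: sx.
rewrite /coboundary (alternating_increasing rlin ac us sA); set T := [set t in s].
suff -> : wedge (fun=> 1) (functional_form l x) (inc T) = 0 by rewrite mulr0.
have [xT|nxT] := boolP (in_SP (x, T)); last first.
  apply: (wedge_eq0 (D := mem T)) => [|u uT _].
    by apply/allP => t; rewrite mem_increasing.
  apply/eqP/negPn/negP => /functional_form_support bu; case/negP: nxT.
  have uT' : [set t in u] \subset T.
    by apply/subsetP => t; rewrite inE => /(allP uT).
  apply/(in_SPP lmQ); split=> //; apply: le_anti; rewrite join_below_le //=.
  by rewrite -{1}(basis_join lmQ bu) join_below_sub.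
have [om [ox oT]] := faceP xT; rewrite -oT -ox.
have [card|ncard] := eqVneq #|at_ om| (rank (top om)).+1.
  have [ze uni] := unicircular_exists lmQ card.
  have dep := unicircular_dependent lmQ uni.
  rewrite -ox in af; apply: (etrans (coboundary_face lmQ rlin om af)).
  rewrite -[RHS](lR _ _ uni); apply: eq_bigr => b bo; congr (_ * _).
  exact: functional_form_facet.
apply: (wedge_eq0 (D := predT)) => [|u _]; first exact/allP.
rewrite size_increasing => su; apply/eqP/negPn/negP => fu.
have bu := functional_form_support fu; case/eqP: ncard.
rewrite -su (basis_card bu); congr _.+1; apply/esym/eqP; rewrite cardsE.
rewrite -ox in af; apply/eqP/card_uniqP.
by apply: contraNT fu => /(alternating_eq0 af) ->.
Qed.

Lemma functional_form_top_form l x : (forall al, al \notin indep M -> l al = 0) ->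
    (forall ze om, unicircular ze om ->
      \sum_(b in atoms_below om) sgn fo [set b] (atoms_below om :\ b) * l (facet om b) = 0) ->
  top_form [set: Q] x (functional_form l x).
Proof.
move=> l0 lR; split; first exact: functional_form_alternating.
  by move=> s /functional_form_support; rewrite subsetT.
by move=> s; rewrite setTI; apply: functional_form_cocycle.
Qed.

Definition face_pairing c x f : rat :=
  \sum_(al in indep M | top al == x) c al * f (inc (at_ al)).

(** The facets that still contain the circuit are dependent, so the circuit
relation can be extended to all atoms of [om], as in the coboundary. *)
Lemma unicircular_relation ze om (c0 : M -> OS_poset r) : unicircular ze om ->
    (forall al, al \in indep M -> c0 al = OSf al) ->
    (forall al, al \notin indep M -> c0 al = 0) ->
  \sum_(b in atoms_below om) sgn fo [set b] (atoms_below om :\ b) *: c0 (facet om b) = 0.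
Proof.
move=> uni cI cN; have := E_to_A_relator (OS_circuit fo uni); rewrite E_to_A_sum => E.
have [_ zo _] := unicircularP uni; have zoA := atoms_below_le zo.
apply: (etrans (esym (sum_in_subset zoA _))).
  move=> b bo nbz; rewrite cN ?scaler0 //.
  by rewrite (unicircular_indep lmQ uni bo).
rewrite -[RHS]E; apply: eq_bigr => b bz; have bo := subsetP zoA b bz.
have fI : facet om b \in indep M by rewrite (unicircular_indep lmQ uni bo); exact: bz.
have nb := facet_nonbottom lmQ (unicircular_dependent lmQ uni) bo.
by rewrite E_to_AZ (cI _ fI) (OS_face_gen r nb).
Qed.

(** A functional that kills the faces in [B], the dependent faces and the circuit
relations has forms vanishing on [B] as its components.  If such forms kill the
combination, then by duality it is a combination of faces in [B] modulo the
circuit relations. *)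
Lemma separation c (B : {set M}) :
    (forall x f, top_form [set: Q] x f ->
      (forall be, be \in B -> be \in indep M -> top be = x -> f (inc (at_ be)) = 0) ->
      face_pairing c x f = 0) ->
  exists e : M -> rat,
    \sum_(al in indep M) c al *: OSf al = \sum_(be in indep M | be \in B) e be *: OSf be.
Proof.
move=> H; pose D al := (al \notin indep M) || (al \in B).
pose uni om := [exists ze, unicircular ze om].
pose R om al : rat := if uni om then
  \sum_(b in atoms_below om) sgn fo [set b] (atoms_below om :\ b) * (al == facet om b)%:R else 0.
(* The left summand indexes the faces to be killed, the right one the circuit
relations. *)
pose w (j : M + M) al : rat := match j with
  | inl be => (D be && (al == be))%:R
  | inr om => R om al end.
pose c0 al := if al \in indep M then c al else 0.
have [e eE] : exists e : M + M -> rat, forall al, c0 al = \sum_j e j * w j al.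
  apply: dual_span => l lw.
  have lD al : D al -> l al = 0.
    move=> Da; have /= := lw (inl al); rewrite Da /= => <-.
    exact: (esym (sum_delta (l : M -> rat^o) al)).
  have l0 al : al \notin indep M -> l al = 0 by move=> na; apply: lD; rewrite /D na.
  have lR ze om : unicircular ze om ->
      \sum_(b in atoms_below om) sgn fo [set b] (atoms_below om :\ b) * l (facet om b) = 0.
    move=> zo; have uo : uni om by apply/existsP; exists ze.
    apply: etrans (lw (inr om)); rewrite /= /R uo.
    exact: (esym (sum_deltas (l : M -> rat^o) (atoms_below om)
      (fun b => sgn fo [set b] (atoms_below om :\ b)) (fun b => facet om b))).
  have Hx x : face_pairing c x (functional_form l x) = 0.
    apply: H => [|be bB bI bx]; first exact: functional_form_top_form.
    by rewrite functional_form_face // lD // /D bB orbT.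
  transitivity (\sum_(al in indep M) c al * l al).
    rewrite [RHS]big_mkcond; apply: eq_bigr => al _; rewrite /c0.
    by case: ifP => //; rewrite mul0r.
  rewrite (partition_big top predT) //= big1 // => x _; rewrite -[RHS](Hx x).
  by apply: eq_bigr => al /andP[aI /eqP ax]; rewrite functional_form_face.
pose G al := if al \in indep M then OSf al else 0.
exists (fun be => e (inl be)).
transitivity (\sum_al c0 al *: G al).
  rewrite [LHS]big_mkcond; apply: eq_bigr => al _; rewrite /c0 /G.
  by case: (al \in indep M); rewrite ?scale0r.
have R0 om : \sum_al w (inr om) al *: G al = 0.
  rewrite /= /R; case: (boolP (uni om)) => [/existsP[ze zo]|_]; last first.
    by rewrite big1 // => al _; rewrite scale0r.
  apply: (etrans (sum_deltas G (atoms_below om)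
      (fun b => sgn fo [set b] (atoms_below om :\ b)) (fun b => facet om b))).
  apply: (unicircular_relation zo) => al; rewrite /G; first by move=> ->.
  by move=> /negPf ->.
have D0 be : \sum_al w (inl be) al *: G al = if D be then G be else 0.
  rewrite /=; case: (D be) => /=; first exact: sum_delta.
  by rewrite big1 // => al _; rewrite scale0r.
apply: (etrans (sum_combination_sumType G eE)).
rewrite [X in _ + X]big1 => [|om _]; last by rewrite R0 scaler0.
rewrite addr0 [RHS]big_mkcond; apply: eq_bigr => be _.
rewrite D0 /D /G; case: (be \in indep M); last by rewrite scaler0.
by case: (be \in B); rewrite /= ?scaler0.
Qed.

End SeparationByForms.

(** * Extension of forms from the deletion *)

Section Alternation.
Variable T : finType.
Implicit Types (f g : seq T -> rat) (s : seq T).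

Lemma alternatingD f g : alternating f -> alternating g -> alternating (fun s => f s + g s).
Proof. by move=> af ag s u v s'; rewrite af ag opprD. Qed.

Lemma alternatingN f : alternating f -> alternating (fun s => - f s).
Proof. by move=> af s u v s'; rewrite af. Qed.

Lemma alternating0 : alternating (fun _ : seq T => 0 : rat).
Proof. by move=> s u v s'; rewrite oppr0. Qed.

Lemma alternating_sum (I : finType) (P : pred I) (F : I -> seq T -> rat) :
  (forall i, P i -> alternating (F i)) -> alternating (fun s => \sum_(i | P i) F i s).
Proof.
by move=> aF s u v s'; rewrite -sumrN; apply: eq_bigr => i /aF; apply.
Qed.

Lemma alternating_if (A : pred {set T}) f : alternating f ->
  alternating (fun s => if A [set t in s] then f s else 0).
Proof.
move=> af s u v s'; have -> : [set t in s ++ u :: v :: s'] = [set t in s ++ v :: u :: s'].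
  by apply/setP => t; rewrite !inE !mem_cat !inE; do 2![case: (t == _)].
by case: ifP => _; rewrite ?oppr0.
Qed.
End Alternation.

Section Extension.
Variables (d : Order.disp_t) (P : finPOrderType d).
Hypothesis lmP : locally_matroidal P.
Variables (a : P).
Hypothesis ha : a \in atoms P.
Implicit Types (x y z : P) (f g h : seq P -> rat) (s u : seq P).

Lemma atom_mem x : (a \in atoms_below x) = (a <= x)%O.
Proof. by rewrite inE ha. Qed.

Lemma card_setU1_seq s : uniq s -> a \notin s -> #|a |: [set t in s]| = (size s).+1.
Proof. by move=> us nas; rewrite cardsU1 inE nas cardsE (card_uniqP us). Qed.

(** For [f0] and [g] not involving [a], the function [f0 + a /\ g] is closed on
sequences without [a] when [f0] is, and on sequences starting with [a] when
[f0] is the coboundary of [g]. *)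
Lemma glue_form x f0 g : alternating f0 -> alternating g ->
    (forall s, f0 s != 0 -> a \notin s /\ basis x [set t in s]) ->
    (forall s, g s != 0 -> a \notin s /\ basis x (a |: [set t in s])) ->
    (forall s, [set t in s] \subset atoms_below x -> a \notin s -> coboundary f0 s = 0) ->
    (forall s, [set t in s] \subset atoms_below x -> a \notin s -> coboundary g s = f0 s) ->
  top_form [set: P] x (fun s => f0 s + dual_wedge a g s).
Proof.
move=> af0 ag H0 Hg H0c Hgc.
have f0a s : f0 (a :: s) = 0.
  by apply/eqP/negPn/negP => /H0[]; rewrite mem_head.
have ga s : g (a :: s) = 0.
  by apply/eqP/negPn/negP => /Hg[]; rewrite mem_head.
have aw := alternating_wedge (fun t => (t == a)%:R : rat) ag.
have af := alternatingD af0 aw.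
split=> // [s|s].
  rewrite subsetT => fs; split=> //.
  have [f0s|/H0[]//] := eqVneq (f0 s) 0; rewrite f0s add0r in fs.
  have [sa|/dual_wedge_notin E] := boolP (a \in s); last by rewrite E eqxx in fs.
  case/splitPr: sa fs => s1 s2; rewrite /dual_wedge (alternating_to_front s1 a s2 aw).
  rewrite mulf_eq0 signr_eq0 orFb -/(dual_wedge a g (a :: s1 ++ s2)) dual_wedge_cons // => /Hg[_].
  congr (basis x _); apply/setP => t; rewrite !inE !mem_cat inE.
  by case: (t == a); rewrite ?orbT.
rewrite setTI => sx; have acf := alternating_wedge (fun=> 1 : rat) af.
apply: (alternating_eq0_pivot (a := a) (D := mem (atoms_below x)) acf).
- move=> u; rewrite all_set => ux nau; rewrite wedgeD -!/(coboundary _) H0c // add0r.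
  by rewrite coboundary_dual_wedge dual_wedge_notin ?oppr0.
- move=> u; rewrite all_set => ux nau; rewrite wedgeD -!/(coboundary _).
  rewrite coboundary_dual_wedge dual_wedge_uniq // Hgc //.
  have := coboundary_homotopy f0 a u; rewrite /coboundary (@eq_wedge _ _ _ _ (fun=> 0)) //.
  by rewrite wedge0 => /eqP; rewrite eq_sym subr_eq0 => /eqP ->; rewrite subrr.
- by rewrite all_set.
Qed.

Let disj_all (D : {set P}) s : [set t in s] \subset [set~ a] :&: D ->
  [set t in s] \subset D /\ a \notin s.
Proof.
rewrite subsetI => /andP[/subsetP sa sD]; split=> //.
by apply/negP => as_; have := sa a; rewrite !inE as_ eqxx => /(_ isT).
Qed.

Let sub_disj (D : {set P}) s : [set t in s] \subset D -> a \notin s ->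
  [set t in s] \subset [set~ a] :&: D.
Proof.
move=> sD nas; rewrite subsetI sD andbT; apply/subsetP => t; rewrite !inE => ts.
by apply: contraNneq nas => <-.
Qed.

(** Fixing an atom [b] other than [a] as the first entry gives a primitive [g0] of
[f].  Its unwanted values are those at sets that span, together with [a], only a
coatom [y] of [x] above [a].  The values at the bases of [y] are a form of the
deletion at [y], which by induction has a primitive [h y] of the required kind;
subtracting the coboundary of the sum of the [h y] removes the unwanted values and
does not change the coboundary of [g0]. *)
Lemma deletion_primitive x f : (a <= x)%O -> top_form [set~ a] x f ->
  exists g, [/\ alternating g,
    forall s, g s != 0 -> a \notin s /\ basis x (a |: [set t in s])
  & forall s, [set t in s] \subset atoms_below x -> a \notin s -> coboundary g s = f s].
Proof.
elim/poset_ind: x f => x IH f ax ff.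
have af := form_alternating ff.
have [[s0 fs0]|f0] := pselect (exists s, f s != 0); last first.
  exists (fun=> 0); split=> [|s|s _ _]; first exact: alternating0.
    by rewrite eqxx.
  rewrite /coboundary wedge0; apply/esym/eqP/negPn/negP => fs.
  by apply: f0; exists s.
have [b [bx bna]] : exists b, b \in atoms_below x /\ b != a.
  case: s0 fs0 => [|b s0] fs0.
    have [_ /basis_card r0] := form_support ff fs0.
    move: ha; rewrite inE => /eqP a1; have := rank_le lmP ax.
    by rewrite a1 r0 (_ : [set _ in _] = set0) ?cards0 //; apply/setP => t; rewrite !inE.
  exists b; have [sa /(basis_atoms lmP) sx] := form_support ff fs0.
  have bin : b \in [set t in b :: s0] by rewrite inE mem_head.
  by split; [apply: (subsetP sx) | have := subsetP sa _ bin; rewrite !inE].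
pose g0 s := f (b :: s).
have ag0 : alternating g0 := alternating_cons b af.
have g0c s : [set t in s] \subset atoms_below x -> a \notin s -> coboundary g0 s = f s.
  move=> sx nas; rewrite /g0 coboundary_homotopy (form_cocycle ff) ?subr0 //.
  apply: sub_disj; first by rewrite set_cons subUset sub1set bx.
  by rewrite inE negb_or eq_sym bna.
pose Y y := [&& (a <= y)%O, (y < x)%O & (rank y).+1 == rank x].
have Yx y : Y y -> (y <= x)%O by case/and3P => _ /ltW.
have g0basis s : g0 s != 0 -> uniq s /\ basis x (b |: [set t in s]) /\ b \notin s.
  move=> gs; have [_] := form_support ff gs; rewrite set_cons => bs.
  by have /= := form_uniq ff gs => /andP[].
have g0size s : g0 s != 0 -> (size s).+1 = rank x.
  case/g0basis=> us [/basis_card -> nb].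
  by rewrite cardsU1 inE nb cardsE (card_uniqP us).
pose fy y s := if basis y [set t in s] then g0 s else 0.
have fyE y s : Y y -> [set t in s] \subset atoms_below y -> fy y s = g0 s.
  move=> Yy sy; rewrite /fy; case: ifP => // /negP nb; apply/esym/eqP/negPn/negP => gs.
  case: nb; have [us [bs nb]] := g0basis s gs.
  have bsub := basis_sub lmP bs (subsetUr [set b] [set t in s]).
  rewrite (join_below_mono lmP (Yx y Yy) sy) in bsub.
  suff <- : join_below y [set t in s] = y by [].
  apply: (eq_of_rank lmP (join_below_le lmP sy)); rewrite (basis_card bsub).
  rewrite cardsE (card_uniqP us) -ltnS g0size //.
  by case/and3P: Yy => _ _ /eqP ->.
have fyform y : Y y -> top_form [set~ a] y (fy y).
  move=> Yy; split.
  - exact: (alternating_if (basis y) ag0).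
  - move=> s; rewrite /fy; case: ifP => [by_ gs|]; last by rewrite eqxx.
    split=> //; have [sa _] := form_support ff gs; apply: subset_trans sa.
    by rewrite set_cons subsetUr.
  move=> s /disj_all[sy nas].
  have sx := subset_trans sy (atoms_below_le (Yx y Yy)).
  rewrite /coboundary (@eq_wedge_in _ _ (mem (atoms_below y)) _ _ g0) ?all_set //.
    rewrite -/(coboundary g0) g0c //; apply/eqP/negPn/negP => fs.
    have [_ bs] := form_support ff fs.
    have : (x <= y)%O.
      rewrite -(basis_join lmP bs) (join_below_mono lmP (Yx y Yy) sy).
      exact: join_below_le.
    by case/and3P: Yy => _ /lt_geF ->.
  by move=> u; rewrite all_set => uy _; apply: fyE.
have /choice[h hP] : forall y, exists hy : seq P -> rat, Y y ->
    [/\ alternating hy,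
      forall s, hy s != 0 -> a \notin s /\ basis y (a |: [set t in s])
    & forall s, [set t in s] \subset atoms_below y -> a \notin s ->
        coboundary hy s = fy y s].
  move=> y; have [Yy|nY] := boolP (Y y); last by exists (fun=> 0) => Yy; case/negP: nY.
  have /and3P[ay yx _] := Yy.
  by have [hy] := IH y yx (fy y) ay (fyform y Yy); exists hy.
pose H s := \sum_(y | Y y) h y s.
have aH : alternating H by apply: alternating_sum => y /hP[].
have hsize y s : Y y -> h y s != 0 -> (size s).+1 = rank y.
  move=> Yy hs; have [ah hsupp _] := hP y Yy; have [nas /basis_card ->] := hsupp s hs.
  rewrite card_setU1_seq //; apply: contraNT hs => ns.
  by rewrite (alternating_eq0 ah ns).
pose A (S : {set P}) := S \subset atoms_below x :\ a.
pose g s := if A [set t in s] then g0 s - coboundary H s else 0.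
have AP s : A [set t in s] <-> [set t in s] \subset atoms_below x /\ a \notin s.
  by rewrite /A subsetD1 inE; split=> [/andP[]//|[-> ->]].
exists g; split.
- exact: (alternating_if A (alternatingD ag0 (alternatingN (alternating_wedge _ aH)))).
- move=> s; rewrite /g; case: ifP => [/AP[sx nas] gs|]; last by rewrite eqxx.
  split=> //; have us : uniq s.
    apply: contraNT gs => ns; rewrite (alternating_eq0 ag0 ns).
    by rewrite [coboundary H s](alternating_eq0 (alternating_wedge _ aH) ns) subrr.
  set T := a |: [set t in s]; have cT : #|T| = (size s).+1 by apply: card_setU1_seq.
  have Tx : T \subset atoms_below x by rewrite subUset sub1set atom_mem ax.
  have [sr|nsr] := eqVneq (size s).+1 (rank x); last first.
    case/eqP: gs; have -> : g0 s = 0 by apply: contra_neq_eq nsr => /g0size.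
    rewrite sub0r [coboundary H s](wedge_eq0 (D := predT)) ?oppr0 //; first exact/allP.
    move=> u _ su; rewrite /H big1 // => y Yy; apply: contra_neq_eq nsr => hu.
    by have /and3P[_ _ /eqP <-] := Yy; rewrite -(hsize y u Yy hu) su.
  have [jx|njx] := eqVneq (join_below x T) x.
    by apply: (basisE lmP Tx); rewrite ?cT // jx.
  have jlt : (join_below x T < x)%O by rewrite lt_neqAle njx join_below_le.
  have [y [jy yx ry]] := coatom_above lmP jlt.
  have Ty : T \subset atoms_below y.
    exact: subset_trans (sub_atoms_join lmP Tx) (atoms_below_le jy).
  have /andP[ay sy] : (a <= y)%O && ([set t in s] \subset atoms_below y).
    by move: Ty; rewrite subUset sub1set atom_mem.
  have Yy : Y y by rewrite /Y ay yx ry eqxx.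
  have [ah hsupp hc] := hP y Yy.
  (* Among all [h z] only [h y] is nonzero on the atoms below the coatom [y], so that
  the correction at [s] is exactly the unwanted value. *)
  case/eqP: gs; rewrite -(fyE y s Yy sy) -(hc s sy nas); apply/eqP; rewrite subr_eq0.
  apply/eqP; apply: (eq_wedge_in (D := mem (atoms_below y))); rewrite ?all_set //.
  move=> u; rewrite all_set => uy _; rewrite /H (bigD1 y) //= big1 ?addr0 //.
  move=> z /andP[Yz nzy]; have [_ zsupp _] := hP z Yz.
  apply: contra_neq_eq nzy => /zsupp[_ bz].
  have Uy : a |: [set t in u] \subset atoms_below y by rewrite subUset sub1set atom_mem ay.
  have zy : (z <= y)%O.
    rewrite -(basis_join lmP bz) -(join_below_mono lmP (Yx z Yz) (basis_atoms lmP bz)).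
    by rewrite (join_below_mono lmP (Yx y Yy) Uy) join_below_le.
  apply: (eq_of_rank lmP zy); rewrite -ltnS.
  by have /and3P[_ _ /eqP ->] := Yy; have /and3P[_ _ /eqP ->] := Yz.
move=> s sx nas.
rewrite /coboundary (@eq_wedge_in _ _ (mem (atoms_below x :\ a)) _ _ (fun u => g0 u - coboundary H u)).
- by rewrite wedgeB -!/(coboundary _) g0c // /coboundary wedge_square subr0.
- by rewrite all_set; apply/AP.
- by move=> u; rewrite all_set => Au _; rewrite /g /A Au.
Qed.

(** Above [a] the extension is [f + a /\ g] with the primitive [g] of [f]; elsewhere
no sequence of atoms below [x] contains [a]. *)
Lemma deletion_form_extension x f : top_form [set~ a] x f ->
  exists f', top_form [set: P] x f' /\ forall s, a \notin s -> f' s = f s.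
Proof.
move=> ff; have [ax|nax] := boolP (a <= x)%O.
  have [g [ag gsupp gc]] := deletion_primitive ax ff.
  exists (fun s => f s + dual_wedge a g s); split.
    apply: glue_form => //; first exact: form_alternating ff.
      move=> s fs; have [sa bs] := form_support ff fs; split=> //.
      by apply/negP => as_; have := subsetP sa a; rewrite !inE as_ eqxx => /(_ isT).
    by move=> s sx nas; apply: (form_cocycle ff); apply: sub_disj.
  by move=> s nas; rewrite dual_wedge_notin ?addr0.
exists f; split=> //; split; first exact: form_alternating ff.
  by move=> s /(form_support ff)[_ ->]; rewrite subsetT.
move=> s; rewrite setTI => sx; apply: (form_cocycle ff); apply: sub_disj => //.
apply: contra nax => as_; rewrite -atom_mem; apply: (subsetP sx).
by rewrite inE.
Qed.

End Extension.

(** * Forms of the deletion and of the contraction *)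

Lemma set_map (T U : finType) (f : T -> U) (s : seq T) :
  [set u in map f s] = f @: [set t in s].
Proof.
apply/setP => u; rewrite inE; apply/mapP/imsetP => -[t ts ->]; exists t => //.
  by rewrite inE.
by rewrite inE in ts.
Qed.

Lemma alternating_map (R : numDomainType) (T U : eqType) (f : T -> U) (h : seq U -> R) :
  alternating h -> alternating (fun s => h (map f s)).
Proof. by move=> ah s u v s'; rewrite !map_cat; apply: ah. Qed.

Lemma coboundary_map (T U : eqType) (f : T -> U) (h : seq U -> rat) s :
  coboundary h (map f s) = coboundary (fun u => h (map f u)) s.
Proof. exact: wedge_map. Qed.

Section DeletionForms.
Variables (d d' : Order.disp_t) (P : finPOrderType d) (F : finPOrderType d').
Hypothesis lmP : locally_matroidal P.
Variables (a : P) (ha : a \in atoms P) (iota : F -> P).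
Hypothesis iota_le : forall x y, (x <= y)%O = (iota x <= iota y)%O.
Hypothesis iota_im : forall z, (exists x, iota x = z) <-> in_SP (z, atoms_below z :\ a).
Implicit Types (x : F).

Lemma deletion_restrict_form x f : top_form [set: P] (iota x) f ->
  top_form [set: F] x (fun s => f (map iota s)).
Proof.
move=> ff; split; first exact: alternating_map (form_alternating ff).
  move=> s /(form_support ff)[_]; rewrite set_map subsetT.
  by rewrite (deletion_basis lmP ha iota_le iota_im).
move=> s; rewrite setTI -coboundary_map (deletion_image_sub lmP iota_le iota_im).
by rewrite -set_map => sx; apply: (form_cocycle ff); rewrite setTI.
Qed.

(** Read on the atoms other than [a], a form of the deletion is a form for the
restriction to these atoms. *)
Lemma deletion_extend_form x f : top_form [set: F] x f ->
  exists f', top_form [set: P] (iota x) f' /\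
    forall s, [set t in s] \subset atoms F -> f' (map iota s) = f s.
Proof.
move=> ff; have af := form_alternating ff; have [b _] := deletion_bottom lmP iota_le iota_im.
have [kappa kappaK] := embedding_retraction iota_le b.
pose A (S : {set P}) := S \subset codom iota.
pose g s := if A [set t in s] then f (map kappa s) else 0.
have mapK s : A [set t in s] -> s = map iota (map kappa s).
  move=> /subsetP sA; rewrite -map_comp -[LHS]map_id; apply/eq_in_map => z zs /=.
  by have /codomP[t ->] : z \in codom iota by [apply: sA; rewrite inE]; rewrite kappaK.
have gE s : g (map iota s) = f s.
  rewrite /g (_ : A _); last by apply/subsetP => z; rewrite inE => /mapP[t _ ->]; apply: codom_f.
  by rewrite -map_comp (eq_map (g := id)) ?map_id // => t /=; rewrite kappaK.
have gform : top_form [set~ a] (iota x) g.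
  split; first exact: (alternating_if A (alternating_map kappa af)).
    move=> s gs; have sA : A [set t in s] by apply: contraNT gs => /negPf; rewrite /g => ->.
    move: gs; rewrite (mapK s sA); move: (map kappa s) => u; rewrite gE => fu.
    have [_ bu] := form_support ff fu; rewrite set_map.
    rewrite -(deletion_basis lmP ha iota_le iota_im) bu; split=> //.
    have Tx := basis_atoms (deletion_matroidal lmP ha iota_le iota_im) bu.
    have := deletion_image_sub_neq lmP ha iota_le iota_im Tx.
    by rewrite subsetD1 => /andP[_ na]; apply/subsetP => z zi; rewrite !inE; apply: contraNneq na => <-.
  move=> s; rewrite subsetI => /andP[sa sx].
  have sA : A [set t in s].
    apply/subsetP => z zs; have zA : z \in atoms P.
      by move: (subsetP sx z zs); rewrite inE => /andP[].
    have za : z != a by have := subsetP sa z zs; rewrite !inE.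
    have [t <-] := deletion_atom_image lmP iota_im zA za.
    exact: codom_f.
  rewrite (mapK s sA) coboundary_map /coboundary (eq_wedge _ _ gE).
  apply: (form_cocycle ff); rewrite setTI (deletion_image_sub lmP iota_le iota_im).
  by rewrite -set_map -mapK.
have [f' [f'form f'E]] := deletion_form_extension lmP ha gform.
exists f'; split=> // s sA; rewrite f'E ?gE //.
apply/negP => /mapP[t ts at_]; have tA : t \in atoms F by apply: (subsetP sA); rewrite inE.
have := deletion_atom_neq lmP ha iota_le iota_im (x := t).
by rewrite -at_ eqxx => /(_ _)/negP; apply => //; move: tA; rewrite inE => /eqP.
Qed.

End DeletionForms.

Section ContractionForms.
Variables (d d' : Order.disp_t) (P : finPOrderType d) (F : finPOrderType d').
Hypothesis lmP : locally_matroidal P.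
Variables (a : P) (ha : a \in atoms P) (iota : F -> P).
Hypothesis iota_le : forall x y, (x <= y)%O = (iota x <= iota y)%O.
Hypothesis iota_im : forall z, (exists x, iota x = z) <-> (a <= z)%O.
Variables (kappa : P -> F) (kappaK : cancel iota kappa).
Implicit Types (x y : F) (z w : P).

Let lmF := contraction_matroidal lmP ha iota_le iota_im.

(** The atom of the contraction spanned by an atom [z] other than [a], below a
fixed element: outside of a principal ideal the join of [a] and [z] is not
unique. *)
Definition line x z : F := kappa (join_below (iota x) [set a; z]).

Definition line_form x (f : seq F -> rat) s : rat :=
  if [set z in s] \subset atoms_below (iota x) :\ a then f (map (line x) s) else 0.

Lemma lineP x z : z \in atoms_below (iota x) :\ a ->
  line x z \in atoms_below x /\ iota (line x z) = join_below (iota x) [set a; z].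
Proof.
rewrite in_setD1 => /andP[za zx].
have [t tx tE] := contraction_line lmP ha iota_le iota_im zx za.
by rewrite /line -tE kappaK.
Qed.

(** One atom on each line of a basis in the contraction gives, together with [a],
a basis in the original poset. *)
Lemma line_form_support x f s : top_form [set: F] x f -> line_form x f s != 0 ->
  a \notin s /\ basis (iota x) (a |: [set z in s]).
Proof.
move=> ff; rewrite /line_form; case: ifP => [sx|]; last by rewrite eqxx.
move=> fs; have [_ bs] := form_support ff fs; have us := form_uniq ff fs.
have nas : a \notin s by move: sx; rewrite subsetD1 inE => /andP[].
have sx' : [set z in s] \subset atoms_below (iota x) by apply: subset_trans sx (subsetDl _ _).
have ax := contraction_atom ha iota_im x.
have asx : a |: [set z in s] \subset atoms_below (iota x) by rewrite subUset sub1set ax.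
split=> //; apply: (basisE lmP asx).
  rewrite -(contraction_rank lmP ha iota_le iota_im) (basis_card bs) card_setU1_seq //.
    by rewrite cardsE (card_uniqP us) size_map.
  exact: map_uniq us.
have /iota_im[j jE] : (a <= join_below (iota x) (a |: [set z in s]))%O.
  by apply: join_below_ub => //; apply: setU11.
rewrite -jE (_ : j = x) //; apply: (in_SP_min lmF (proj1 (andP bs))).
  by rewrite iota_le jE join_below_le.
move=> t; rewrite inE => /mapP[z zs ->].
have zx : z \in atoms_below (iota x) :\ a by apply: (subsetP sx); rewrite inE.
have [_ lE] := lineP zx; rewrite iota_le lE jE; apply: join_below_sub => //.
by apply: setUS; rewrite sub1set inE.
Qed.

Lemma line_form_alternating x f : top_form [set: F] x f -> alternating (line_form x f).
Proof.
move=> ff; apply: (alternating_if (fun S => S \subset atoms_below (iota x) :\ a)).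
exact: alternating_map (form_alternating ff).
Qed.

Lemma contraction_pullback_form x f : top_form [set: F] x f ->
  top_form [set: P] (iota x) (dual_wedge a (line_form x f)).
Proof.
move=> ff; have ag := line_form_alternating ff.
have -> : dual_wedge a (line_form x f) = (fun s => 0 + dual_wedge a (line_form x f) s).
  by apply/funext => s; rewrite add0r.
apply: (glue_form (f0 := fun=> 0)).
- exact: alternating0.
- exact: ag.
- by move=> s; rewrite eqxx.
- by move=> s; apply: line_form_support.
- by move=> s _ _; rewrite /coboundary wedge0.
move=> s sx nas; have sD : [set z in s] \subset atoms_below (iota x) :\ a.
  by rewrite subsetD1 sx inE.
rewrite /coboundary (@eq_wedge_in _ _ (mem (atoms_below (iota x) :\ a)) _ _
  (fun u => f (map (line x) u))); last 2 first.
- by rewrite all_set.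
- by move=> u; rewrite all_set => ux _; rewrite /line_form ux.
rewrite -/(coboundary _ s) -coboundary_map; apply: (form_cocycle ff).
rewrite setTI; apply/subsetP => t; rewrite inE => /mapP[z zs ->].
by case: (@lineP x z) => //; apply: (subsetP sD); rewrite inE.
Qed.

(** Closedness at [a :: z :: w :: s], where the first three entries lie on one
line, has two nonzero terms: the removal of [a] leaves a sequence without [a],
and the removal of an entry of [s] leaves three dependent atoms. *)
Lemma form_line_invariant x f : top_form [set: P] (iota x) f ->
    (forall s, a \notin s -> f s = 0) ->
  forall z w s, z \in atoms_below (iota x) :\ a -> w \in atoms_below (iota x) :\ a ->
    join_below (iota x) [set a; z] = join_below (iota x) [set a; w] ->
    [set t in s] \subset atoms_below (iota x) :\ a ->
  f (a :: z :: s) = f (a :: w :: s).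
Proof.
move=> ff f0 z w s zx wx zw sx; have [->//|nzw] := eqVneq z w.
have [za zx'] : z != a /\ z \in atoms_below (iota x) by move: zx; rewrite in_setD1 => /andP[].
have [wa wx'] : w != a /\ w \in atoms_below (iota x) by move: wx; rewrite in_setD1 => /andP[].
have ax := contraction_atom ha iota_im x.
have [sx' nas] : [set t in s] \subset atoms_below (iota x) /\ a \notin s.
  by move: sx; rewrite subsetD1 inE => /andP[].
have sub : [set t in a :: z :: w :: s] \subset atoms_below (iota x).
  by rewrite !set_cons !subUset !sub1set ax zx' wx'.
have := form_cocycle ff (s := a :: z :: w :: s); rewrite setTI => /(_ sub).
have triple u : f (a :: z :: w :: u) = 0.
  apply/eqP/negPn/negP => fu; have [_ bu] := form_support ff fu.
  have sub3 : [set a; z; w] \subset [set t in a :: z :: w :: u].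
    by rewrite !set_cons !subUset !sub1set !inE !eqxx !orbT.
  have := basis_card (basis_sub lmP bu sub3).
  have azx : [set a; z] \subset atoms_below (iota x) by rewrite subUset !sub1set ax.
  have awx : [set a; w] \subset atoms_below (iota x) by rewrite subUset !sub1set ax.
  have azwx : [set a; z; w] \subset atoms_below (iota x) by rewrite subUset azx sub1set.
  have -> : join_below (iota x) [set a; z; w] = join_below (iota x) [set a; z].
    apply: le_anti; apply/andP; split; last by apply: join_below_sub; rewrite ?subsetUl.
    apply: join_below_min => // [|t]; first exact: join_below_le.
    rewrite in_setU in_set1 in_set2 orbC => /orP[/eqP ->|/orP[/eqP ->|/eqP ->]].
    + by rewrite zw join_below_ub ?set22.
    + by rewrite join_below_ub ?set21.
    + by rewrite join_below_ub ?set22.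
  rewrite (rank_line lmP) // 1?eq_sym //.
  rewrite [[set a; z; w]]setUC cardsU1 cards2 !inE (negPf wa) [w == z]eq_sym (negPf nzw).
  by rewrite [a == z]eq_sym za.
rewrite /coboundary /= !mul1r f0 ?sub0r; last first.
  by rewrite !inE !negb_or [a == z]eq_sym za [a == w]eq_sym wa.
rewrite (@eq_wedge _ _ _ _ (fun=> 0)) // wedge0 subr0 opprB => /eqP.
by rewrite subr_eq0 => /eqP.
Qed.

(** Such a form is [a /\ g] with [g s] the value at [a :: s].  By the invariance
along the lines through [a], [g] can be read on lines, evaluated at any atom
chosen on each of them. *)
Lemma contraction_form_pullback z f : top_form [set: P] z f ->
    (forall s, a \notin s -> f s = 0) ->
  (forall s, f s = 0) \/ exists x g, [/\ iota x = z, top_form [set: F] x g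
    & forall s, f s = dual_wedge a (line_form x g) s].
Proof.
move=> ff f0; have [az|naz] := boolP (a <= z)%O; last first.
  left=> s; apply/eqP/negPn/negP => fs.
  have sa : a \in s by apply: contraNT fs => /f0 ->.
  have [_ /(basis_atoms lmP) sz] := form_support ff fs.
  case/negP: naz; have /(subsetP sz) : a \in [set t in s] by rewrite inE.
  by rewrite inE => /andP[].
right; have /iota_im[x xz] := az; rewrite -xz in ff * => {z az xz}.
have af := form_alternating ff; have ax := contraction_atom ha iota_im x.
have [lift liftP] := contraction_lifting lmP ha iota_le iota_im.
have liftA t : t \in atoms_below x -> _ := liftP x t.
have lineK t : t \in atoms_below x -> line x (lift t) = t.
  by move=> tx; have [_ E] := liftA t tx; rewrite /line -E kappaK.
pose A (S : {set F}) := S \subset atoms_below x.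
pose g u := if A [set t in u] then f (a :: map lift u) else 0.
have lift_sub u : A [set t in u] -> [set z in map lift u] \subset atoms_below (iota x) :\ a.
  move=> uA; apply/subsetP => z; rewrite inE => /mapP[t tu ->].
  by case: (liftA t) => //; apply: (subsetP uA); rewrite inE.
exists x, g; split=> //.
  split; first exact: (alternating_if A (alternating_map lift (alternating_cons a af))).
    move=> u; rewrite /g; case: ifP => [uA fu|]; last by rewrite eqxx.
    rewrite subsetT; split=> //; have [_ bu] := form_support ff fu.
    have := form_uniq ff fu; rewrite cons_uniq => /andP[nau uu].
    apply: (basisE lmF uA); first apply/eqP.
      rewrite -eqSS (contraction_rank lmP ha iota_le iota_im) (basis_card bu).
      by rewrite set_cons card_setU1_seq // cardsE (card_uniqP (map_uniq uu)) size_map.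
    suff -> : join_below x [set t in u] = x by [].
    apply: (embedding_inj iota_le); apply: (in_SP_min lmP (proj1 (andP bu))).
      by rewrite -iota_le (join_below_le lmF).
    have aj := contraction_ge iota_im (join_below x [set t in u]).
    move=> z; rewrite inE in_cons => /orP[/eqP -> //|/mapP[t tu ->]].
    have tin : t \in [set t in u] by rewrite inE.
    have tx := subsetP uA t tin; have [lx tE] := liftA t tx.
    apply: le_trans (_ : (iota t <= _)%O); last by rewrite -iota_le (join_below_ub lmF).
    have lx' : lift t \in atoms_below (iota x) by move: lx; rewrite in_setD1 => /andP[].
    by rewrite tE join_below_ub ?set22 // subUset !sub1set ax.
  move=> u; rewrite setTI => ux.
  rewrite /coboundary (@eq_wedge_in _ _ (mem (atoms_below x)) _ _ (fun u => f (a :: map lift u))).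
  - have lu := lift_sub u ux; have nau : a \notin map lift u.
      by move: lu; rewrite subsetD1 inE => /andP[].
    rewrite -/(coboundary _ u) -(coboundary_map lift (fun u => f (a :: u))).
    rewrite coboundary_homotopy f0 // (form_cocycle ff) ?subrr // setTI set_cons.
    by rewrite subUset sub1set ax (subset_trans lu) // subsetDl.
  - by rewrite all_set.
  - by move=> v; rewrite all_set => vx _; rewrite /g /A vx.
have invariant u v : [set t in v] \subset atoms_below (iota x) :\ a ->
    [set t in u] \subset atoms_below (iota x) :\ a ->
  f (a :: v ++ u) = f (a :: v ++ map (fun z => lift (line x z)) u).
  elim: u v => [|z u IH] v vx //= ; rewrite set_cons subUset sub1set => /andP[zx ux].
  have [lzx lzE] := lineP zx; have [llx llE] := liftA _ lzx.
  have ax' : alternating (fun s => f (a :: s)) := alternating_cons a af.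
  rewrite (alternating_to_front v z u ax').
  rewrite (form_line_invariant ff f0 zx llx) -?llE -?lzE //; last first.
    by rewrite set_cat subUset vx.
  rewrite -(alternating_to_front v (lift (line x z)) u ax') -cat_rcons.
  rewrite (IH (rcons v (lift (line x z)))) ?cat_rcons // -cats1 set_cat subUset vx.
  by apply/subsetP => t; rewrite in_set mem_seq1 => /eqP ->.
move=> s; apply/eqP; rewrite -subr_eq0; apply/eqP.
have gA := alternating_if A (alternating_map lift (alternating_cons a af)).
have lA : alternating (line_form x g).
  exact: (alternating_if (fun S => S \subset atoms_below (iota x) :\ a) (alternating_map (line x) gA)).
have dA := alternating_wedge (fun t => (t == a)%:R) lA.
apply: (alternating_eq0_pivot (a := a) (D := predT)
  (h := fun s => f s - dual_wedge a (line_form x g) s)).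
- exact: (alternatingD af (alternatingN dA)).
- by move=> u _ nau; rewrite f0 // dual_wedge_notin // subrr.
- move=> u _ nau; rewrite dual_wedge_uniq // /line_form; case: ifP => ux; last first.
    rewrite subr0; apply/eqP/negPn/negP => fu; move/negP: ux; apply.
    have [_ /(basis_atoms lmP)] := form_support ff fu; rewrite set_cons subUset => /andP[_ sub].
    by rewrite subsetD1 sub inE.
  rewrite /g (_ : A _); last first.
    apply/subsetP => t; rewrite inE => /mapP[z zu ->].
    by case: (@lineP x z) => //; apply: (subsetP ux); rewrite inE.
  rewrite -map_comp -(invariant u [::]) ?subrr //.
  by apply/subsetP => t; rewrite inE.
- exact/allP.
Qed.

End ContractionForms.

(** * Linear maps out of an Orlik-Solomon algebra *)

Section BundledLinear.
Variables (U V : lmodType rat) (phi : U -> V).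
Definition bundled_linear of linear phi := phi.
Variable phi_linear : linear phi.
HB.instance Definition _ :=
  GRing.isLinear.Build rat U V *:%R (bundled_linear phi_linear) phi_linear.
Definition linear_bundle : {linear U -> V} := bundled_linear phi_linear.
End BundledLinear.

Lemma linear_extension (U V : lmodType rat) (I : finType) (P : pred I)
    (G : I -> U) (v : I -> V) :
    (forall y, exists c : I -> rat, y = \sum_(i | P i) c i *: G i) ->
    (forall c : I -> rat, \sum_(i | P i) c i *: G i = 0 -> \sum_(i | P i) c i *: v i = 0) ->
  exists phi : {linear U -> V}, forall i, P i -> phi (G i) = v i.
Proof.
move=> /choice[c cE] rel0; pose phi y := \sum_(i | P i) c y i *: v i.
have phiE y e : y = \sum_(i | P i) e i *: G i -> phi y = \sum_(i | P i) e i *: v i.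
  move=> yE; apply/eqP; rewrite -subr_eq0 /phi -sumrB.
  under eq_bigr do rewrite -scalerBl.
  apply/eqP; apply: (rel0 (fun i => c y i - e i)).
  under eq_bigr do rewrite scalerBl.
  by rewrite sumrB -cE -yE subrr.
have phi_linear : linear phi.
  move=> k y z; rewrite (phiE _ (fun i => k * c y i + c z i)).
    rewrite /phi scaler_sumr -big_split; apply: eq_bigr => i _.
    by rewrite scalerDl scalerA.
  rewrite [in LHS](cE y) [in LHS](cE z) scaler_sumr -big_split; apply: eq_bigr => i _.
  by rewrite scalerDl scalerA.
have delta (W : lmodType rat) (H : I -> W) i : P i -> H i = \sum_(j | P j) (j == i)%:R *: H j.
  move=> Pi; rewrite (bigD1 i) //= eqxx scale1r big1 ?addr0 // => j /andP[_ /negPf ->].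
  by rewrite scale0r.
by exists (linear_bundle phi_linear) => i Pi; rewrite [LHS](phiE _ _ (delta U G i Pi)) -delta.
Qed.

Lemma spanned_multiplicative (A B : algType rat) (f : {linear A -> B}) (I : finType)
    (P : pred I) (G : I -> A) :
    (forall y, exists c : I -> rat, y = \sum_(i | P i) c i *: G i) ->
    (forall i j, P i -> P j -> f (G i * G j) = f (G i) * f (G j)) ->
  {morph f : u v / u * v}.
Proof.
move=> sp fM u v; have [[c ->] [e ->]] := (sp u, sp v).
rewrite mulr_suml !linear_sum mulr_suml; apply: eq_bigr => i Pi.
rewrite mulr_sumr linear_sum mulr_sumr; apply: eq_bigr => j Pj.
by rewrite -scalerAl -scalerAr !linearZ /= fM // -scalerAl -scalerAr.
Qed.

Section BundledLRMorphism.
Variables (A B : algType rat) (phi : {linear A -> B}).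
Definition bundled_lrmorphism of monoid_morphism phi : A -> B := phi.
Variable phi_monoid : monoid_morphism phi.
HB.instance Definition _ := GRing.Linear.on (bundled_lrmorphism phi_monoid).
HB.instance Definition _ :=
  GRing.isMonoidMorphism.Build A B (bundled_lrmorphism phi_monoid) phi_monoid.
Definition lrmorphism_bundle : {lrmorphism A -> B} := bundled_lrmorphism phi_monoid.
End BundledLRMorphism.

Section Combinations.
Variables (U V W : lmodType rat) (f : {linear U -> V}) (g : {linear V -> W}).
Variables (I : finType) (Q : pred I) (c : I -> rat).

Lemma linear_span_image (v : I -> V) :
  (forall k, Q k -> exists u, f u = v k) -> exists u, f u = \sum_(k | Q k) c k *: v k.
Proof.
move=> H; apply: (big_ind (fun x => exists u, f u = x)) => [|_ _ [u <-] [u' <-]|k Qk].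
- by exists 0; rewrite linear0.
- by exists (u + u'); rewrite linearD.
- by have [u <-] := H k Qk; exists (c k *: u); rewrite linearZ.
Qed.

Lemma linear_comp_span0 (u : I -> U) :
  (forall k, Q k -> g (f (u k)) = 0) -> g (f (\sum_(k | Q k) c k *: u k)) = 0.
Proof.
move=> H; rewrite !linear_sum big1 // => k Qk.
by rewrite !linearZ /= (H k Qk) scaler0.
Qed.

End Combinations.
Section FaceMaps.
Variables (d : Order.disp_t) (Q : finPOrderType d) (r : rel Q).
Hypothesis lmQ : locally_matroidal Q.
Hypothesis rlin : linear_order_on (atoms Q) r.
Local Notation M := (prescheme_of Q).
Local Notation top := face_top.
Local Notation at_ := face_atoms.
Local Notation inc := (increasing r).
Local Notation OSf := (OS_face r).
Local Notation ordf := (order_form rat (atoms Q) r).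
Implicit Types (x : Q) (al be : M) (s : seq Q) (c : M -> rat) (y z : OS_poset r).

Definition functional_of x f (phi : OS_poset r -> rat) : Prop :=
  scalar phi /\
  forall al, al \in indep M -> phi (OSf al) = if top al == x then f (inc (at_ al)) else 0.

Lemma functional_exists x f : top_form [set: Q] x f -> exists phi, functional_of x f phi.
Proof. by move=> ff; have [phi] := OS_functional lmQ rlin ff; exists phi. Qed.

Lemma functional_pairing x f phi c : functional_of x f phi ->
  phi (\sum_(al in indep M) c al *: OSf al) = face_pairing r c x f.
Proof.
case=> lphi phiE; rewrite (scalar_sum _ _ _ _ lphi) /face_pairing [RHS]big_mkcondr.
by apply: eq_bigr => al aI; rewrite phiE //; case: ifP => _; rewrite ?mulr0.
Qed.

Lemma functional_eq phi psi : scalar phi -> scalar psi ->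
  (forall al, al \in indep M -> phi (OSf al) = psi (OSf al)) -> phi =1 psi.
Proof.
move=> lphi lpsi E y; have [c ->] := OS_spanned lmQ rlin y.
rewrite (scalar_sum _ _ _ _ lphi) (scalar_sum _ _ _ _ lpsi).
by apply: eq_bigr => al aI; rewrite E.
Qed.

Lemma separated_span (B : {set M}) y :
    (forall x f phi, top_form [set: Q] x f -> functional_of x f phi ->
      (forall be, be \in B -> be \in indep M -> top be = x -> f (inc (at_ be)) = 0) ->
      phi y = 0) ->
  exists e : M -> rat, y = \sum_(be in indep M | be \in B) e be *: OSf be.
Proof.
have [c ->] := OS_spanned lmQ rlin y => H.
apply: (separation lmQ rlin) => x f ff fB; have [phi phif] := functional_exists ff.
by rewrite -(functional_pairing c phif); apply: H fB.
Qed.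

Lemma separated_zero y :
    (forall x f phi, top_form [set: Q] x f -> functional_of x f phi -> phi y = 0) ->
  y = 0.
Proof.
move=> H; have [x f phi ff phif _|e ->] := @separated_span set0 y; first exact: H phif.
by rewrite big1 // => be /andP[_]; rewrite inE.
Qed.

Lemma linear_from_faces (V : lmodType rat) (v : M -> V) :
    (forall c, \sum_(al in indep M) c al *: OSf al = 0 ->
      \sum_(al in indep M) c al *: v al = 0) ->
  exists phi : {linear OS_poset r -> V}, forall al, al \in indep M -> phi (OSf al) = v al.
Proof. exact: linear_extension (OS_spanned lmQ rlin). Qed.

(** The product of the atoms of [s] in the component at [x]; it is zero unless
they form a basis of [x]. *)
Definition monomial x s : OS_poset r :=
  \sum_(al in indep M | (top al == x) && (at_ al == [set t in s])) ordf s *: OSf al.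

(** Both sides are alternating in [s], and they agree on sorted faces. *)
Lemma functional_monomial x (y : Q) f phi s : top_form [set: Q] y f -> functional_of y f phi ->
  phi (monomial x s) = if x == y then f s else 0.
Proof.
move=> ff [lphi phiE]; rewrite (scalar_sum _ _ _ _ lphi).
have [xy|nxy] := eqVneq x y; last first.
  rewrite big1 // => al /and3P[aI /eqP ax _]; rewrite phiE // ax (negPf nxy) mulr0 //.
have [/existsP[al /and3P[aI /eqP ax /eqP a_s]]|/existsPn none] := boolP
  [exists al, [&& al \in indep M, top al == x & at_ al == [set t in s]]]; last first.
  rewrite big_pred0 => [|al]; last by apply/negbTE/none.
  apply/esym/eqP/negPn/negP => fs; have [_ bs] := form_support ff fs.
  have [al [ax a_s]] := faceP (proj1 (andP bs)).
  by have := none al; rewrite face_indepE ax a_s xy bs !eqxx.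
rewrite (big_pred1 al) => [|be /=]; last first.
  apply/idP/eqP => [/and3P[_ /eqP bx /eqP bs]|->]; last by rewrite aI ax a_s !eqxx.
  by apply: face_eq; rewrite ?ax ?a_s.
rewrite phiE // ax xy eqxx a_s; have sA : [set t in s] \subset atoms Q.
  by rewrite -a_s face_atomsA.
have [us|nus] := boolP (uniq s).
  by rewrite -(alternating_increasing rlin (form_alternating ff)).
by rewrite /order_form (negPf nus) mul0r (alternating_eq0 (form_alternating ff)).
Qed.

Lemma monomial_face al s : al \in indep M -> [set t in s] = at_ al ->
  monomial (top al) s = ordf s *: OSf al.
Proof.
move=> aI sE; rewrite /monomial (big_pred1 al) // => be /=.
apply/idP/eqP => [/and3P[_ /eqP bx /eqP bs]|->]; last by rewrite aI sE !eqxx.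
by apply: face_eq; rewrite ?bs.
Qed.

Lemma order_form_sqr s : uniq s -> [set t in s] \subset atoms Q -> ordf s * ordf s = 1.
Proof.
move=> us sA; have := alternating_sort r s (order_form_alternating rat rlin).
rewrite (sort_increasing rlin us sA) order_form_increasing // mulr1 => ->.
exact: sort_sign_sqr.
Qed.

End FaceMaps.

(** * The map from the algebra of the deletion *)

Section DeletionMap.
Variables (d d1 : Order.disp_t) (P : finPOrderType d) (F : finPOrderType d1).
Hypothesis lmP : locally_matroidal P.
Variables (a : P) (ha : a \in atoms P) (iota : F -> P).
Hypothesis iota_le : forall x y, (x <= y)%O = (iota x <= iota y)%O.
Hypothesis iota_im : forall z, (exists x, iota x = z) <-> in_SP (z, atoms_below z :\ a).
Variable r : rel P.
Hypothesis rlin : linear_order_on (atoms P) r.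
Let rF : rel F := relpre iota r.

Let lmF := deletion_matroidal lmP ha iota_le iota_im.
Local Notation MP := (prescheme_of P).
Local Notation MF := (prescheme_of F).
Local Notation top := face_top.
Local Notation at_ := face_atoms.

Let iota_inj : injective iota := embedding_inj iota_le.

Let iota_atoms t : t \in atoms F -> iota t \in atoms P.
Proof. by rewrite !inE (deletion_rank lmP iota_le iota_im). Qed.

Lemma deletion_order_linear : linear_order_on (atoms F) rF.
Proof.
have [anti trans tot] := rlin; split.
- by move=> x y xA yA; rewrite /rF /= => /anti/iota_inj; apply; apply: iota_atoms.
- by move=> x y z xA yA zA; apply: trans; apply: iota_atoms.
- by move=> x y xA yA; apply: tot; apply: iota_atoms.
Qed.
Let rFlin := deletion_order_linear.

Lemma increasing_iota (T : {set F}) : T \subset atoms F ->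
  map iota (increasing rF T) = increasing r (iota @: T).
Proof.
move=> TA; rewrite /increasing /rF -sort_map.
apply: (sort_increasing_set rlin).
- by rewrite map_inj_uniq ?enum_uniq.
- by rewrite set_map set_enum.
- by apply/subsetP => z /imsetP[t tT ->]; apply: iota_atoms; apply: (subsetP TA).
Qed.

Lemma order_form_iota s : [set t in s] \subset atoms F ->
  order_form rat (atoms P) r (map iota s) = order_form rat (atoms F) rF s.
Proof.
move=> sA; rewrite /order_form map_inj_uniq //.
have -> : all (mem (atoms P)) (map iota s).
  by apply/allP => z /mapP[t ts ->]; apply: iota_atoms; apply: (subsetP sA); rewrite inE.
have -> : all (mem (atoms F)) s by rewrite all_set.
case: (uniq s) => //=; elim: s {sA} => //= t s ->; congr (_ ^+ _ * _).
by rewrite count_map; apply: eq_count.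
Qed.

Variable lift_face : MF -> MP.
Hypothesis lift_top : forall al, top (lift_face al) = iota (top al).
Hypothesis lift_atoms : forall al, at_ (lift_face al) = iota @: at_ al.

Lemma lift_face_inj : injective lift_face.
Proof.
move=> al be E; apply: face_eq.
  by apply: iota_inj; rewrite -!lift_top E.
by apply: (imset_inj iota_inj); rewrite -!lift_atoms E.
Qed.

Lemma lift_face_indep al : (lift_face al \in indep MP) = (al \in indep MF).
Proof.
by rewrite !face_indepE lift_top lift_atoms (deletion_basis lmP ha iota_le iota_im).
Qed.

Lemma lift_face_surj be : be \in indep MP -> a \notin at_ be ->
  exists2 al, al \in indep MF & lift_face al = be.
Proof.
rewrite face_indepE => bb nab.
have [x [T [xE TE bT]]] := deletion_basis_image lmP ha iota_le iota_im nab bb.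
have [al [ax aT]] := faceP (proj1 (andP bT)).
exists al; first by rewrite face_indepE ax aT.
by apply: face_eq; rewrite ?lift_top ?lift_atoms ?ax ?aT.
Qed.

Lemma lift_face_notin al : a \notin at_ (lift_face al).
Proof.
rewrite lift_atoms; apply/negP => /imsetP[t ta aE].
have tA : t \in atoms F by apply: (subsetP (face_atomsA lmF al)).
have := deletion_atom_neq lmP ha iota_le iota_im (x := t).
by rewrite -aE eqxx => /(_ _)/negP; apply => //; move: tA; rewrite inE => /eqP.
Qed.

Lemma lift_face_increasing al :
  increasing r (at_ (lift_face al)) = map iota (increasing rF (at_ al)).
Proof. by rewrite lift_atoms increasing_iota // face_atomsA. Qed.

Lemma lift_face_bottom al : (lift_face al \in bottoms MP) = (al \in bottoms MF).
Proof.
apply/(face_bottomsP lmP)/(face_bottomsP lmF); rewrite lift_atoms => E.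
  by apply/eqP; rewrite -(imset_eq0 iota) E.
by rewrite E imset0.
Qed.

Lemma lift_face_joins al be : al \in indep MF -> be \in indep MF ->
  joins [set lift_face al; lift_face be] :&: indep MP =
  lift_face @: (joins [set al; be] :&: indep MF).
Proof.
move=> aI bI; apply/setP => ga; apply/setIP/imsetP => [[gJ gI]|[de]].
  move: gJ; rewrite (face_joinsE lmP) => /and3P[ag bg /eqP gE].
  have nag : a \notin at_ ga by rewrite gE in_setU negb_or !lift_face_notin.
  have [de dI dE] := lift_face_surj gI nag; exists de => //.
  rewrite inE dI andbT (face_joinsE lmF); move: ag bg gE; rewrite -dE !lift_top !lift_atoms.
  by rewrite -imsetU -!iota_le => -> -> /(imset_inj iota_inj) ->; rewrite eqxx.
rewrite inE (face_joinsE lmF) => /andP[/and3P[ad bd /eqP dE] dI] ->.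
rewrite lift_face_indep dI (face_joinsE lmP) !lift_top !lift_atoms dE imsetU eqxx.
by rewrite -!iota_le ad bd.
Qed.

Local Notation A1 := (OS_poset rF).
Local Notation A := (OS_poset r).

(** The restriction of a form to the deletion is a form, hence defines a functional
on the algebra of the deletion. *)
Lemma lift_functional z f phi : top_form [set: P] z f -> functional_of z f phi ->
  forall c : MF -> rat, \sum_(al in indep MF) c al *: OS_face rF al = 0 ->
  phi (\sum_(al in indep MF) c al *: OS_face r (lift_face al)) = 0.
Proof.
move=> ff [lphi phiE] c c0; rewrite (scalar_sum _ _ _ _ lphi).
have [/existsP[x /eqP xz]|/existsPn nz] := boolP [exists x, iota x == z]; last first.
  rewrite big1 // => al aI; rewrite phiE ?lift_face_indep // lift_top.
  by rewrite (negPf (nz _)) mulr0.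
rewrite -xz in ff phiE.
have ff' := deletion_restrict_form lmP ha iota_le iota_im ff.
have [psi [lpsi psiE]] := functional_exists lmF rFlin ff'.
have psi0 := scalar0 lpsi.
rewrite -[RHS]psi0 -c0 (scalar_sum _ _ _ _ lpsi); apply: eq_bigr => al aI.
rewrite psiE // phiE ?lift_face_indep // lift_top (inj_eq iota_inj).
by rewrite lift_face_increasing.
Qed.

Lemma deletion_linear_map : exists i : {linear A1 -> A},
  forall al, al \in indep MF -> i (OS_face rF al) = OS_face r (lift_face al).
Proof.
apply: (linear_from_faces lmF rFlin) => c c0.
by apply: (separated_zero lmP rlin) => z f phi ff phif; apply: (lift_functional ff phif).
Qed.

Lemma deletion_map_multiplicative (i : {linear A1 -> A}) :
    (forall al, al \in indep MF -> i (OS_face rF al) = OS_face r (lift_face al)) ->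
  monoid_morphism i.
Proof.
move=> iE; split.
  have /set0Pn[b bb] := face_bottoms_neq0 lmF.
  have bI := bottom_indep lmF bb.
  by rewrite -(OS_face_bottom rF bb) iE // OS_face_bottom ?lift_face_bottom.
have faceM al be : al \in indep MF -> be \in indep MF ->
    i (OS_face rF al * OS_face rF be) = i (OS_face rF al) * i (OS_face rF be).
  move=> aI bI; rewrite (iE al aI) (iE be bI) (OS_face_mul lmF rFlin aI bI).
  rewrite (OS_face_mul lmP rlin) ?lift_face_indep // !lift_face_increasing -map_cat.
  rewrite order_form_iota; last by rewrite set_cat !set_increasing subUset !face_atomsA.
  rewrite lift_face_joins // linearZ linear_sum /=; congr (_ *: _).
  rewrite big_imset /=; last by move=> ? ? _ _; apply: lift_face_inj.
  by apply: eq_bigr => ga; rewrite inE => /andP[_ gI]; apply: iE.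
exact: (spanned_multiplicative (OS_spanned lmF rFlin) faceM).
Qed.

(** Forms of the deletion extend, so the functionals that they define factor
through [i]; these functionals separate the elements of the algebra. *)
Lemma deletion_map_injective (i : {linear A1 -> A}) :
    (forall al, al \in indep MF -> i (OS_face rF al) = OS_face r (lift_face al)) ->
  injective i.
Proof.
move=> iE; apply: raddf_inj => y iy0; apply: (separated_zero lmF rFlin) => x f phi ff [lphi phiE].
have [g [gform gE]] := deletion_extend_form lmP ha iota_le iota_im ff.
have [psi [lpsi psiE]] := functional_exists lmP rlin gform.
have lpsii : scalar (psi \o i) by move=> k u v; rewrite /= linearP lpsi.
have E : phi =1 psi \o i.
  apply: (functional_eq lmF rFlin lphi lpsii) => al aI.
  rewrite phiE // /= iE // psiE ?lift_face_indep // lift_top (inj_eq iota_inj).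
  case: ifP => // _; rewrite lift_face_increasing gE //.
  by rewrite set_increasing face_atomsA.
rewrite E /= iy0.
exact: scalar0 lpsi.
Qed.

End DeletionMap.

(** * The residue map to the algebra of the contraction *)

Section ContractionMap.
Variables (d d2 : Order.disp_t) (P : finPOrderType d) (C : finPOrderType d2).
Hypothesis lmP : locally_matroidal P.
Variables (a : P) (ha : a \in atoms P) (jota : C -> P).
Hypothesis jota_le : forall x y, (x <= y)%O = (jota x <= jota y)%O.
Hypothesis jota_im : forall z, (exists x, jota x = z) <-> (a <= z)%O.
Variables (kappa : P -> C) (kappaK : cancel jota kappa).
Variables (r : rel P) (rC : rel C).
Hypothesis rlin : linear_order_on (atoms P) r.
Hypothesis rClin : linear_order_on (atoms C) rC.

Let lmC := contraction_matroidal lmP ha jota_le jota_im.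
Local Notation MP := (prescheme_of P).
Local Notation MC := (prescheme_of C).
Local Notation top := face_top.
Local Notation at_ := face_atoms.
Local Notation inc := (increasing r).
Local Notation ordP := (order_form rat (atoms P) r).
Local Notation ordC := (order_form rat (atoms C) rC).
Local Notation ln := (line a jota kappa).
Local Notation pullback x f := (dual_wedge a (line_form a jota kappa x f)).
Local Notation A := (OS_poset r).
Local Notation A2 := (OS_poset rC).
Implicit Types (x : C) (al : MP) (be : MC).

(** The residue along [a]: the atom [a] is moved to the front and removed, and
every other atom is replaced by the line that it spans with [a]. *)
Definition residue al : A2 :=
  if a \in at_ al then
    ordP (a :: inc (at_ al :\ a)) *:
      monomial rC (kappa (top al)) (map (ln (kappa (top al))) (inc (at_ al :\ a)))
  else 0.

Lemma set_pivot al : a \in at_ al -> [set t in a :: inc (at_ al :\ a)] = at_ al.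
Proof. by move=> aa; rewrite set_cons set_increasing setD1K. Qed.

Lemma uniq_pivot al : uniq (a :: inc (at_ al :\ a)).
Proof. by rewrite cons_uniq increasing_uniq mem_increasing !inE eqxx. Qed.

Lemma pullback_residue x f al : top_form [set: C] x f -> top al = jota x ->
  pullback x f (inc (at_ al)) = if a \in at_ al
    then ordP (a :: inc (at_ al :\ a)) * f (map (ln x) (inc (at_ al :\ a))) else 0.
Proof.
move=> ff ax; case: ifP => [aa|na]; last first.
  by apply: dual_wedge_notin; rewrite mem_increasing na.
have pf := contraction_pullback_form lmP ha jota_le jota_im kappaK ff.
have sA : [set t in a :: inc (at_ al :\ a)] \subset atoms P.
  by rewrite set_pivot // face_atomsA.
have E := alternating_increasing rlin (form_alternating pf) (uniq_pivot al) sA.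
rewrite set_pivot // in E.
have nas : a \notin inc (at_ al :\ a) by rewrite mem_increasing !inE eqxx.
have -> : f (map (ln x) (inc (at_ al :\ a))) = pullback x f (a :: inc (at_ al :\ a)).
  rewrite dual_wedge_uniq // /line_form set_increasing.
  by rewrite setSD // -ax face_atoms_below.
by rewrite E mulrA (order_form_sqr rlin (uniq_pivot al) sA) mul1r.
Qed.

(** The residue is the transpose of the pullback of forms. *)
Lemma functional_residue x f (phi : A2 -> rat) (psi : A -> rat) :
    top_form [set: C] x f -> functional_of x f phi ->
    functional_of (jota x) (pullback x f) psi ->
  forall al, al \in indep MP -> phi (residue al) = psi (OS_face r al).
Proof.
move=> ff phif [_ psiE] al aI; have [lphi _] := phif.
have phi0 := scalar0 lphi.
rewrite psiE // /residue; case: (boolP (a \in at_ al)) => aa; last first.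
  rewrite phi0; case: eqP => // ax.
  by rewrite (pullback_residue ff ax) (negPf aa).
have /jota_im[y ya] : (a <= top al)%O.
  by have := subsetP (face_atoms_below lmP al) a aa; rewrite inE => /andP[].
have phiZ k u : phi (k *: u) = k * phi u.
  by have := lphi k u 0; rewrite !addr0 phi0 addr0.
rewrite phiZ (functional_monomial lmC rClin _ _ ff phif) // -ya kappaK.
rewrite (inj_eq (embedding_inj jota_le)); case: eqP => [yx|_]; last by rewrite mulr0.
by rewrite (pullback_residue (x := x) ff) ?aa -?ya yx.
Qed.

(** A linear relation between faces is respected because the functionals of the
contraction pull back to functionals of the algebra. *)
Lemma contraction_linear_map : exists p : {linear A -> A2},
  forall al, al \in indep MP -> p (OS_face r al) = residue al.
Proof.
apply: (linear_from_faces lmP rlin) => c c0.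
apply: (separated_zero lmC rClin) => x f phi ff phif; have [lphi _] := phif.
have pf := contraction_pullback_form lmP ha jota_le jota_im kappaK ff.
have [psi psif] := functional_exists lmP rlin pf; have [lpsi _] := psif.
have psi0 := scalar0 lpsi.
rewrite -[RHS]psi0 -c0 (scalar_sum _ _ _ _ lphi) (scalar_sum _ _ _ _ lpsi).
by apply: eq_bigr => al aI; rewrite (functional_residue ff phif psif).
Qed.

Variable p : {linear A -> A2}.
Hypothesis pE : forall al, al \in indep MP -> p (OS_face r al) = residue al.

Lemma contraction_map_adjoint x f (phi : A2 -> rat) (psi : A -> rat) :
    top_form [set: C] x f -> functional_of x f phi ->
    functional_of (jota x) (pullback x f) psi ->
  forall y, phi (p y) = psi y.
Proof.
move=> ff phif psif; have [[lphi _] [lpsi _]] := (phif, psif).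
have lphip : scalar (phi \o p) by move=> k u v; rewrite /= linearP lphi.
apply: (functional_eq lmP rlin lphip lpsi) => al aI.
by rewrite /= pE // (functional_residue ff phif psif).
Qed.

(** One atom chosen on each line of [be] gives, together with [a], a face whose
residue is [be] up to sign. *)
Lemma contraction_face_image be : be \in indep MC -> exists y, p y = OS_face rC be.
Proof.
move=> bI; have bb : basis (top be) (at_ be) by rewrite -face_indepE.
have [lift liftP] := contraction_lifting lmP ha jota_le jota_im.
set x := top be; set S := lift @: at_ be.
have bx := basis_atoms lmC bb.
have liftA t : t \in at_ be -> lift t \in atoms_below (jota x) :\ a /\
    jota t = join_below (jota x) [set a; lift t].
  by move=> /(subsetP bx) tx; apply: liftP.
have lnK t : t \in at_ be -> ln x (lift t) = t.
  by move=> tb; have [_ E] := liftA t tb; rewrite /line -E kappaK.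
have lift_inj : {in at_ be &, injective lift}.
  by move=> t u tb ub tu; rewrite -(lnK t tb) -(lnK u ub) tu.
have Sx : S \subset atoms_below (jota x) :\ a.
  by apply/subsetP => z /imsetP[t tb ->]; case: (liftA t tb).
have naS : a \notin S by apply/negP => /(subsetP Sx); rewrite !inE eqxx.
have ax := contraction_atom ha jota_im x.
have aSx : a |: S \subset atoms_below (jota x).
  by rewrite subUset sub1set ax (subset_trans Sx) ?subsetDl.
have baS : basis (jota x) (a |: S).
  apply: (basisE lmP aSx).
    rewrite -(contraction_rank lmP ha jota_le jota_im) cardsU1 naS.
    by rewrite card_in_imset // (basis_card bb).
  have /jota_im[j jE] : (a <= join_below (jota x) (a |: S))%O.
    by apply: join_below_ub => //; apply: setU11.
  rewrite -jE (_ : j = x) //; apply: (in_SP_min lmC (proj1 (andP bb))).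
    by rewrite jota_le jE join_below_le.
  move=> t tb; have [_ tE] := liftA t tb; rewrite jota_le tE jE.
  by apply: join_below_sub => //; apply: setUS; rewrite sub1set imset_f.
have [al [ax' aE]] := faceP (proj1 (andP baS)).
have aI : al \in indep MP by rewrite face_indepE ax' aE.
have aD : at_ al :\ a = S by rewrite aE setU1K.
have aa : a \in at_ al by rewrite aE setU11.
set s := map (ln x) (inc S).
have sE : [set t in s] = at_ be.
  rewrite /s set_map set_increasing; apply/setP => t; apply/imsetP/idP.
    by case=> z /imsetP[u ub ->] ->; rewrite lnK.
  by move=> tb; exists (lift t); rewrite ?imset_f ?lnK.
have us : uniq s.
  rewrite map_inj_in_uniq ?increasing_uniq // => z w; rewrite !mem_increasing.
  by move=> /imsetP[t tb ->] /imsetP[u ub ->]; rewrite !lnK // => ->.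
have pal : p (OS_face r al) = (ordP (a :: inc S) * ordC s) *: OS_face rC be.
  rewrite pE // /residue aa ax' kappaK aD -scalerA; congr (_ *: _).
  exact: monomial_face.
have sAC : [set t in s] \subset atoms C by rewrite sE face_atomsA.
have usP : uniq (a :: inc S) by rewrite -aD uniq_pivot.
have sAP : [set t in a :: inc S] \subset atoms P.
  by rewrite -aD set_pivot // face_atomsA.
exists ((ordP (a :: inc S) * ordC s) *: OS_face r al).
rewrite linearZ /= pal scalerA mulrACA (order_form_sqr rlin usP sAP).
by rewrite (order_form_sqr rClin us sAC) mulr1 scale1r.
Qed.

Lemma contraction_map_surjective z : exists y, p y = z.
Proof.
have [c ->] := OS_spanned lmC rClin z.
by apply: linear_span_image => be; apply: contraction_face_image.
Qed.

(** By duality it is enough that [y] is killed by every form that vanishes on the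
faces avoiding [a].  Such a form is the pullback of a form of the contraction,
whose value at [y] is a value at [p y]. *)
Lemma contraction_map_kernel y : p y = 0 ->
  exists c : MP -> rat, y = \sum_(al in indep MP | a \notin at_ al) c al *: OS_face r al.
Proof.
move=> py0; have [|e eE] := @separated_span _ _ _ lmP rlin [set al | a \notin at_ al] y.
  move=> z f psi ff psif fB; have [lpsi psiE] := psif.
  have f0 s : a \notin s -> f s = 0.
    move=> nas; apply/eqP/negPn/negP => fs; have [_ bs] := form_support ff fs.
    have [al [az aE]] := faceP (proj1 (andP bs)).
    have us := form_uniq ff fs; case/eqP: fs.
    rewrite (alternating_increasing rlin (form_alternating ff)) -?aE.
    - by rewrite fB ?mulr0 ?face_indepE ?az ?aE // inE aE inE.
    - exact: us.
    - exact: face_atomsA.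
  have [fz|[x [g [xz gform gE]]]] := contraction_form_pullback lmP ha jota_le jota_im kappaK ff f0.
    have [c ->] := OS_spanned lmP rlin y; rewrite (functional_pairing c psif) /face_pairing.
    by rewrite big1 // => al _; rewrite fz mulr0.
  have [phi phif] := functional_exists lmC rClin gform; have [lphi _] := phif.
  have psif' : functional_of (jota x) (pullback x g) psi.
    by split=> // al aI; rewrite psiE // -xz gE.
  rewrite -(contraction_map_adjoint gform phif psif') py0.
  exact: scalar0 lphi.
by exists e; rewrite eE; apply: eq_bigl => al; rewrite inE.
Qed.

Lemma contraction_map_notin al : al \in indep MP -> a \notin at_ al -> p (OS_face r al) = 0.
Proof. by move=> aI na; rewrite pE // /residue (negPf na). Qed.

End ContractionMap.

(** * The exact sequence *)

Section Instances.
Variables (d : Order.disp_t) (P : finPOrderType d).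
Hypothesis lmP : locally_matroidal P.
Variables (a : P) (ha : a \in atoms P).
Local Notation F := (deletion_poset ha).
Local Notation C := (contraction_poset ha).

Lemma atom_face_le (y : prescheme_of P) : (atom_face ha <= y)%O = (a \in face_atoms y).
Proof.
rewrite face_le sub1set; case: (boolP (a \in face_atoms y)) => ay; last by rewrite andbF.
rewrite andbT; have := subsetP (face_atoms_below lmP y) a ay.
by rewrite inE => /andP[_].
Qed.

Definition deletion_top (x : F) : P := face_top (deletion_poset_val x).
Definition contraction_top (x : C) : P := face_top (val (val x)).

Let deletion_pred (y : prescheme_of P) :
  ~~ (atom_face ha <= y)%O = ((a \in face_atoms y) == false).
Proof. by rewrite atom_face_le eqbF_neg. Qed.

Let contraction_pred (y : prescheme_of P) :
  (atom_face ha <= y)%O = ((a \in face_atoms y) == true).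
Proof. by rewrite atom_face_le eqb_id. Qed.

Lemma deletion_top_le x y : (x <= y)%O = (deletion_top x <= deletion_top y)%O.
Proof. exact: (flat_le lmP deletion_pred). Qed.

Lemma deletion_top_image z :
  (exists x, deletion_top x = z) <-> in_SP (z, atoms_below z :\ a).
Proof. exact: (flat_top_deletion lmP deletion_pred). Qed.

Lemma contraction_top_le x y : (x <= y)%O = (contraction_top x <= contraction_top y)%O.
Proof. exact: (flat_le lmP contraction_pred). Qed.

Lemma contraction_top_image z : (exists x, contraction_top x = z) <-> (a <= z)%O.
Proof. exact: (flat_top_contraction lmP contraction_pred). Qed.

Let lmF := deletion_matroidal lmP ha deletion_top_le deletion_top_image.

Lemma deletion_val_atoms (x : F) :
  face_atoms (deletion_poset_val x) = atoms_below (deletion_top x) :\ a.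
Proof. exact: (flat_atoms lmP deletion_pred). Qed.

Lemma deletion_faceE (al : prescheme_of F) :
  face_top (deletion_face al) = deletion_top (face_top al) /\
  face_atoms (deletion_face al) = deletion_top @: face_atoms al.
Proof.
have atE (x : F) : face_atoms (deletion_poset_val x) = deletion_top @: atoms_below x.
  by rewrite deletion_val_atoms (deletion_image_atoms lmP ha deletion_top_le deletion_top_image).
have sub : [set deletion_poset_val t | t in face_atoms al] \subset
    atoms_below (deletion_poset_val (face_top al)).
  apply/subsetP => _ /imsetP[t ta ->].
  have tx := subsetP (face_atoms_below lmF al) t ta.
  apply/(atom_faceP lmP); exists (deletion_top t); first by rewrite atE imset_f.
  split; first by [].
  have tA : rank t == 1%N by move: tx; rewrite atoms_belowE => /andP[h _]; exact: h.
  have tt : t \in atoms_below t by rewrite atoms_belowE tA lexx.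
  rewrite atE; apply/setP => z; rewrite in_set1; apply/imsetP/eqP => [[u ut ->]|->].
    have uA : rank u == 1%N by move: ut; rewrite atoms_belowE => /andP[h _]; exact: h.
    have ult : (u <= t)%O by move: ut; rewrite atoms_belowE => /andP[_ h]; exact: h.
    have tA' : t \in atoms F by rewrite inE; exact: tA.
    have uA' : u \in atoms F by rewrite inE; exact: uA.
    by rewrite (atom_le_eq lmF uA' tA' ult).
  by exists t; [exact: tt|].
have [_ aE tE] := face_belowE lmP sub.
have im : [set face_top b | b in [set deletion_poset_val t | t in face_atoms al]]
    = deletion_top @: face_atoms al by rewrite -imset_comp.
rewrite im in aE tE; split; last exact: aE.
apply: (etrans tE); have := in_SP_face al.
rewrite (deletion_in_SP lmP ha deletion_top_le deletion_top_image).
by case/(in_SPP lmP).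
Qed.

End Instances.

Theorem theorem3p3p4 (d : Order.disp_t) (P : finPOrderType d)
    (hP : locally_geometric P)
    (r : rel P) (hr : linear_order_on (atoms P) r)
    (a : P) (ha : a \in atoms P)
    (r'' : rel (contraction_poset ha))
    (hr'' : linear_order_on (atoms (contraction_poset ha)) r'') :
  exists (i : {lrmorphism OS_poset (deletion_order ha r) -> OS_poset r})
         (p : {linear OS_poset r -> OS_poset r''}),
    [/\ forall al : prescheme_of (deletion_poset ha),
          al \in indep (prescheme_of (deletion_poset ha))
                   :\: bottoms (prescheme_of (deletion_poset ha)) ->
          i (OS_gen (face_order (deletion_order ha r)) al)
          = OS_gen (face_order r) (deletion_face al),
        injective i,
        forall x : OS_poset r, p x = 0 <-> exists y, i y = x
      & forall z : OS_poset r'', exists x, p x = z].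
Proof.
have lmP := locally_geometric_matroidal hP.
have Fle := deletion_top_le lmP (ha := ha); have Fim := deletion_top_image lmP ha.
have Cle := contraction_top_le lmP (ha := ha); have Cim := contraction_top_image lmP ha.
have top_lift (al : prescheme_of (deletion_poset ha)) :
  face_top (deletion_face al) = deletion_top (face_top al) by case: (deletion_faceE lmP al).
have atoms_lift (al : prescheme_of (deletion_poset ha)) :
  face_atoms (deletion_face al) = (@deletion_top _ _ _ ha) @: face_atoms al.
  by case: (deletion_faceE lmP al).
have [i iE] := deletion_linear_map lmP ha Fle Fim hr top_lift atoms_lift.
have imon := deletion_map_multiplicative lmP ha Fle Fim hr top_lift atoms_lift iE.
have iinj := deletion_map_injective lmP ha Fle Fim hr top_lift atoms_lift iE.
have [kappa kappaK] : exists kappa, cancel (@contraction_top _ _ _ ha) kappa.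
  by have [b _] := contraction_bottom Cle Cim; apply: embedding_retraction Cle b.
have [p pE] := contraction_linear_map lmP ha Cle Cim kappaK hr hr''.
have pi0 y : p (i y) = 0.
  have [c ->] := OS_spanned (deletion_matroidal lmP ha Fle Fim)
    (deletion_order_linear lmP Fle Fim hr) y.
  apply: linear_comp_span0 => al aI; rewrite (iE al aI).
  have lI := lift_face_indep lmP ha Fle Fim top_lift atoms_lift al.
  apply: (contraction_map_notin pE); first by rewrite lI; exact: aI.
  exact: (lift_face_notin lmP ha Fle Fim atoms_lift).
exists (lrmorphism_bundle imon), p; split.
- move=> al; rewrite in_setD => /andP[nab aI].
  have := iE al aI; rewrite /OS_face (negPf nab).
  rewrite (lift_face_bottom lmP ha Fle Fim atoms_lift) (negPf nab).
  exact.
- exact: iinj.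
- move=> x; split=> [px0|[y <-]]; last exact: pi0.
  have [c ->] := contraction_map_kernel lmP ha Cle Cim kappaK hr hr'' pE px0.
  apply: linear_span_image => al /andP[aI na].
  have [be bI lbe] := lift_face_surj lmP ha Fle Fim top_lift atoms_lift aI na.
  by exists (OS_face _ be); rewrite -lbe; exact: (iE be bI).
- exact: (contraction_map_surjective lmP ha Cle Cim kappaK hr hr'' pE).
Qed.
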